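(* Consider the Fourier-transformed wave equation (W) of the context, with the parameters $\gamma,\gamma_\pm,\delta_0,\delta_+$ defined there. Let $m_P\in\mathbb N_0$ be sufficiently large and $\rho_0$ sufficiently small, and for a solution $\hat\phi$ let $\hat\varphi_\pm$ be the quantities on $Z_P$ defined in the context. (Asymptotics) Given any $\hat\phi_0,\hat\phi_1:\mathbb R^d\to\mathbb C$, there is a unique solution $\hat\phi$ of (W) with $(\hat\phi,\partial_t\hat\phi)(T,\cdot)=(\hat\phi_0,\hat\phi_1)$. Moreover, for all $\xi\in\mathbb R^d$ the following limits exist and are finite: $$\hat\varphi_{+,0}(\xi):=\lim_{\tau\searrow0}\hat\varphi_+(\tau,\xi),\quad\hat\varphi_{-,0}(\xi):=\lim_{\tau\searrow0}\hat\varphi_-(\tau,\xi)\qquad\text{if }\gamma\ne0,$$ $$\hat\varphi_{+,0}(\xi):=\lim_{\tau\searrow0}[\hat\varphi_+-(\log z)\hat\varphi_-](\tau,\xi),\quad\hat\varphi_{-,0}(\xi):=\lim_{\tau\searrow0}\hat\varphi_-(\tau,\xi)\qquad\text{if }\gamma=0.$$ In addition, for all $\xi\in\mathbb R^d$, $$\langle\xi\rangle^{\gamma_+}|\hat\varphi_{+,0}(\xi)|+\langle\xi\rangle^{\gamma_-}|\hat\varphi_{-,0}(\xi)|\lesssim\langle\xi\rangle^{\delta_+}\big[\langle\xi\rangle^{1+\delta_0}|\hat\phi(T,\xi)|+\langle\xi\rangle^{\delta_0}|\partial_t\hat\phi(T,\xi)|\big].$$ (Scattering) Given $\hat\varphi_{\pm,0}:\mathbb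 R^d\to\mathbb C$, there is a unique solution $\hat\phi$ of (W) such that, for all $\xi\in\mathbb R^d$, $\lim_{\tau\searrow0}\hat\varphi_\pm(\tau,\xi)=\hat\varphi_{\pm,0}(\xi)$ if $\gamma\ne0$, respectively $\lim_{\tau\searrow0}[\hat\varphi_+-(\log z)\hat\varphi_-](\tau,\xi)=\hat\varphi_{+,0}(\xi)$ and $\lim_{\tau\searrow0}\hat\varphi_-(\tau,\xi)=\hat\varphi_{-,0}(\xi)$ if $\gamma=0$. In addition, for all $\xi\in\mathbb R^d$, $$\langle\xi\rangle^{1+\delta_0}|\hat\phi(T,\xi)|+\langle\xi\rangle^{\delta_0}|\partial_t\hat\phi(T,\xi)|\lesssim\langle\xi\rangle^{\delta_+}\big[\langle\xi\rangle^{\gamma_+}|\hat\varphi_{+,0}(\xi)|+\langle\xi\rangle^{\gamma_-}|\hat\varphi_{-,0}(\xi)|\big].$$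
   Context: Conventions. $\mathbb N=\{1,2,\dots\}$, $\mathbb N_0=\mathbb N\cup\{0\}$, $\imath=\sqrt{-1}$, $\langle\eta\rangle=(1+|\eta|^2)^{1/2}$. $A\lesssim B$ means $A\le CB$ with $C$ independent of $\xi$ and of the solution (it may depend on $T$, the coefficients, $m_P$, $\rho_0$). For $\beta>0$ and a normed space $X$, $\mathcal T^\beta([0,T];X)$ is the set of $f:[0,T]\to X$ of the form $f(t)=f_0+f_*(t)$ with $f_0\in X$, $f_*$ smooth on $(0,T]$, $f_*(0)=0$ and $|(t\partial_t)^kf_*|\le C_kt^\beta$ for all $k\in\mathbb N_0$; so $f(0)=f_0$. Equation. $T>0$, $d\in\mathbb N$, $\ell\in(-1,\infty)$, $\beta>0$, $a\in\mathcal T^\beta([0,T];\mathbb R^d\otimes\mathbb R^d)$, $b\in\mathcal T^\beta([0,T];\mathbb R^d)$, $c\in\mathcal T^\beta([0,T];\mathbb C^d)$, $g,h\in\mathcal T^\beta([0,T];\mathbb C)$, and $\sum_{i,j}a_{ij}(t)\xi_i\xi_j\ge\lambda_0|\xi|^2$ for all $(t,\xi)\in[0,T]\times\mathbb R^d$, some $\lambda_0>0$. For $\omega\in\mathbb S^{d-1}$: $\mathfrak a(t,\omega)=\sum a_{ij}(t)\omega_i\omega_j$, $\mathfrak b(t,\omega)=\sum b_i(t)\omega_i$, $\mathfrak c(t,\omega)=\sum c_i(t)\omega_i$, $\alpha(t,\omega)=\sqrt{\mathfrak a(t,\omega)+\mathfrak b^2(t,\omega)}$. The wave equation on $(0,T]\times\mathbb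 R^d$ is $$\partial_t^2\phi-t^{2\ell}\sum_{i,j}a_{ij}\partial^2_{x_ix_j}\phi+2t^\ell\sum_ib_i\partial^2_{tx_i}\phi+t^{\ell-1}\sum_ic_i\partial_{x_i}\phi+t^{-1}g\,\partial_t\phi+t^{-2}h\,\phi=0,$$ and its spatial Fourier transform, regarded for each $\xi\in\mathbb R^d$ as an ODE in $t\in(0,T]$ for $\hat\phi(\cdot,\xi)\in C^2((0,T];\mathbb C)$, is $$\text{(W)}\quad\partial_t^2\hat\phi+t^{2\ell}|\xi|^2\mathfrak a\,\hat\phi+2\imath t^\ell|\xi|\mathfrak b\,\partial_t\hat\phi+\imath t^{\ell-1}|\xi|\mathfrak c\,\hat\phi+t^{-1}g\,\partial_t\hat\phi+t^{-2}h\,\hat\phi=0,$$ where $\mathfrak a,\mathfrak b,\mathfrak c$ are evaluated at $(t,\xi/|\xi|)$ (terms with a factor $|\xi|$ are $0$ at $\xi=0$). Parameters. $\gamma=\sqrt{(g(0)-1)^2-4h(0)}\in\mathbb C$ (either square root), $\gamma_\pm=\frac{1+\operatorname{Re}(g(0)\pm\gamma)}{2(\ell+1)}$, $\delta_0=\frac{\operatorname{Re}g(0)-\ell}{2(\ell+1)}$, $\delta_+=\frac1{2(\ell+1)}\sup_{\omega\in\mathbb S^{d-1}}\frac{|\operatorname{Re}[\mathfrak c(0,\omega)-(\ell+g(0))\mathfrak b(0,\omega)]|}{\alpha(0,\omega)}$. Pseudodifferential zone. $\langle\langle\xi\rangle\rangle=\max_i\langle\xi_i\rangle^{1/(\ell+1)}$,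 $z=\langle\langle\xi\rangle\rangle t$, $\partial_z=\langle\langle\xi\rangle\rangle^{-1}\partial_t$, $Z_P=\{(t,\xi)\in(0,T]\times\mathbb R^d:z\le\rho_0\}$ with $\rho_0\in(0,1)$ small. $\mathcal S_*^q(Z_P)$ is the set of continuous $f:Z_P\to\mathbb C^2\otimes\mathbb C^2$ ($2\times2$ matrices), smooth in $t$ for each $\xi$, such that for some $p\in\mathbb N_0$ and all $k\in\mathbb N_0$, $|(z\partial_z)^kf|\le C_kz^q(1+|\log z|)^p$. Let $$\mathcal A_P=\begin{bmatrix}-t^{-1}&t^{-1}\\-t^{2\ell+1}|\xi|^2\mathfrak a-\imath t^\ell|\xi|\mathfrak c-t^{-1}h&-2\imath t^\ell|\xi|\mathfrak b-t^{-1}g\end{bmatrix},$$ and, writing $g_0=g(0)$, $$\gamma\ne0:\ M_P=\begin{bmatrix}\frac{g_0-1-\gamma}2&1\\\frac{g_0-1+\gamma}2&1\end{bmatrix},\ B_P=\begin{bmatrix}-\frac{g_0+1+\gamma}2&0\\0&-\frac{g_0+1-\gamma}2\end{bmatrix};$$ $$\gamma=0:\ M_P=\begin{bmatrix}\frac{3-g_0}2&-1\\\frac{g_0-1}2&1\end{bmatrix},\ B_P=\begin{bmatrix}-\frac{g_0+1}2&1\\0&-\frac{g_0+1}2\end{bmatrix}.$$ Set $R_P=\langle\langle\xi\rangle\rangle^{-1}(M_P\mathcal A_PM_P^{-1}-t^{-1}B_P)$ and $a_P=\min(\ell,-1+\beta)$. Fix sequences, $m\in\mathbb N$: $D_P^{(m)}\in\mathcal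 S_*^{m(a_P+1)-1}(Z_P)$ diagonal, $N_P^{(m)}\in\mathcal S_*^{m(a_P+1)}(Z_P)$, $R_P^{(m)}\in\mathcal S_*^{m(a_P+1)+a_P}(Z_P)$ such that, with $Q_P^{(m)}=I_2+\sum_{k=1}^mN_P^{(k)}$, $$R_P^{(m)}=\sum_{k=1}^m\partial_zN_P^{(k)}+Q_P^{(m)}(z^{-1}B_P+R_P)-\Big(z^{-1}B_P+\sum_{k=1}^mD_P^{(k)}\Big)Q_P^{(m)};\qquad Q_P^{(0)}=I_2.$$ (Objects on $Z_P$ for smaller $\rho_0$ are restrictions of those for larger $\rho_0$.) Finally, on $Z_P$, $$\gamma\ne0:\ \begin{bmatrix}\hat\varphi_+\\\hat\varphi_-\end{bmatrix}=\begin{bmatrix}t^{\frac{g_0+1+\gamma}2}&0\\0&t^{\frac{g_0+1-\gamma}2}\end{bmatrix}Q_P^{(m_P)}\begin{bmatrix}\frac{g_0-1-\gamma}{2t}\hat\phi+\partial_t\hat\phi\\\frac{g_0-1+\gamma}{2t}\hat\phi+\partial_t\hat\phi\end{bmatrix};$$ $$\gamma=0:\ \begin{bmatrix}\hat\varphi_+\\\hat\varphi_-\end{bmatrix}=t^{\frac{g_0+1}2}Q_P^{(m_P)}\begin{bmatrix}\frac{3-g_0}{2t}\hat\phi-\partial_t\hat\phi\\\frac{g_0-1}{2t}\hat\phi+\partial_t\hat\phi\end{bmatrix}.$$ *)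

(* Defs.v *)
From Stdlib Require Import Reals.
From mathcomp Require Import ssreflect ssrfun ssrbool eqtype fintype bigop.
From Coquelicot Require Import Coquelicot.

Local Open Scope R_scope.

(** Calculus on a subset [D] of the line: derivatives are taken within [D], so
    they are one-sided at an end point that belongs to [D]. *)

Definition is_deriv_on {V : NormedModule R_AbsRing}
    (D : R -> Prop) (f df : R -> V) : Prop :=
  forall t, D t ->
    @filterdiff R_AbsRing (AbsRing_NormedModule R_AbsRing) V
      f (within D (locally t)) (fun s => scal s (df t)).

Definition continuous_within {U V : UniformSpace}
    (D : U -> Prop) (f : U -> V) : Prop :=
  forall x, D x -> filterlim f (within D (locally x)) (locally (f x)).

(** [G k] is [(w(t) d/dt)^k f] on [D], for all [k]. *)
Definition is_iter_deriv {V : NormedModule R_AbsRing}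
    (D : R -> Prop) (w : R -> R) (f : R -> V) (G : nat -> R -> V) : Prop :=
  (forall t, D t -> G 0%nat t = f t) /\
  (forall k, exists dG : R -> V,
     is_deriv_on D (G k) dG /\
     forall t, D t -> G (S k) t = scal (w t) (dG t)).

Definition smooth_on {V : NormedModule R_AbsRing}
    (D : R -> Prop) (f : R -> V) : Prop :=
  exists G, is_iter_deriv D (fun _ => 1) f G.

(** The class [T^beta([0,T]; V)]; [f0] is then [f 0]. *)
Definition in_Tclass {V : NormedModule R_AbsRing}
    (T beta : R) (f : R -> V) : Prop :=
  exists (f0 : V) (fs : R -> V),
    (forall t, 0 <= t <= T -> f t = plus f0 (fs t)) /\
    fs 0 = zero /\
    smooth_on (fun t => 0 < t <= T) fs /\
    exists G : nat -> R -> V,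
      is_iter_deriv (fun t => 0 < t <= T) (fun t => t) fs G /\
      forall k, exists Ck : R,
        forall t, 0 < t <= T -> norm (G k t) <= Ck * Rpower t beta.

(** Vectors of [R^d]; the uniform structure is that of the maximum norm. *)
Definition vec (d : nat) : Type := 'I_d -> R.

Definition vnorm {d : nat} (xi : vec d) : R :=
  sqrt (\big[Rplus/0]_(i < d) (xi i) ^ 2).

Definition bracket (x : R) : R := sqrt (1 + x ^ 2).

(** [t^s] for [t > 0] and complex [s]. *)
Definition RpowerC (t : R) (s : C) : C :=
  (Rpower t (Re s) * cos (Im s * ln t), Rpower t (Re s) * sin (Im s * ln t)).

Definition mat2 : Type := @matrix C 2 2.

Definition mk2 (a b c d : C) : mat2 := [[a, b], [c, d]].

Definition col2 (a b : C) : @matrix C 2 1 := [[a], [b]].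

Definition entry {n m : nat} (A : @matrix C n m) (i j : nat) : C :=
  coeff_mat (RtoC 0) A i j.

Definition Mscal {n m : nat} (c : C) (A : @matrix C n m) : @matrix C n m :=
  mk_matrix n m (fun i j => Cmult c (entry A i j)).

Definition Msub {n m : nat} (A B : @matrix C n m) : @matrix C n m :=
  Mplus A (Mopp B).

Definition Minv (A : mat2) : mat2 :=
  Mscal (Cinv (entry A 0 0 * entry A 1 1 - entry A 0 1 * entry A 1 0))
    (mk2 (entry A 1 1) (- entry A 0 1)
         (- entry A 1 0) (entry A 0 0)).

Definition Msum (m : nat) (F : nat -> mat2) : mat2 :=
  sum_n_m (G := matrix_AbelianMonoid) F 1 m.

Definition Mdiagonal (A : mat2) : Prop := entry A 0 1 = 0 /\ entry A 1 0 = 0.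

Definition is_mat_deriv_on (D : R -> Prop) (F dF : R -> mat2) : Prop :=
  forall i j, (i < 2)%nat -> (j < 2)%nat ->
    is_deriv_on (V := C_R_NormedModule) D
      (fun t => entry (F t) i j) (fun t => entry (dF t) i j).

(** The coefficients of the wave equation
      phi_tt - t^(2l) sum a_ij phi_(x_i x_j) + 2 t^l sum b_i phi_(t x_i)
        + t^(l-1) sum c_i phi_(x_i) + t^(-1) g phi_t + t^(-2) h phi = 0
    on [(0,T] x R^d]. *)
Record wave_data (d : nat) := WaveData {
  wT : R;
  wl : R;
  wbeta : R;
  wa : R -> 'I_d -> 'I_d -> R;
  wb : R -> 'I_d -> R;
  wc : R -> 'I_d -> C;
  wg : R -> C;
  wh : R -> C
}.

Arguments wT {d}. Arguments wl {d}. Arguments wbeta {d}. Arguments wa {d}.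
Arguments wb {d}. Arguments wc {d}. Arguments wg {d}. Arguments wh {d}.

(** Membership of the vector- and matrix-valued coefficients in [T^beta] is
    componentwise membership. *)
Definition admissible {d : nat} (E : wave_data d) : Prop :=
  0 < wT E /\ -1 < wl E /\ 0 < wbeta E /\
  (forall i j, in_Tclass (V := R_NormedModule) (wT E) (wbeta E)
                 (fun t => wa E t i j)) /\
  (forall i, in_Tclass (V := R_NormedModule) (wT E) (wbeta E)
               (fun t => wb E t i)) /\
  (forall i, in_Tclass (V := C_R_NormedModule) (wT E) (wbeta E)
               (fun t => wc E t i)) /\
  in_Tclass (V := C_R_NormedModule) (wT E) (wbeta E) (wg E) /\
  in_Tclass (V := C_R_NormedModule) (wT E) (wbeta E) (wh E) /\
  exists lambda0 : R, 0 < lambda0 /\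
    forall t (xi : vec d), 0 <= t <= wT E ->
      lambda0 * vnorm xi ^ 2 <=
        \big[Rplus/0]_(i < d) \big[Rplus/0]_(j < d) (wa E t i j * xi i * xi j).

Definition fra {d : nat} (E : wave_data d) (t : R) (om : vec d) : R :=
  \big[Rplus/0]_(i < d) \big[Rplus/0]_(j < d) (wa E t i j * om i * om j).

Definition frb {d : nat} (E : wave_data d) (t : R) (om : vec d) : R :=
  \big[Rplus/0]_(i < d) (wb E t i * om i).

Definition frc {d : nat} (E : wave_data d) (t : R) (om : vec d) : C :=
  \big[Cplus/RtoC 0]_(i < d) Cmult (wc E t i) (RtoC (om i)).

Definition alpha {d : nat} (E : wave_data d) (t : R) (om : vec d) : R :=
  sqrt (fra E t om + frb E t om ^ 2).

(** The direction [xi / |xi|]; at [xi = 0] it is the zero vector, and is only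
    used multiplied by [|xi| = 0]. *)
Definition dir {d : nat} (xi : vec d) : vec d := fun i => xi i / vnorm xi.

(** [phi] solves the spatial Fourier transform of the wave equation,
    [phi(., xi)] being in [C^2((0,T]; C)] for each [xi], and [dphi] is its time
    derivative on [(0,T]]. *)
Definition solves_W {d : nat} (E : wave_data d)
    (phi dphi : R -> vec d -> C) : Prop :=
  forall xi : vec d, exists ddphi : R -> C,
    is_deriv_on (V := C_R_NormedModule) (fun t => 0 < t <= wT E)
      (fun t => phi t xi) (fun t => dphi t xi) /\
    is_deriv_on (V := C_R_NormedModule) (fun t => 0 < t <= wT E)
      (fun t => dphi t xi) ddphi /\
    continuous_within (U := R_UniformSpace) (V := C_UniformSpace)
      (fun t => 0 < t <= wT E) ddphi /\
    forall t, 0 < t <= wT E ->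
      (ddphi t
       + RtoC (Rpower t (2 * wl E) * vnorm xi ^ 2 * fra E t (dir xi)) * phi t xi
       + 2 * Ci * RtoC (Rpower t (wl E) * vnorm xi * frb E t (dir xi)) * dphi t xi
       + Ci * RtoC (Rpower t (wl E - 1) * vnorm xi) * frc E t (dir xi) * phi t xi
       + RtoC (/ t) * wg E t * dphi t xi
       + RtoC (/ t ^ 2) * wh E t * phi t xi
       = 0)%C.

(** [phi] is the only solution, as a function on [(0,T] x R^d], with
    the property [P], which may involve the time derivative. *)
Definition is_unique_solution {d : nat} (E : wave_data d)
    (P : (R -> vec d -> C) -> (R -> vec d -> C) -> Prop)
    (phi dphi : R -> vec d -> C) : Prop :=
  solves_W E phi dphi /\ P phi dphi /\
  forall psi dpsi, solves_W E psi dpsi -> P psi dpsi ->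
    forall t xi, 0 < t <= wT E -> psi t xi = phi t xi.

Definition has_final_data {d : nat} (E : wave_data d) (phi0 phi1 : vec d -> C)
    (phi dphi : R -> vec d -> C) : Prop :=
  forall xi, phi (wT E) xi = phi0 xi /\ dphi (wT E) xi = phi1 xi.

(** [gamma] is either square root of [(g(0)-1)^2 - 4 h(0)]. *)

Definition is_gamma {d : nat} (E : wave_data d) (gamma : C) : Prop :=
  (gamma * gamma = (wg E 0 - 1) * (wg E 0 - 1) - 4 * wh E 0)%C.

Definition gamma_plus {d : nat} (E : wave_data d) (gamma : C) : R :=
  (1 + Re (wg E 0%R + gamma)%C) / (2 * (wl E + 1)).

Definition gamma_minus {d : nat} (E : wave_data d) (gamma : C) : R :=
  (1 + Re (wg E 0%R - gamma)%C) / (2 * (wl E + 1)).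

Definition delta_zero {d : nat} (E : wave_data d) : R :=
  (Re (wg E 0) - wl E) / (2 * (wl E + 1)).

Definition delta_plus {d : nat} (E : wave_data d) : R :=
  / (2 * (wl E + 1)) *
  real (Lub_Rbar (fun x => exists om : vec d, vnorm om = 1 /\
    x = Rabs (Re (frc E 0%R om
                  - (RtoC (wl E) + wg E 0%R) * RtoC (frb E 0%R om))%C)
        / alpha E 0 om)).

Definition dbracket {d : nat} (E : wave_data d) (xi : vec d) : R :=
  \big[Rmax/0]_(i < d) Rpower (bracket (xi i)) (/ (wl E + 1)).

Definition zvar {d : nat} (E : wave_data d) (t : R) (xi : vec d) : R :=
  dbracket E xi * t.

Definition ZP {d : nat} (E : wave_data d) (rho : R) (t : R) (xi : vec d) : Prop :=
  0 < t <= wT E /\ zvar E t xi <= rho.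

(** Scalar entries of the class [S_*^q(Z_P)]: symbols of order [q] with logarithmic power [p]; [G k] is
    [(z d/dz)^k f], where [d/dz] is [1/dbracket] times [d/dt]. *)
Definition is_symbol {d : nat} (E : wave_data d) (rho q : R) (p : nat)
    (f : R -> vec d -> C) : Prop :=
  continuous_within
    (U := prod_UniformSpace R_UniformSpace
            (fct_UniformSpace 'I_d R_UniformSpace))
    (V := C_UniformSpace)
    (fun y => ZP E rho (fst y) (snd y)) (fun y => f (fst y) (snd y)) /\
  (forall xi, smooth_on (V := C_R_NormedModule)
     (fun t => ZP E rho t xi) (fun t => f t xi)) /\
  exists G : nat -> R -> vec d -> C,
    (forall xi, is_iter_deriv (V := C_R_NormedModule) (fun t => ZP E rho t xi)
       (fun t => zvar E t xi * / dbracket E xi)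
       (fun t => f t xi) (fun k t => G k t xi)) /\
    forall k, exists Ck : R, forall t xi, ZP E rho t xi ->
      Cmod (G k t xi) <=
        Ck * Rpower (zvar E t xi) q * (1 + Rabs (ln (zvar E t xi))) ^ p.

Definition in_Sclass {d : nat} (E : wave_data d) (rho q : R)
    (F : R -> vec d -> mat2) : Prop :=
  exists p : nat, forall i j, (i < 2)%nat -> (j < 2)%nat ->
    is_symbol E rho q p (fun t xi => entry (F t xi) i j).

Definition calA {d : nat} (E : wave_data d) (t : R) (xi : vec d) : mat2 :=
  mk2
    (- / RtoC t)
    (/ RtoC t)
    (- RtoC (Rpower t (2 * wl E + 1) * vnorm xi ^ 2 * fra E t (dir xi))
     - Ci * RtoC (Rpower t (wl E) * vnorm xi) * frc E t (dir xi)
     - / RtoC t * wh E t)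
    (- (2 * Ci * RtoC (Rpower t (wl E) * vnorm xi * frb E t (dir xi)))
     - / RtoC t * wg E t).

Definition MP {d : nat} (E : wave_data d) (gamma : C) : mat2 :=
  let g0 := wg E 0 in
  if Ceq_dec gamma 0
  then mk2 ((3 - g0) / 2) (- (1))
           ((g0 - 1) / 2) 1
  else mk2 ((g0 - 1 - gamma) / 2) 1
           ((g0 - 1 + gamma) / 2) 1.

Definition BP {d : nat} (E : wave_data d) (gamma : C) : mat2 :=
  let g0 := wg E 0 in
  if Ceq_dec gamma 0
  then mk2 (- ((g0 + 1) / 2)) 1
           0 (- ((g0 + 1) / 2))
  else mk2 (- ((g0 + 1 + gamma) / 2)) 0
           0 (- ((g0 + 1 - gamma) / 2)).

Definition RP {d : nat} (E : wave_data d) (gamma : C)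
    (t : R) (xi : vec d) : mat2 :=
  Mscal (RtoC (/ dbracket E xi))
    (Msub (Mmult (Mmult (MP E gamma) (calA E t xi)) (Minv (MP E gamma)))
          (Mscal (RtoC (/ t)) (BP E gamma))).

Definition aP {d : nat} (E : wave_data d) : R := Rmin (wl E) (-1 + wbeta E).

(** [QP N m] is [I_2] for [m = 0]. *)
Definition QP {d : nat} (N : nat -> R -> vec d -> mat2) (m : nat)
    (t : R) (xi : vec d) : mat2 :=
  Mplus Mone (Msum m (fun k => N k t xi)).

(** In the identity, [dN k] is [d/dt N^(k)], so that [d/dz N^(k)] is [dN k] divided by [dbracket]. *)
Definition diagonalization {d : nat} (E : wave_data d) (gamma : C) (rho : R)
    (D N Rem : nat -> R -> vec d -> mat2) : Prop :=
  (forall m, (1 <= m)%nat ->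
     in_Sclass E rho (INR m * (aP E + 1) - 1) (D m) /\
     (forall t xi, ZP E rho t xi -> Mdiagonal (D m t xi)) /\
     in_Sclass E rho (INR m * (aP E + 1)) (N m) /\
     in_Sclass E rho (INR m * (aP E + 1) + aP E) (Rem m)) /\
  exists dN : nat -> R -> vec d -> mat2,
    (forall k, (1 <= k)%nat -> forall xi,
       is_mat_deriv_on (fun t => ZP E rho t xi)
         (fun t => N k t xi) (fun t => dN k t xi)) /\
    forall m, (1 <= m)%nat -> forall t xi, ZP E rho t xi ->
      Rem m t xi =
        Msub
          (Mplus
             (Msum m (fun k => Mscal (RtoC (/ dbracket E xi)) (dN k t xi)))
             (Mmult (QP N m t xi)
                (Mplus (Mscal (RtoC (/ zvar E t xi)) (BP E gamma))
                       (RP E gamma t xi))))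
          (Mmult
             (Mplus (Mscal (RtoC (/ zvar E t xi)) (BP E gamma))
                    (Msum m (fun k => D k t xi)))
             (QP N m t xi)).

(** The column vector with entries [varphi_+], [varphi_-], for a function with
    values [phi] and time derivatives [dphi]. *)
Definition varphi {d : nat} (E : wave_data d) (gamma : C)
    (N : nat -> R -> vec d -> mat2) (mP : nat) (phi dphi : R -> vec d -> C)
    (t : R) (xi : vec d) : @matrix C 2 1 :=
  let g0 := wg E 0 in
  let u := phi t xi in
  let du := dphi t xi in
  if Ceq_dec gamma 0
  then Mscal (RpowerC t ((g0 + 1) / 2))
         (Mmult (QP N mP t xi)
            (col2 ((3 - g0) / (2 * RtoC t) * u - du)
                  ((g0 - 1) / (2 * RtoC t) * u + du)))
  else Mmult
         (Mmult
            (mk2 (RpowerC t ((g0 + 1 + gamma) / 2)) 0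
                 0 (RpowerC t ((g0 + 1 - gamma) / 2)))
            (QP N mP t xi))
         (col2 ((g0 - 1 - gamma) / (2 * RtoC t) * u + du)
               ((g0 - 1 + gamma) / (2 * RtoC t) * u + du)).

Definition varphi_plus {d : nat} (E : wave_data d) (gamma : C)
    (N : nat -> R -> vec d -> mat2) (mP : nat) (phi dphi : R -> vec d -> C)
    (t : R) (xi : vec d) : C :=
  entry (varphi E gamma N mP phi dphi t xi) 0 0.

Definition varphi_minus {d : nat} (E : wave_data d) (gamma : C)
    (N : nat -> R -> vec d -> mat2) (mP : nat) (phi dphi : R -> vec d -> C)
    (t : R) (xi : vec d) : C :=
  entry (varphi E gamma N mP phi dphi t xi) 1 0.

(** The limit [l] of [f(tau, xi)] as [tau] decreases to [0], for [f] defined on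
    the zone. *)
Definition is_lim_ZP {d : nat} (E : wave_data d) (rho : R)
    (f : R -> vec d -> C) (xi : vec d) (l : C) : Prop :=
  filterlim (fun tau => f tau xi)
    (within (fun tau => ZP E rho tau xi) (at_right 0)) (locally (T := C_UniformSpace) l).

Definition has_asymptotic_data {d : nat} (E : wave_data d) (gamma : C)
    (rho : R) (N : nat -> R -> vec d -> mat2) (mP : nat)
    (vp vm : vec d -> C) (phi dphi : R -> vec d -> C) : Prop :=
  forall xi,
    (gamma <> 0 ->
       is_lim_ZP E rho (varphi_plus E gamma N mP phi dphi) xi (vp xi) /\
       is_lim_ZP E rho (varphi_minus E gamma N mP phi dphi) xi (vm xi)) /\
    (gamma = 0 ->
       is_lim_ZP E rho
         (fun t x => (varphi_plus E gamma N mP phi dphi t x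
            - RtoC (ln (zvar E t x)) * varphi_minus E gamma N mP phi dphi t x)%C)
         xi (vp xi) /\
       is_lim_ZP E rho (varphi_minus E gamma N mP phi dphi) xi (vm xi)).

Definition asymptotic_size {d : nat} (E : wave_data d) (gamma : C)
    (vp vm : vec d -> C) (xi : vec d) : R :=
  Rpower (bracket (vnorm xi)) (gamma_plus E gamma) * Cmod (vp xi)
  + Rpower (bracket (vnorm xi)) (gamma_minus E gamma) * Cmod (vm xi).

Definition final_size {d : nat} (E : wave_data d)
    (phi dphi : R -> vec d -> C) (xi : vec d) : R :=
  Rpower (bracket (vnorm xi)) (1 + delta_zero E) * Cmod (phi (wT E) xi)
  + Rpower (bracket (vnorm xi)) (delta_zero E) * Cmod (dphi (wT E) xi).

(* Main.v *)
Require Import Defs.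
From Stdlib Require Import Reals Lra Lia IndefiniteDescription FunctionalExtensionality.
From mathcomp Require Import ssreflect ssrfun ssrbool eqtype seq fintype bigop.
From Coquelicot Require Import Coquelicot.

(** For each frequency the equation is a linear ordinary differential equation
    on the interval from 0 to [wT E], open at 0, so solutions exist and are
    unique ([picard], [classical_solution_unique]). The content of the theorem
    is that the transformed unknowns converge at the singular time 0, and that
    their limits and the data at the final time bound each other uniformly in
    the frequency. Write [J] for [dbracket], which is comparable with the
    [(l+1)]-st root of the bracket of [|xi|], and [z = J t].

    Near 0. Let [W = Q M (u / t, v)], with [v] the derivative of [u]. The
    identity for the remainder says that
    [W' = (B / t + J D) W + J Rem V] with [W = Q V]. The weights
    [t^e1] and [t^e2], and the subtraction of a logarithm if [gamma = 0],
    remove [B / t]. The matrix [D] is diagonal, hence compatible with the weights,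
    while the remainder loses at most the power [|Re gamma|] of [z], which it can
    afford when [mP] is large. The transformed system has coefficients
    of size [J z^(eta - 1)], whose integral over the zone is bounded
    independently of [J]; so limits exist and are comparable with [W] at the end of
    the zone ([integrable_system_limits], [fuchsian_pair_limits],
    [zone_estimate]).

    Away from 0. Put [lam = t^l |xi|], [w = v + i lam b u] and
    [y = lam alpha u]. Then
    [w' = - lam alpha y - i lam b w - (g / t) w - (i kappa / t) y] and
    [y' = lam alpha w - i lam b y + (l / t) y] up to integrable errors, with
    [kappa = (c - (l + g) b) / alpha]. The large terms are skew and do not change
    [|w|^2 + |y|^2]. The terms of order [1 / t] have three parts: the mean
    growth [(l - Re g) / t], which gives the exponent [delta_zero]; the part with
    [Re kappa], which is bounded by [2 (l + 1) delta_plus / t] and gives the loss;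
    and multiples of [|y|^2 - |w|^2] and of the inner product of [w] and [y]. These
    two forms rotate into each other with frequency [2 lam alpha], so a
    correction of the energy of relative size [1 / (t lam)] cancels them
    ([corrected_energy_rate], [oscillatory_energy]). This needs [t lam] large; where
    [t lam] is bounded a plain Gronwall estimate in the variable [ln t]
    suffices ([bounded_phase_comparison]). All these
    bounds are two-sided, and [outer_estimate] puts them together.

    Scattering. The map from the data at the final time to the limits is linear and
    the estimate shows that it is injective; being given by a 2 by 2 matrix
    at each frequency, it is bijective. *)

Local Open Scope R_scope.

(** * Comparison of functions through their derivatives *)

Lemma is_derive_continuity_pt (f : R -> R) (t l : R) :
  is_derive f t l -> continuity_pt f t.
Proof.
  move=> H; apply: derivable_continuous_pt; exists l; exact/is_derive_Reals.
Qed.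

(** Differentiability is only asked in the open interval: at the final time the
    coefficients of the equation are only continuous. *)
Lemma nondecreasing_of_derive (f df : R -> R) (a b : R) :
  a <= b ->
  (forall t, a < t < b -> is_derive f t (df t)) ->
  (forall t, a <= t <= b -> continuity_pt f t) ->
  (forall t, a < t < b -> 0 <= df t) -> f a <= f b.
Proof.
  move=> Hab Hd Hc Hp.
  pose df' t := if Rlt_dec a t then if Rlt_dec t b then df t else 0 else 0.
  have [c [_ Hfc]] : exists c, Rmin a b <= c <= Rmax a b /\ f b - f a = df' c * (b - a).
    apply: MVT_gen; rewrite (Rmin_left _ _ Hab) (Rmax_right _ _ Hab) // => x Hx.
    rewrite /df'; case: Rlt_dec => H1; last lra.
    case: Rlt_dec => H2; last lra.
    exact: Hd.
  have : 0 <= df' c.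
    rewrite /df'; case: (Rlt_dec a c) => H1 /=; last lra.
    case: (Rlt_dec c b) => H2 /=; last lra.
    exact: Hp.
  move=> H0; have := Rmult_le_pos _ (b - a) H0 ltac:(lra); lra.
Qed.

(** [G * exp (- (p + r))] decreases and [G * exp (- p + r)] increases. Having
    both bounds from one differential inequality is what makes every estimate
    below reversible, hence usable for asymptotics and for scattering. *)
Lemma gronwall (G dG p dp r dr : R -> R) (a b : R) :
  a <= b ->
  (forall t, a < t < b -> is_derive G t (dG t)) ->
  (forall t, a < t < b -> is_derive p t (dp t)) ->
  (forall t, a < t < b -> is_derive r t (dr t)) ->
  (forall t, a <= t <= b -> continuity_pt G t) ->
  (forall t, a <= t <= b -> continuity_pt p t) ->
  (forall t, a <= t <= b -> continuity_pt r t) ->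
  (forall t, a < t < b -> Rabs (dG t - dp t * G t) <= dr t * G t) ->
  G b <= G a * exp (p b - p a + (r b - r a)) /\
  G a <= G b * exp (- (p b - p a) + (r b - r a)).
Proof.
  move=> Hab HG Hp Hr cG cp cr HH.
  have cexp g t : continuity_pt g t -> continuity_pt (fun s => exp (g s)) t.
    move=> H; apply: (continuity_pt_comp g exp) => //.
    exact/derivable_continuous_pt/derivable_pt_exp.
  have E1 : G b * exp (- (p b + r b)) <= G a * exp (- (p a + r a)).
    apply: Ropp_le_cancel.
    apply: (nondecreasing_of_derive (fun t => - (G t * exp (- (p t + r t))))
      (fun t => - ((dG t - (dp t + dr t) * G t) * exp (- (p t + r t)))) a b Hab).
    - move=> t Ht; have H1 := HG t Ht; have H2 := Hp t Ht; have H3 := Hr t Ht.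
      auto_derive.
        by split; [exists (dG t)|split; [exists (dp t)|split; [exists (dr t)|]]].
      rewrite (is_derive_unique _ _ _ H1) (is_derive_unique _ _ _ H2)
        (is_derive_unique _ _ _ H3); ring.
    - move=> t Ht; apply/continuity_pt_opp/continuity_pt_mult; first exact: cG.
      apply: (cexp (fun s => - (p s + r s))).
      apply/continuity_pt_opp/continuity_pt_plus; [exact: cp|exact: cr].
    - move=> t Ht; have := HH t Ht => /Rabs_le_between.
      have := exp_pos (- (p t + r t)); nra.
  have E2 : G a * exp (- p a + r a) <= G b * exp (- p b + r b).
    apply: (nondecreasing_of_derive (fun t => (G t * exp (- p t + r t)))
      (fun t => ((dG t + (- dp t + dr t) * G t) * exp (- p t + r t))) a b Hab).
    - move=> t Ht; have H1 := HG t Ht; have H2 := Hp t Ht; have H3 := Hr t Ht.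
      auto_derive.
        by split; [exists (dG t)|split; [exists (dp t)|split; [exists (dr t)|]]].
      rewrite (is_derive_unique _ _ _ H1) (is_derive_unique _ _ _ H2)
        (is_derive_unique _ _ _ H3); ring.
    - move=> t Ht; apply/continuity_pt_mult; first exact: cG.
      apply: (cexp (fun s => - p s + r s)).
      apply/continuity_pt_plus; [apply/continuity_pt_opp; exact: cp|exact: cr].
    - move=> t Ht; have := HH t Ht => /Rabs_le_between.
      have := exp_pos (- p t + r t); nra.
  split.
  - have := Rmult_le_compat_r (exp (p b + r b)) _ _ (Rlt_le _ _ (exp_pos _)) E1.
    rewrite !Rmult_assoc -!exp_plus Rplus_opp_l exp_0 Rmult_1_r.
    by have -> : - (p a + r a) + (p b + r b) = p b - p a + (r b - r a) by ring.
  - have := Rmult_le_compat_r (exp (p a - r a)) _ _ (Rlt_le _ _ (exp_pos _)) E2.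
    rewrite !Rmult_assoc -!exp_plus.
    have -> : - p a + r a + (p a - r a) = 0 by ring.
    rewrite exp_0 Rmult_1_r.
    by have -> : - p b + r b + (p a - r a) = - (p b - p a) + (r b - r a) by ring.
Qed.

Lemma abs_increment_le_of_derive (f df g dg : R -> R) (a b : R) :
  a <= b ->
  (forall t, a < t < b -> is_derive f t (df t)) ->
  (forall t, a < t < b -> is_derive g t (dg t)) ->
  (forall t, a <= t <= b -> continuity_pt f t) ->
  (forall t, a <= t <= b -> continuity_pt g t) ->
  (forall t, a < t < b -> Rabs (df t) <= dg t) ->
  Rabs (f b - f a) <= g b - g a.
Proof.
  move=> Hab Hf Hg cf cg H.
  have H1 : g a - f a <= g b - f b.
    apply: (nondecreasing_of_derive (fun t => g t - f t) (fun t => dg t - df t)) => //.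
    - move=> t Ht; apply: (is_derive_minus (V := R_NormedModule)); [exact: Hg|exact: Hf].
    - move=> t Ht; apply: continuity_pt_minus; [exact: cg|exact: cf].
    - move=> t Ht; have /Rabs_le_between := H t Ht; lra.
  have H2 : g a + f a <= g b + f b.
    apply: (nondecreasing_of_derive (fun t => g t + f t) (fun t => dg t + df t)) => //.
    - move=> t Ht; apply: (is_derive_plus (V := R_NormedModule)); [exact: Hg|exact: Hf].
    - move=> t Ht; apply: continuity_pt_plus; [exact: cg|exact: cf].
    - move=> t Ht; have /Rabs_le_between := H t Ht; lra.
  apply/Rabs_le_between; lra.
Qed.

(** * Linear initial value problems *)


Lemma continuous_iff_continuity_pt (f : R -> R) t : continuous f t <-> continuity_pt f t.
Proof. by split => H; apply/continuity_pt_filterlim. Qed.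

Lemma continuity_pt_Rmin_r (T t : R) : continuity_pt (fun s => Rmin s T) t.
Proof.
  have E s : Rmin s T = (s + T - Rabs (s - T)) * / 2.
    rewrite /Rmin /Rabs; case: Rle_dec => /= H; case: Rcase_abs => /= H'; lra.
  apply: (continuity_pt_ext (fun s => (s + T - Rabs (s - T)) * / 2)) => [s|].
    by rewrite E.
  apply: continuity_pt_mult; last by apply: continuity_pt_const.
  apply: continuity_pt_minus.
    apply: continuity_pt_plus; last by apply: continuity_pt_const.
    exact: continuity_pt_id.
  apply: (continuity_pt_comp (fun s => s - T) Rabs); last exact: Rcontinuity_abs.
  apply: continuity_pt_minus; last by apply: continuity_pt_const.
  exact: continuity_pt_id.
Qed.

Lemma exp_le_compat (x y : R) : x <= y -> exp x <= exp y.
Proof. by case=> [H|->]; [exact/Rlt_le/exp_increasing|exact: Rle_refl]. Qed.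

Lemma geometric_Lim_seq (u : nat -> R) (K : R) :
  (forall n, Rabs (u (S n) - u n) <= K * (/ 2) ^ n) ->
  forall n, Rabs (real (Lim_seq u) - u n) <= 2 * K * (/ 2) ^ n.
Proof.
  move=> H.
  have Hpos n : 0 < (/ 2) ^ n by apply: pow_lt; lra.
  have K0 : 0 <= K by have := H 0%nat; have := Rabs_pos (u 1%nat - u 0%nat); rewrite /=; lra.
  have Hk n k : Rabs (u (n + k)%nat - u n) <= 2 * K * (/ 2) ^ n * (1 - (/ 2) ^ k).
    elim: k => [|k IH]; first by rewrite -plus_n_O Rminus_diag Rabs_R0 /=; lra.
    rewrite -plus_n_Sm.
    have -> : u (S (n + k)%nat) - u n = (u (S (n + k)%nat) - u (n + k)%nat) + (u (n + k)%nat - u n) by ring.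
    apply: Rle_trans (Rabs_triang _ _) _.
    have := H (n + k)%nat; rewrite pow_add /=; lra.
  have Hb n m : (n <= m)%nat -> Rabs (u m - u n) <= 2 * K * (/ 2) ^ n.
    move=> Hnm; have <- : (n + (m - n))%nat = m by lia.
    apply: Rle_trans (Hk _ _) _.
    have h := Rmult_le_pos _ _ K0 (Rlt_le _ _ (Hpos n)).
    have := Rmult_le_pos _ _ h (Rlt_le _ _ (Hpos (m - n)%nat)); lra.
  have : ex_finite_lim_seq u.
    apply/ex_lim_seq_cauchy_corr => eps.
    have Hl : is_lim_seq (fun n => 2 * K * (/ 2) ^ n) (2 * K * 0).
      apply: is_lim_seq_mult'; first exact: is_lim_seq_const.
      apply: is_lim_seq_geom; rewrite Rabs_pos_eq; lra.
    rewrite Rmult_0_r in Hl.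
    have [N HN] : exists N, 2 * K * (/ 2) ^ N < eps / 2.
      have he : 0 < eps / 2 by have := cond_pos eps; lra.
      move/is_lim_seq_spec: Hl => /(_ (mkposreal _ he)) [N HN]; exists N.
      have := HN N (le_n _); rewrite /= Rminus_0_r => h; have := Rle_abs (2 * K * (/ 2) ^ N); lra.
    exists N => n m Hn Hm.
    have -> : u n - u m = (u n - u N) - (u m - u N) by ring.
    have := Hb N n Hn; have := Hb N m Hm; have := Rabs_triang (u n - u N) (- (u m - u N)).
    rewrite Rabs_Ropp /Rminus; lra.
  move=> [l Hl] n; rewrite (is_lim_seq_unique _ _ Hl) /=.
  have Hl2 : is_lim_seq (fun k => u k - u n) (l - u n).
    apply: is_lim_seq_minus' => //; exact: is_lim_seq_const.
  have /is_lim_seq_abs Hl3 := Hl2.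
  change (Rbar_le (Rabs (l - u n)) (2 * K * (/ 2) ^ n)).
  apply: (is_lim_seq_le_loc _ (fun _ => 2 * K * (/ 2) ^ n) _ _ _ Hl3 (is_lim_seq_const _)).
  exists n => m Hm; exact: Hb.
Qed.

(** The right-hand side is only locally Lipschitz near the singular time 0, so
    the iterates converge uniformly on each [[a, T]] only, with constants that
    depend on [a]. Measuring vectors by a bound on all coordinates avoids a norm
    on the functions from [I] to [R]. *)
Lemma picard {I : Type} (F : R -> (I -> R) -> I -> R) (T : R) (y0 : I -> R) :
  0 < T ->
  (forall Y : R -> I -> R,
     (forall i t, 0 < t -> continuity_pt (fun s => Y s i) t) ->
     forall i t, 0 < t -> continuity_pt (fun s => F s (Y s) i) t) ->
  (forall a, 0 < a -> exists L, 0 < L /\ forall t y z M, a <= t <= T ->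
     (forall j, Rabs (y j - z j) <= M) ->
     forall i, Rabs (F t y i - F t z i) <= L * M) ->
  (forall a, 0 < a -> exists K, 0 <= K /\ forall t i, a <= t <= T -> Rabs (F t y0 i) <= K) ->
  exists z : R -> I -> R, (forall i, z T i = y0 i) /\
    forall t i, 0 < t <= T -> is_derive (fun s => z s i) t (F t (z t) i).
Proof.
  move=> T0 Hc HL HB.
  pose Y := fix Y (n : nat) : R -> I -> R := match n with
    | O => fun _ i => y0 i
    | S n => fun t i => y0 i + RInt (fun s => F s (Y n s) i) T t end.
  have der (f : R -> R) c : (forall t, 0 < t -> continuity_pt f t) ->
      forall t, 0 < t -> is_derive (fun t => c + RInt f T t) t (f t).
    move=> Hf t Ht.
    have -> : f t = plus 0 (f t) by rewrite /plus /=; ring.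
    apply: (is_derive_plus (V := R_NormedModule)); first exact: is_derive_const.
    apply: (is_derive_RInt f (RInt f T) T); last exact/continuous_iff_continuity_pt/Hf.
    exists (mkposreal _ Ht) => s /= Hs; apply: RInt_correct; apply: ex_RInt_continuous => x Hx.
    apply/continuous_iff_continuity_pt/Hf.
    move: Hs; rewrite /ball /= /AbsRing_ball /= /abs /minus /plus /opp /= => /Rabs_lt_between Hs.
    have : 0 < Rmin T s by apply: Rmin_glb_lt => //; lra.
    lra.
  have cY n : forall i t, 0 < t -> continuity_pt (fun s => Y n s i) t.
    elim: n => [|n IH] i t Ht; first by apply: continuity_pt_const => ? ?.
    apply: (is_derive_continuity_pt _ _ (F t (Y n t) i)).
    apply: (der (fun s => F s (Y n s) i)) => //; move=> s Hs; exact: Hc.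
  have dY n i t : 0 < t -> is_derive (fun s => Y (S n) s i) t (F t (Y n t) i).
    move=> Ht; apply: (der (fun s => F s (Y n s) i)) => // s Hs; apply: Hc => //; exact: cY.
  have YT n i : Y n T i = y0 i.
    by case: n => [|n] //=; rewrite RInt_point /zero /= Rplus_0_r.
  (* The weight [exp (2 * L * (T - t))] turns each integration into a factor 1/2,
     whatever the length of [a, T]. *)
  have conv a : 0 < a -> exists K, forall n t i, a <= t <= T ->
      Rabs (Y (S n) t i - Y n t i) <= K * (/ 2) ^ n.
    move=> a0; have [L [L0 HLa]] := HL a a0; have [K [K0 HKa]] := HB a a0.
    have W n : forall t i, a <= t <= T ->
        Rabs (Y (S n) t i - Y n t i) <= K * T * (/ 2) ^ n * exp (2 * L * (T - t)).
      elim: n => [|n IH] t i Ht.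
        have : Rabs (Y 1%nat T i - Y 1%nat t i) <= K * T - K * t.
          apply: (abs_increment_le_of_derive (fun s => Y 1%nat s i) (fun s => F s y0 i)
            (fun s => K * s) (fun _ => K)); first lra.
          - move=> s Hs; apply: (dY 0%nat); lra.
          - move=> s Hs; auto_derive => //; ring.
          - move=> s Hs; apply: cY; lra.
          - move=> s Hs; apply: continuity_pt_mult; [by apply: continuity_pt_const|exact: continuity_pt_id].
          - move=> s Hs; apply: HKa; lra.
        rewrite YT -Rabs_Ropp /= Ropp_minus_distr => h; apply: Rle_trans h _.
        have : 1 <= exp (2 * L * (T - t)).
          rewrite -exp_0; apply: exp_le_compat; nra.
        have : 0 <= K * T by nra.
        have : 0 <= K * t by nra.
        nra.
      have : Rabs ((Y (S (S n)) T i - Y (S n) T i) - (Y (S (S n)) t i - Y (S n) t i)) <=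
          - (K * T * (/ 2) ^ (S n) * exp (2 * L * (T - T))) - - (K * T * (/ 2) ^ (S n) * exp (2 * L * (T - t))).
        apply: (abs_increment_le_of_derive (fun s => Y (S (S n)) s i - Y (S n) s i)
            (fun s => F s (Y (S n) s) i - F s (Y n s) i)
            (fun s => - (K * T * (/ 2) ^ (S n) * exp (2 * L * (T - s))))
            (fun s => L * (K * T * (/ 2) ^ n * exp (2 * L * (T - s))))); first lra.
        - move=> s Hs; apply: (is_derive_minus (V := R_NormedModule)); apply: dY; lra.
        - move=> s Hs; auto_derive => //=; rewrite /Rminus; field.
        - move=> s Hs; apply: continuity_pt_minus; apply: cY; lra.
        - move=> s Hs; apply: (is_derive_continuity_pt _ _ (L * (K * T * (/ 2) ^ n * exp (2 * L * (T - s))))).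
          auto_derive => //=; rewrite /Rminus; field.
        - move=> s Hs; apply: HLa; first lra.
          move=> j; apply: IH; lra.
      rewrite !YT Rminus_diag Rminus_0_l Rabs_Ropp => h; apply: Rle_trans h _.
      have : 0 <= K * T * (/ 2) ^ S n * exp (2 * L * (T - T)).
        apply: Rmult_le_pos; last exact/Rlt_le/exp_pos.
        apply: Rmult_le_pos; first nra.
        by apply: pow_le; lra.
      lra.
    exists (K * T * exp (2 * L * (T - a))) => n t i Ht; apply: Rle_trans (W n t i Ht) _.
    rewrite Rmult_assoc [(/ 2) ^ n * _]Rmult_comm -Rmult_assoc.
    apply: Rmult_le_compat_r; first by apply: pow_le; lra.
    apply: Rmult_le_compat_l; first nra.
    apply: exp_le_compat; nra.
  (* Clamping at [T] makes the limit two-sidedly continuous at [T], so that the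
     solution obtained by integration is differentiable there. *)
  pose y t i := real (Lim_seq (fun n => Y n (Rmin t T) i)).
  have yb a : 0 < a -> exists K, 0 <= K /\ forall n t i, a <= t <= T -> Rabs (y t i - Y n t i) <= K * (/ 2) ^ n.
    move=> a0; have [K HK] := conv a a0; exists (2 * Rabs K); split; first by have := Rabs_pos K; lra.
    move=> n t i Ht; rewrite /y (Rmin_left t T); last lra.
    apply: (geometric_Lim_seq (fun n => Y n t i)) => m; apply: Rle_trans (HK m t i Ht) _.
    apply: Rmult_le_compat_r; [by apply: pow_le; lra|exact: Rle_abs].
  have Hpos n : 0 < (/ 2) ^ n by apply: pow_lt; lra.
  have small K e : 0 <= K -> 0 < e -> exists N, forall n, (N <= n)%nat -> K * (/ 2) ^ n < e.
    move=> K0 e0.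
    have he : 0 < e / (K + 1) by apply: Rdiv_lt_0_compat; lra.
    have h2 : Rabs (/ 2) < 1 by rewrite Rabs_pos_eq; lra.
    have [N HN] := pow_lt_1_zero (/ 2) h2 _ he; exists N => n Hn; have := HN n Hn.
    rewrite Rabs_pos_eq; last exact/Rlt_le.
    move=> /Rlt_div_r h; have := Hpos n; have := h ltac:(lra); nra.
  have cy i t : 0 < t -> continuity_pt (fun s => y s i) t.
    move=> Ht.
    have h2 : 0 < t / 2 by lra.
    apply: (CVU_continuity (fun n s => Y n (Rmin s T) i) (fun s => y s i) t (mkposreal _ h2)).
    - have a0 : 0 < Rmin (t / 2) T by apply: Rmin_glb_lt.
      have [K [K0 HK]] := yb _ a0.
      move=> e e0; have [N HN] := small K e K0 e0; exists N => n s Hn /Rabs_lt_between /= Hs.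
      have -> : y s i = y (Rmin s T) i by rewrite /y (Rmin_left (Rmin s T) T) //; exact: Rmin_r.
      apply: Rle_lt_trans (HN n Hn); apply: HK; split; last exact: Rmin_r.
      apply: Rmin_glb; last exact: Rmin_r.
      by apply: Rle_trans (Rmin_l _ _) _; lra.
    - move=> n s /Rabs_lt_between /= Hs.
      apply: (continuity_pt_comp (fun s => Rmin s T) (fun s => Y n s i)); first exact: continuity_pt_Rmin_r.
      apply: cY; apply: Rmin_glb_lt => //; lra.
    - by rewrite /Boule Rminus_diag Rabs_R0.
  pose z t i := y0 i + RInt (fun s => F (Rmin s T) (y (Rmin s T)) i) T t.
  have dz i t : 0 < t -> is_derive (fun s => z s i) t (F (Rmin t T) (y (Rmin t T)) i).
    move=> Ht; apply: (der (fun s => F (Rmin s T) (y (Rmin s T)) i)) => // s Hs.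
    apply: (continuity_pt_comp (fun s => Rmin s T) (fun s => F s (y s) i)); first exact: continuity_pt_Rmin_r.
    apply: Hc => //; exact: Rmin_glb_lt.
  have zT i : z T i = y0 i by rewrite /z RInt_point /zero /= Rplus_0_r.
  have zy t i : 0 < t <= T -> z t i = y t i.
    move=> Ht; have [K [K0 HK]] := yb t (proj1 Ht); have [L [L0 HLt]] := HL t (proj1 Ht).
    apply: Rminus_diag_uniq.
    have B n : Rabs (z t i - y t i) <= (L * K * T + K) * (/ 2) ^ n.
      have B1 : Rabs (y t i - Y (S n) t i) <= K * (/ 2) ^ S n by apply: HK; lra.
      have B2 : Rabs ((z T i - Y (S n) T i) - (z t i - Y (S n) t i)) <= L * (K * (/ 2) ^ n) * T - L * (K * (/ 2) ^ n) * t.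
        apply: (abs_increment_le_of_derive (fun s => z s i - Y (S n) s i)
            (fun s => F (Rmin s T) (y (Rmin s T)) i - F s (Y n s) i)
            (fun s => L * (K * (/ 2) ^ n) * s)
            (fun s => L * (K * (/ 2) ^ n))); first lra.
        - move=> s Hs; apply: (is_derive_minus (V := R_NormedModule)); [apply: dz; lra|apply: dY; lra].
        - move=> s Hs; auto_derive => //; ring.
        - move=> s Hs; apply: continuity_pt_minus; last by apply: cY; lra.
          apply: is_derive_continuity_pt; apply: dz; lra.
        - move=> s Hs; apply: continuity_pt_mult; [by apply: continuity_pt_const|exact: continuity_pt_id].
        - move=> s Hs; rewrite Rmin_left; last lra.
          apply: HLt; first lra.
          move=> j; apply: HK; lra.
      rewrite zT YT Rminus_diag Rminus_0_l Rabs_Ropp in B2.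
      have -> : z t i - y t i = (z t i - Y (S n) t i) - (y t i - Y (S n) t i) by ring.
      apply: Rle_trans (Rabs_triang _ _) _; rewrite Rabs_Ropp.
      have := Hpos n => hn.
      have h1 : 0 <= L * (K * (/ 2) ^ n) * t.
        apply: Rmult_le_pos; last lra.
        apply: Rmult_le_pos; first lra.
        by apply: Rmult_le_pos; lra.
      have h2 : 0 <= K * (/ 2) ^ n by apply: Rmult_le_pos; lra.
      have E2 : (/ 2) ^ S n = / 2 * (/ 2) ^ n by [].
      rewrite E2 in B1; lra.
    case: (Req_dec (z t i - y t i) 0) => // /Rabs_pos_lt Hn.
    have hK : 0 <= L * K * T + K.
      apply: Rplus_le_le_0_compat => //; apply: Rmult_le_pos; last lra.
      apply: Rmult_le_pos; lra.
    have [N HN] := small (L * K * T + K) _ hK Hn.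
    have := HN N (le_n _); have := B N; lra.
  exists z; split => // t i Ht.
  have [L [L0 HLt]] := HL t (proj1 Ht).
  have -> : F t (z t) i = F (Rmin t T) (y (Rmin t T)) i.
    rewrite Rmin_left; last lra.
    apply: Rminus_diag_uniq.
    have h : Rabs (F t (z t) i - F t (y t) i) <= L * 0.
      apply: HLt; first lra.
      move=> k; rewrite zy // Rminus_diag Rabs_R0; lra.
    case: (Req_dec (F t (z t) i - F t (y t) i) 0) => // /Rabs_pos_lt Hn; lra.
  apply: dz; lra.
Qed.

(** * Complex-valued functions of a real variable *)

(** Componentwise derivatives, so that the calculus of real functions applies. *)
Definition is_Cderive (f : R -> C) (t : R) (l : C) : Prop :=
  is_derive (fun s => Re (f s)) t (Re l) /\ is_derive (fun s => Im (f s)) t (Im l).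

Definition Ccont (f : R -> C) (t : R) : Prop :=
  continuity_pt (fun s => Re (f s)) t /\ continuity_pt (fun s => Im (f s)) t.

Lemma is_Cderive_Ccont f t l : is_Cderive f t l -> Ccont f t.
Proof. by move=> [H1 H2]; split; apply: is_derive_continuity_pt; eassumption. Qed.

Lemma is_Cderive_plus f g t l m :
  is_Cderive f t l -> is_Cderive g t m -> is_Cderive (fun s => (f s + g s)%C) t (l + m)%C.
Proof.
  by move=> [H1 H2] [H3 H4]; split; apply: (is_derive_plus (V := R_NormedModule)).
Qed.

Lemma is_Cderive_opp f t l : is_Cderive f t l -> is_Cderive (fun s => (- f s)%C) t (- l)%C.
Proof. by move=> [H1 H2]; split; apply: (is_derive_opp (V := R_NormedModule)). Qed.

Lemma is_Cderive_minus f g t l m :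
  is_Cderive f t l -> is_Cderive g t m -> is_Cderive (fun s => (f s - g s)%C) t (l - m)%C.
Proof. by move=> H1 H2; apply: is_Cderive_plus => //; apply: is_Cderive_opp. Qed.

Lemma is_derive_eq (f : R -> R) t l m : is_derive f t l -> l = m -> is_derive f t m.
Proof. by move=> H <-. Qed.

Lemma is_Cderive_eq (f : R -> C) t l m : is_Cderive f t l -> l = m -> is_Cderive f t m.
Proof. by move=> H <-. Qed.

Lemma is_derive_Rmult (f g : R -> R) t l m :
  is_derive f t l -> is_derive g t m -> is_derive (fun s => f s * g s) t (l * g t + f t * m).
Proof. by move=> H1 H2; apply: (is_derive_mult f g t l m H1 H2) => x y; exact: Rmult_comm. Qed.

Lemma is_Cderive_mult f g t l m :
  is_Cderive f t l -> is_Cderive g t m ->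
  is_Cderive (fun s => (f s * g s)%C) t (l * g t + f t * m)%C.
Proof.
  move=> [H1 H2] [H3 H4]; split => /=.
  - apply: is_derive_eq.
      apply: (is_derive_minus (V := R_NormedModule)); apply: is_derive_Rmult; eassumption.
    rewrite /minus /plus /opp /Re /Im /=; ring.
  - apply: is_derive_eq.
      apply: (is_derive_plus (V := R_NormedModule)); apply: is_derive_Rmult; eassumption.
    rewrite /minus /plus /opp /Re /Im /=; ring.
Qed.

Lemma is_Cderive_const (c : C) t : is_Cderive (fun _ => c) t (RtoC 0).
Proof. by split; apply: (is_derive_const (V := R_NormedModule)). Qed.

Lemma is_Cderive_lin (f g : R -> C) t l m (c c' : C) :
  is_Cderive f t l -> is_Cderive g t m ->
  is_Cderive (fun s => c * f s + c' * g s)%C t (c * l + c' * m)%C.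
Proof.
  move=> hf hg; apply: is_Cderive_eq.
    apply: is_Cderive_plus; apply: is_Cderive_mult;
      [exact: is_Cderive_const|exact: hf|exact: is_Cderive_const|exact: hg].
  cbv beta; ring.
Qed.

Lemma is_Cderive_RtoC (f : R -> R) t l : is_derive f t l -> is_Cderive (fun s => RtoC (f s)) t (RtoC l).
Proof. by move=> H; split => //=; apply: (is_derive_const (V := R_NormedModule)). Qed.

Lemma is_Cderive_ext_loc (f g : R -> C) t l a b :
  a < t < b -> (forall s, a < s < b -> f s = g s) -> is_Cderive f t l -> is_Cderive g t l.
Proof.
  move=> Ht H [H1 H2].
  have L : locally t (fun s => f s = g s).
    have h : 0 < Rmin (t - a) (b - t) by apply: Rmin_glb_lt; lra.
    exists (mkposreal _ h) => s; rewrite /ball /= /AbsRing_ball /abs /minus /plus /opp /= => /Rabs_lt_between Hs.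
    apply: H; have := Rmin_l (t - a) (b - t); have := Rmin_r (t - a) (b - t); lra.
  by split; [apply: is_derive_ext_loc H1|apply: is_derive_ext_loc H2]; case: L => e He; exists e => s Hs; rewrite He.
Qed.

Lemma Ccont_comp (f : R -> C) (g : R -> R) t :
  continuity_pt g t -> Ccont f (g t) -> Ccont (fun s => f (g s)) t.
Proof.
  by move=> H [H1 H2]; split; [apply: (continuity_pt_comp g (fun s => Re (f s)))|
     apply: (continuity_pt_comp g (fun s => Im (f s)))].
Qed.

Lemma Ccont_plus f g t : Ccont f t -> Ccont g t -> Ccont (fun s => (f s + g s)%C) t.
Proof. by move=> [H1 H2] [H3 H4]; split; apply: continuity_pt_plus. Qed.

Lemma Ccont_opp f t : Ccont f t -> Ccont (fun s => (- f s)%C) t.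
Proof. by move=> [H1 H2]; split; apply: continuity_pt_opp. Qed.

Lemma Ccont_mult f g t : Ccont f t -> Ccont g t -> Ccont (fun s => (f s * g s)%C) t.
Proof.
  move=> [H1 H2] [H3 H4]; split.
  - by apply: continuity_pt_minus; apply: continuity_pt_mult.
  - by apply: continuity_pt_plus; apply: continuity_pt_mult.
Qed.

Lemma Ccont_RtoC (f : R -> R) t : continuity_pt f t -> Ccont (fun s => RtoC (f s)) t.
Proof. by move=> H; split => //; apply: continuity_pt_const. Qed.

Lemma Ccont_const (c : C) t : Ccont (fun _ => c) t.
Proof. by split; apply: continuity_pt_const. Qed.

(** The real inner product of the plane; [2 * Cdot f f'] is the derivative of
    the square of the modulus. *)
Definition Cdot (x y : C) : R := Re x * Re y + Im x * Im y.

Lemma Cmod_sqr (x : C) : Cmod x ^ 2 = Re x ^ 2 + Im x ^ 2.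
Proof. by rewrite /Cmod /Re /Im /= !Rmult_1_r sqrt_sqrt //; nra. Qed.

Lemma Cmod_le_Rabs (x : C) : Cmod x <= Rabs (Re x) + Rabs (Im x).
Proof.
  have := Cmod_sqr x; rewrite -(pow2_abs (Re x)) -(pow2_abs (Im x)).
  have := Cmod_ge_0 x; have := Rabs_pos (Re x); have := Rabs_pos (Im x); nra.
Qed.

Lemma Rabs_Re_le (x : C) : Rabs (Re x) <= Cmod x.
Proof.
  have := Cmod_sqr x; rewrite -(pow2_abs (Re x)).
  have := Cmod_ge_0 x; have := Rabs_pos (Re x); nra.
Qed.

Lemma Rabs_Im_le (x : C) : Rabs (Im x) <= Cmod x.
Proof.
  have := Cmod_sqr x; rewrite -(pow2_abs (Im x)).
  have := Cmod_ge_0 x; have := Rabs_pos (Im x); nra.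
Qed.

Lemma Cdot_le (x y : C) : Rabs (Cdot x y) <= Cmod x * Cmod y.
Proof.
  have h := Rmult_le_pos _ _ (Cmod_ge_0 x) (Cmod_ge_0 y).
  rewrite -(Rabs_pos_eq _ h); apply: Rsqr_le_abs_0.
  rewrite Rsqr_mult /Rsqr.
  have := Cmod_sqr x; have := Cmod_sqr y; rewrite /= !Rmult_1_r /Cdot => -> ->.
  have := Rle_0_sqr (Re x * Im y - Im x * Re y); rewrite /Rsqr; nra.
Qed.

Lemma is_derive_Cmod_sqr (f : R -> C) t l :
  is_Cderive f t l -> is_derive (fun s => Cmod (f s) ^ 2) t (2 * Cdot (f t) l).
Proof.
  move=> [H1 H2].
  apply: (is_derive_ext (fun s => Re (f s) * Re (f s) + Im (f s) * Im (f s))).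
    by move=> s; rewrite Cmod_sqr /=; ring.
  apply: is_derive_eq.
    apply: (is_derive_plus (V := R_NormedModule)); apply: is_derive_Rmult; eassumption.
  rewrite /plus /= /Cdot; ring.
Qed.

Lemma continuity_pt_Cmod_sqr (f : R -> C) t :
  Ccont f t -> continuity_pt (fun s => Cmod (f s) ^ 2) t.
Proof.
  move=> [H1 H2].
  apply: (continuity_pt_ext (fun s => Re (f s) * Re (f s) + Im (f s) * Im (f s))).
    by move=> s; rewrite Cmod_sqr /=; ring.
  by apply: continuity_pt_plus; apply: continuity_pt_mult.
Qed.

Lemma Ccont_bounded (f : R -> C) a b :
  a <= b -> (forall t, a <= t <= b -> Ccont f t) ->
  exists M, 0 <= M /\ forall t, a <= t <= b -> Cmod (f t) <= M.
Proof.
  move=> Hab H.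
  have B (g : R -> R) : (forall t, a <= t <= b -> continuity_pt g t) ->
      exists M, forall t, a <= t <= b -> Rabs (g t) <= M.
    move=> Hg; have [x [Hx _]] := continuity_ab_maj (fun t => Rabs (g t)) a b Hab
       (fun t Ht => continuity_pt_comp g Rabs t (Hg t Ht) (Rcontinuity_abs _)).
    by exists (Rabs (g x)).
  have [M1 H1] := B _ (fun t Ht => proj1 (H t Ht)).
  have [M2 H2] := B _ (fun t Ht => proj2 (H t Ht)).
  exists (M1 + M2); split.
    have := H1 a ltac:(lra); have := H2 a ltac:(lra).
    have := Rabs_pos (Re (f a)); have := Rabs_pos (Im (f a)); lra.
  move=> t Ht; apply: Rle_trans (Cmod_le_Rabs (f t)) _.
  have := H1 t Ht; have := H2 t Ht; lra.
Qed.

(** The derivative of the energy [|u|^2 + |v|^2] is at most [4 * dr] times the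
    energy, so [gronwall] applies with [p = 0]. *)
Lemma pair_energy_bound (u v du dv : R -> C) (r dr : R -> R) (a b : R) :
  a <= b ->
  (forall t, a < t < b -> is_Cderive u t (du t) /\ is_Cderive v t (dv t) /\ is_derive r t (dr t)) ->
  (forall t, a <= t <= b -> Ccont u t /\ Ccont v t /\ continuity_pt r t) ->
  (forall t, a < t < b -> Cmod (du t) <= dr t * (Cmod (u t) + Cmod (v t)) /\
                          Cmod (dv t) <= dr t * (Cmod (u t) + Cmod (v t))) ->
  let G t := Cmod (u t) ^ 2 + Cmod (v t) ^ 2 in
  G b <= G a * exp (4 * (r b - r a)) /\ G a <= G b * exp (4 * (r b - r a)).
Proof.
  move=> Hab Hd Hc HH G.
  have [H1 H2] : G b <= G a * exp (0 - 0 + (4 * r b - 4 * r a)) /\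
                 G a <= G b * exp (- (0 - 0) + (4 * r b - 4 * r a)).
    refine (gronwall G (fun t => 2 * Cdot (u t) (du t) + 2 * Cdot (v t) (dv t))
      (fun _ => 0) (fun _ => 0) (fun t => 4 * r t) (fun t => 4 * dr t) a b Hab _ _ _ _ _ _ _).
    - move=> t Ht; have [h1 [h2 _]] := Hd t Ht.
      by apply: (is_derive_plus (V := R_NormedModule)); apply: is_derive_Cmod_sqr.
    - move=> t Ht; exact: is_derive_const.
    - move=> t Ht; have [_ [_ h]] := Hd t Ht.
      apply: is_derive_eq; first (apply: is_derive_Rmult; [exact: is_derive_const|exact: h]).
      rewrite /zero /=; ring.
    - move=> t Ht; have [h1 [h2 _]] := Hc t Ht.
      by apply: continuity_pt_plus; apply: continuity_pt_Cmod_sqr.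
    - by move=> t Ht; apply: continuity_pt_const.
    - move=> t Ht; have [_ [_ h]] := Hc t Ht.
      by apply: continuity_pt_mult => //; apply: continuity_pt_const.
    - move=> t Ht; rewrite Rmult_0_l Rminus_0_r /G.
      have [h1 h2] := HH t Ht.
      have := Cdot_le (u t) (du t); have := Cdot_le (v t) (dv t).
      have := Cmod_ge_0 (u t); have := Cmod_ge_0 (v t); have := Cmod_ge_0 (du t).
      move: h1 h2; set x := Cmod (u t); set y := Cmod (v t) => h1 h2 d0 y0 x0.
      move=> /Rabs_le_between k1 /Rabs_le_between k2.
      have m1 : x * Cmod (du t) <= x * (dr t * (x + y)) by apply: Rmult_le_compat_l.
      have m2 : y * Cmod (dv t) <= y * (dr t * (x + y)) by apply: Rmult_le_compat_l.
      have m3 : dr t * (x + y) ^ 2 <= dr t * (2 * (x ^ 2 + y ^ 2)).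
        case: (Rle_lt_or_eq_dec 0 (x + y)) => [|hp|hz]; first lra.
          apply: Rmult_le_compat_l; last by have := pow2_ge_0 (x - y); lra.
          apply: (Rmult_le_reg_r (x + y)) => //; lra.
        have -> : x = 0 by lra.
        have -> : y = 0 by lra.
        lra.
      apply/Rabs_le_between; nra.
  rewrite Rmult_minus_distr_l; split; [move: H1|move: H2].
  - by rewrite Rminus_diag Rplus_0_l.
  - by rewrite Rminus_diag Ropp_0 Rplus_0_l.
Qed.


Lemma ball_Rabs (x e y : R) : ball x e y <-> Rabs (y - x) < e.
Proof. by rewrite /ball /= /AbsRing_ball /= /abs /minus /plus /opp /=. Qed.

Lemma locally_open_interval (t a b : R) (D : R -> Prop) :
  a < t < b -> (forall s, a < s < b -> D s) -> locally t D.
Proof.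
  move=> Ht HD; have h : 0 < Rmin (t - a) (b - t) by apply: Rmin_glb_lt; lra.
  exists (mkposreal _ h) => s /ball_Rabs /Rabs_lt_between /= Hs.
  apply: HD; have := Rmin_l (t - a) (b - t); have := Rmin_r (t - a) (b - t); lra.
Qed.

(** Within a set that is a neighbourhood of [t], a derivative within the set is
    an ordinary one. *)
Lemma is_derive_of_within (D : R -> Prop) (f : R -> R) (t l : R) :
  locally t D ->
  filterdiff (K := R_AbsRing) (U := AbsRing_NormedModule R_AbsRing) (V := R_NormedModule)
    f (within D (locally t)) (fun s => scal s l) ->
  is_derive f t l.
Proof.
  move=> HD [Hl H]; split => // x Hx.
  have Ex : t = x by apply: (is_filter_lim_locally_unique (V := R_NormedModule)).
  rewrite -Ex => e.
  have /(_ e) H2 : is_domin (within D (locally t)) (fun y => minus y t)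
     (fun y => minus (minus (f y) (f t)) (scal (minus y t) l)).
    by apply: (H t) => P HP; rewrite /within; apply: filter_imp HP => y Hy _.
  by rewrite /within in H2; apply: filter_imp (filter_and _ _ H2 HD) => y [h1 h2]; exact: h1.
Qed.

Lemma filterdiff_C_components (F : (R -> Prop) -> Prop) (f : R -> C) (l : C) :
  Filter F ->
  filterdiff (K := R_AbsRing) (U := AbsRing_NormedModule R_AbsRing) (V := C_R_NormedModule)
    f F (fun s => scal s l) ->
  filterdiff (K := R_AbsRing) (U := AbsRing_NormedModule R_AbsRing) (V := R_NormedModule)
    (fun s => Re (f s)) F (fun s => scal s (Re l)) /\
  filterdiff (K := R_AbsRing) (U := AbsRing_NormedModule R_AbsRing) (V := R_NormedModule)
    (fun s => Im (f s)) F (fun s => scal s (Im l)).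
Proof.
  move=> FF H; split.
  - apply: (filterdiff_comp (V := C_R_NormedModule) f (fun z : C => Re z) _ (fun z : C => Re z) H).
    apply: filterdiff_linear; exact: (is_linear_fst (U := R_NormedModule) (V := R_NormedModule)).
  - apply: (filterdiff_comp (V := C_R_NormedModule) f (fun z : C => Im z) _ (fun z : C => Im z) H).
    apply: filterdiff_linear; exact: (is_linear_snd (U := R_NormedModule) (V := R_NormedModule)).
Qed.

Lemma is_deriv_on_is_derive (D : R -> Prop) (f df : R -> R) (t : R) :
  is_deriv_on (V := R_NormedModule) D f df -> D t -> locally t D -> is_derive f t (df t).
Proof. by move=> H Dt Ht; apply: is_derive_of_within Ht _; exact: H. Qed.

Lemma is_deriv_on_is_Cderive (D : R -> Prop) (f df : R -> C) (t : R) :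
  is_deriv_on (V := C_R_NormedModule) D f df -> D t -> locally t D -> is_Cderive f t (df t).
Proof.
  move=> H Dt Ht; have [H1 H2] := filterdiff_C_components _ _ _ _ (H t Dt).
  by split; apply: is_derive_of_within Ht _.
Qed.

Lemma is_Cderive_is_deriv_on (D : R -> Prop) (f df : R -> C) :
  (forall t, D t -> is_Cderive f t (df t)) -> is_deriv_on (V := C_R_NormedModule) D f df.
Proof.
  move=> H t Dt; have [H1 H2] := H t Dt.
  have PF : ProperFilter (within D (locally t)).
    split; last exact: within_filter.
    by move=> P [e He]; exists t; apply: He => //; exact: ball_center.
  apply: (filterdiff_locally _ t) => //.
    by move=> P HP; rewrite /within; apply: filter_imp HP => y Hy _.
  apply: (filterdiff_comp'_2 (U := R_NormedModule) (V := R_NormedModule) (W := C_R_NormedModule)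
     (fun s => Re (f s)) (fun s => Im (f s)) (fun x y => (x, y)) t (fun s => scal s (Re (df t)))
     (fun s => scal s (Im (df t))) (fun x y => (x, y))) => //.
  apply: (filterdiff_ext id) => [[x y] //|].
  apply: (filterdiff_ext_lin _ id) => [|[x y] //].
  exact: filterdiff_id.
Qed.

(** A one-sided derivative at the end point [T] gives only one-sided continuity
    there; composing with [Rmin s T] makes it two-sided, as the mean value
    theorem wants it. *)
Lemma continuity_pt_clamp_of_filterdiff (f l : R -> R) (T t : R) :
  0 < t ->
  (forall t, 0 < t <= T ->
  filterdiff (K := R_AbsRing) (U := AbsRing_NormedModule R_AbsRing) (V := R_NormedModule)
    f (within (fun s => 0 < s <= T) (locally t)) (fun s => scal s (l t))) -> 0 < T ->
  continuity_pt (fun s => f (Rmin s T)) t.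
Proof.
  move=> Ht H T0; apply/continuous_iff_continuity_pt.
  have ht : 0 < Rmin t T <= T by split; [exact: Rmin_glb_lt|exact: Rmin_r].
  have Hc : filterlim f (within (fun s => 0 < s <= T) (locally (Rmin t T))) (locally (f (Rmin t T))).
    apply: filterdiff_continuous_aux; first by exists (fun s => scal s (l (Rmin t T))); exact: H.
    by move=> P HP; rewrite /within; apply: filter_imp HP => y Hy _.
  apply: filterlim_comp Hc.
  have /continuous_iff_continuity_pt cm := continuity_pt_Rmin_r T t.
  move=> P /cm HP.
  have L : locally t (fun s => 0 < s).
    by apply: (locally_open_interval t 0 (t + 1)) => [|s]; lra.
  have L2 : locally t (fun s => 0 < s /\ (0 < Rmin s T <= T -> P (Rmin s T))) by apply: filter_and.
  apply: filter_imp L2 => s [h1 h2]; apply: h2; split; last exact: Rmin_r.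
  exact: Rmin_glb_lt.
Qed.

Lemma is_deriv_on_continuity_clamp (f df : R -> R) (T t : R) :
  0 < T -> is_deriv_on (V := R_NormedModule) (fun t => 0 < t <= T) f df -> 0 < t ->
  continuity_pt (fun s => f (Rmin s T)) t.
Proof. by move=> T0 H Ht; apply: (continuity_pt_clamp_of_filterdiff f df). Qed.

Lemma is_deriv_on_Ccont_clamp (f df : R -> C) (T t : R) :
  0 < T -> is_deriv_on (V := C_R_NormedModule) (fun t => 0 < t <= T) f df -> 0 < t ->
  Ccont (fun s => f (Rmin s T)) t.
Proof.
  move=> T0 H Ht; split.
  - apply: (continuity_pt_clamp_of_filterdiff (fun s => Re (f s)) (fun s => Re (df s))) => // s Hs.
    exact: (proj1 (filterdiff_C_components _ _ _ _ (H s Hs))).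
  - apply: (continuity_pt_clamp_of_filterdiff (fun s => Im (f s)) (fun s => Im (df s))) => // s Hs.
    exact: (proj2 (filterdiff_C_components _ _ _ _ (H s Hs))).
Qed.

(** * Second-order linear equations on a half-open interval *)

(** Solutions of [u'' + p u' + q u = 0] with [v = u'], in the weakest form that
    the estimates need: the derivatives at the end point [T] are not mentioned,
    so that clamped solutions qualify. *)
Definition is_classical_solution (T : R) (p q u v : R -> C) : Prop :=
  (forall t, 0 < t < T ->
     is_Cderive u t (v t) /\ is_Cderive v t (- (q t * u t) - p t * v t)%C) /\
  (forall t, 0 < t <= T -> Ccont u t /\ Ccont v t).

Definition component (i : bool * bool) (u v : C) : R :=
  let z := if fst i then v else u in if snd i then Im z else Re z.

Lemma Rabs_component_le (i : bool * bool) (u v : C) : Rabs (component i u v) <= Cmod u + Cmod v.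
Proof.
  have := Cmod_ge_0 u; have := Cmod_ge_0 v.
  case: i => [[] []]; rewrite /component /=; [have := Rabs_Im_le v|have := Rabs_Re_le v|
    have := Rabs_Im_le u|have := Rabs_Re_le u]; lra.
Qed.

Lemma initial_value_problem (T : R) (p q : R -> C) (c0 c1 : C) :
  0 < T ->
  (forall t, 0 < t -> Ccont (fun s => p (Rmin s T)) t) ->
  (forall t, 0 < t -> Ccont (fun s => q (Rmin s T)) t) ->
  exists u v : R -> C, u T = c0 /\ v T = c1 /\ forall t, 0 < t <= T ->
    is_Cderive u t (v t) /\ is_Cderive v t (- (q t * u t) - p t * v t)%C.
Proof.
  move=> T0 cp cq.
  pose U (y : bool * bool -> R) : C := (y (false, false), y (false, true)).
  pose V (y : bool * bool -> R) : C := (y (true, false), y (true, true)).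
  pose W t y := (- (q (Rmin t T) * U y) - p (Rmin t T) * V y)%C.
  pose F t (y : bool * bool -> R) i := component i (V y) (W t y).
  have lip a : 0 < a -> exists L, 0 < L /\ forall t y z M, a <= t <= T ->
     (forall j, Rabs (y j - z j) <= M) -> forall i, Rabs (F t y i - F t z i) <= L * M.
    move=> a0; case: (Rle_dec a T) => haT; last by exists 1; split => [|t *]; lra.
    have [Mp [Mp0 Hp]] := Ccont_bounded _ a T haT (fun t Ht => cp t ltac:(lra)).
    have [Mq [Mq0 Hq]] := Ccont_bounded _ a T haT (fun t Ht => cq t ltac:(lra)).
    exists (2 + 2 * Mq + 2 * Mp); split; first lra.
    move=> t y z M Ht H i.
    have -> : F t y i - F t z i = component i (V y - V z)%C (W t y - W t z)%C.
      by case: i => [[] []].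
    apply: Rle_trans (Rabs_component_le _ _ _) _.
    have hU : Cmod (U y - U z)%C <= 2 * M.
      apply: Rle_trans (Cmod_le_Rabs _) _; have := H (false, false); have := H (false, true); rewrite /= /Rminus; lra.
    have hV : Cmod (V y - V z)%C <= 2 * M.
      apply: Rle_trans (Cmod_le_Rabs _) _; have := H (true, false); have := H (true, true); rewrite /= /Rminus; lra.
    have -> : (W t y - W t z = - (q (Rmin t T) * (U y - U z)) - p (Rmin t T) * (V y - V z))%C by rewrite /W; ring.
    have h1 : Cmod (- (q (Rmin t T) * (U y - U z)) - p (Rmin t T) * (V y - V z))%C <= Mq * (2 * M) + Mp * (2 * M).
      apply: Rle_trans (Cmod_triangle _ _) _; rewrite !Cmod_opp !Cmod_mult.
      apply: Rplus_le_compat; apply: Rmult_le_compat => //; try exact: Cmod_ge_0; [exact: Hq|exact: Hp].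
    lra.
  have HC (Y : R -> bool * bool -> R) : (forall i t, 0 < t -> continuity_pt (fun s => Y s i) t) ->
     forall i t, 0 < t -> continuity_pt (fun s => F s (Y s) i) t.
    move=> cY i t Ht.
    have cU : Ccont (fun s => U (Y s)) t by split; exact: cY.
    have cV : Ccont (fun s => V (Y s)) t by split; exact: cY.
    have cW : Ccont (fun s => W s (Y s)) t.
      apply: Ccont_plus; apply: Ccont_opp; apply: Ccont_mult => //; [exact: cq|exact: cp].
    by case: i => [[] []]; [case: cW|case: cW|case: cV|case: cV].
  have HB a : 0 < a -> exists K, 0 <= K /\ forall t i, a <= t <= T -> Rabs (F t (fun i => component i c0 c1) i) <= K.
    move=> a0; have [L [L0 HL]] := lip a a0.
    exists (L * (Cmod c0 + Cmod c1)); split.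
      apply: Rmult_le_pos; [lra|have := Cmod_ge_0 c0; have := Cmod_ge_0 c1; lra].
    move=> t i Ht.
    have -> : F t (fun i => component i c0 c1) i = F t (fun i => component i c0 c1) i - F t (fun _ => 0) i.
      by case: i => [[] []]; rewrite /F /component /= ; ring.
    apply: HL => // j; rewrite Rminus_0_r; exact: Rabs_component_le.
  have [z [zT Hz]] := picard F T (fun i => component i c0 c1) T0 HC lip HB.
  exists (fun t => U (z t)), (fun t => V (z t)); split; first by rewrite /U !zT; case: (c0).
    split; first by rewrite /V !zT; case: (c1).
    move=> t Ht; split; split; rewrite /=.
    + exact: (Hz t (false, false)).
    + exact: (Hz t (false, true)).
    + have := Hz t (true, false) Ht; by rewrite /F /W /component /= Rmin_left //; lra.
    + have := Hz t (true, true) Ht; by rewrite /F /W /component /= Rmin_left //; lra.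
Qed.

Lemma classical_solution_unique (T : R) (p q u v : R -> C) :
  0 < T ->
  (forall t, 0 < t -> Ccont (fun s => p (Rmin s T)) t) ->
  (forall t, 0 < t -> Ccont (fun s => q (Rmin s T)) t) ->
  is_classical_solution T p q u v -> u T = RtoC 0 -> v T = RtoC 0 ->
  forall t, 0 < t <= T -> u t = RtoC 0 /\ v t = RtoC 0.
Proof.
  move=> T0 cp cq [Hd Hc] u0 v0 t Ht.
  have [Mp [Mp0 Hp]] := Ccont_bounded _ t T ltac:(lra) (fun s Hs => cp s ltac:(lra)).
  have [Mq [Mq0 Hq]] := Ccont_bounded _ t T ltac:(lra) (fun s Hs => cq s ltac:(lra)).
  have E : Cmod (u t) ^ 2 + Cmod (v t) ^ 2 <=
      (Cmod (u T) ^ 2 + Cmod (v T) ^ 2) * exp (4 * ((1 + Mp + Mq) * T - (1 + Mp + Mq) * t)).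
    apply: (proj2 (pair_energy_bound u v v (fun s => - (q s * u s) - p s * v s)%C
      (fun s => (1 + Mp + Mq) * s) (fun _ => 1 + Mp + Mq) t T ltac:(lra) _ _ _)).
    - move=> s Hs; have [h1 h2] := Hd s ltac:(lra); do 2!split => //; auto_derive => //; ring.
    - move=> s Hs; have [h1 h2] := Hc s ltac:(lra); do 2!split => //.
      by apply: continuity_pt_mult; [apply: continuity_pt_const|exact: continuity_pt_id].
    - move=> s Hs; have := Cmod_ge_0 (u s); have := Cmod_ge_0 (v s) => hv hu.
      have g1 := Rmult_le_pos _ _ Mp0 hu; have g2 := Rmult_le_pos _ _ Mp0 hv.
      have g3 := Rmult_le_pos _ _ Mq0 hu; have g4 := Rmult_le_pos _ _ Mq0 hv.
      split; first lra.
      apply: Rle_trans (Cmod_triangle _ _) _; rewrite !Cmod_opp !Cmod_mult.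
      have h1 : Cmod (q s) * Cmod (u s) <= Mq * Cmod (u s).
        apply: Rmult_le_compat_r => //; have := Hq s ltac:(lra); rewrite Rmin_left //; lra.
      have h2 : Cmod (p s) * Cmod (v s) <= Mp * Cmod (v s).
        apply: Rmult_le_compat_r => //; have := Hp s ltac:(lra); rewrite Rmin_left //; lra.
      lra.
  rewrite u0 v0 Cmod_0 in E.
  have hu := pow2_ge_0 (Cmod (u t)); have hv := pow2_ge_0 (Cmod (v t)).
  have E0 : (0 ^ 2 + 0 ^ 2) * exp (4 * ((1 + Mp + Mq) * T - (1 + Mp + Mq) * t)) = 0 by ring.
  split; apply: Cmod_eq_0; apply: Rsqr_0_uniq; rewrite Rsqr_pow2; lra.
Qed.

(** * The energy estimate in the oscillatory region *)

Lemma Rabs_mult_le (x y a b : R) : Rabs x <= a -> Rabs y <= b -> Rabs (x * y) <= a * b.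
Proof. by move=> H1 H2; rewrite Rabs_mult; apply: Rmult_le_compat => //; exact: Rabs_pos. Qed.

Lemma Rabs_plus_le (x y a b : R) : Rabs x <= a -> Rabs y <= b -> Rabs (x + y) <= a + b.
Proof. move=> H1 H2; apply: Rle_trans (Rabs_triang _ _) _; lra. Qed.

Lemma Rabs_minus_le (x y a b : R) : Rabs x <= a -> Rabs y <= b -> Rabs (x - y) <= a + b.
Proof. by move=> H1 H2; apply: Rabs_plus_le => //; rewrite Rabs_Ropp. Qed.

(** The pointwise cancellation. The quadratic forms [A] and [B] rotate into each
    other at the large frequency [2 * th], so adding [eta * L] with
    [2 * th * eta] close to [s] to the energy [P] removes the terms of order [s]
    that contain [A] and [B]: what is left of order [s] is the multiple
    [l - gr] of the energy and the term with [kr], and everything else is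
    of the integrable order [eps]. Here [s] stands for [/ t]. *)
Lemma corrected_energy_rate (C s eta eps l gr kr ki rho D P A B S EP EA EB th : R) :
  1 <= C -> 0 <= s -> 0 <= eta -> 0 <= eps -> 4 * C * eta <= 1 -> s * eta <= C * eps ->
  Rabs (s * (1 - rho)) <= C * eps -> 2 * th * eta = s * rho ->
  Rabs A <= P -> Rabs B <= P -> Rabs S <= P ->
  Rabs EP <= C * eps * P -> Rabs EA <= (C * s + C * eps) * P ->
  Rabs EB <= (C * s + C * eps) * P ->
  Rabs (l + gr) <= C -> Rabs (l - gr) <= C -> Rabs (l + 1) <= C -> Rabs ki <= C ->
  Rabs kr <= C -> Rabs kr <= D ->
  let L := (l + gr) * B - ki * A in
  let G := P + eta * L in
  let dP := (l - gr) * s * P + (l + gr) * s * A - kr * s * S + ki * s * B + EP in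
  let dA := 2 * th * B + EA in
  let dB := - (2 * th * A) + EB in
  P <= 2 * G /\ G <= 2 * P /\
  Rabs (dP + - ((l + 1) * s * eta) * L + eta * ((l + gr) * dB - ki * dA) - (l - gr) * s * G)
    <= (D * s + 2 * (C + 4 * C ^ 2 + 8 * C ^ 3) * eps) * G.
Proof.
  move=> C1 s0 eta0 eps0 Ceta seta Hrho Hth HA HB HS HEP HEA HEB h1 h2 h3 hki hkr hD L G dP dA dB.
  have P0 : 0 <= P by apply: Rle_trans HA; exact: Rabs_pos.
  have HL : Rabs L <= 2 * C * P.
    apply: Rle_trans (Rabs_minus_le _ _ _ _ (Rabs_mult_le _ _ _ _ h1 HB) (Rabs_mult_le _ _ _ _ hki HA)) _; lra.
  have aeta : Rabs eta <= eta by rewrite Rabs_pos_eq //; lra.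
  have as_ : Rabs s <= s by rewrite Rabs_pos_eq //; lra.
  have ase : Rabs (s * eta) <= C * eps by rewrite Rabs_pos_eq //; exact: Rmult_le_pos.
  have HetaL : Rabs (eta * L) <= eta * (2 * C * P) by exact: Rabs_mult_le.
  have HetaL2 : eta * (2 * C * P) <= P / 2.
    have := Rmult_le_compat_r _ _ _ P0 Ceta; lra.
  have [G1 G2] : P <= 2 * G /\ G <= 2 * P.
    move/Rabs_le_between: HetaL => HetaL; rewrite /G; lra.
  split => //; split => //.
  have -> : dP + - ((l + 1) * s * eta) * L + eta * ((l + gr) * dB - ki * dA) - (l - gr) * s * G =
    - (kr * (s * S)) + (((l + gr) * A + ki * B) * (s * (1 - rho)) + EP
    + (- ((l + 1) + (l - gr))) * ((s * eta) * L) + eta * ((l + gr) * EB - ki * EA)).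
    have Hth' : eta * ((l + gr) * dB - ki * dA) =
      - ((l + gr) * A + ki * B) * (2 * th * eta) + eta * ((l + gr) * EB - ki * EA).
      by rewrite /dA /dB; ring.
    rewrite Hth' Hth /dP /G; ring.
  have T1 : Rabs (((l + gr) * A + ki * B) * (s * (1 - rho))) <= (C * P + C * P) * (C * eps).
    by apply: Rabs_mult_le => //; apply: Rabs_plus_le; apply: Rabs_mult_le.
  have T2 : Rabs ((- ((l + 1) + (l - gr))) * ((s * eta) * L)) <= (C + C) * ((C * eps) * (2 * C * P)).
    by apply: Rabs_mult_le; [rewrite Rabs_Ropp; apply: Rabs_plus_le|apply: Rabs_mult_le].
  have T3 : Rabs (eta * ((l + gr) * EB - ki * EA)) <=
      eta * (C * ((C * s + C * eps) * P) + C * ((C * s + C * eps) * P)).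
    by apply: Rabs_mult_le => //; apply: Rabs_minus_le; apply: Rabs_mult_le.
  have T3' : eta * (C * ((C * s + C * eps) * P) + C * ((C * s + C * eps) * P)) <=
      2 * C ^ 3 * eps * P + 2 * C ^ 2 * eps * P.
    have -> : eta * (C * ((C * s + C * eps) * P) + C * ((C * s + C * eps) * P)) =
       2 * C ^ 2 * P * (s * eta) + 2 * C ^ 2 * P * eps * eta by ring.
    have hCP : 0 <= 2 * C ^ 2 * P by apply: Rmult_le_pos => //; nra.
    have hCPe : 0 <= 2 * C ^ 2 * P * eps by exact: Rmult_le_pos.
    have e1 : eta <= 1 by nra.
    have := Rmult_le_compat_l _ _ _ hCP seta; have := Rmult_le_compat_l _ _ _ hCPe e1; lra.
  have T4 : Rabs (kr * (s * S)) <= D * s * G + C * (2 * C) * (C * eps) * P.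
    have a1 : Rabs (kr * (s * S)) <= Rabs kr * (s * P) by apply: Rabs_mult_le; [lra|exact: Rabs_mult_le].
    have sG : P <= G + eta * (2 * C * P) by move/Rabs_le_between: HetaL => HetaL; rewrite /G; lra.
    have a2 : Rabs kr * (s * P) <= Rabs kr * (s * (G + eta * (2 * C * P))).
      by apply: Rmult_le_compat_l; [exact: Rabs_pos|exact: Rmult_le_compat_l].
    have sG0 : 0 <= s * G by apply: Rmult_le_pos => //; lra.
    have a3 : Rabs kr * (s * G) <= D * (s * G) by exact: Rmult_le_compat_r.
    have a4 : Rabs kr * ((s * eta) * (2 * C * P)) <= C * ((C * eps) * (2 * C * P)).
      have hCP : 0 <= 2 * C * P by apply: Rmult_le_pos => //; lra.
      apply: Rmult_le_compat => //; first exact: Rabs_pos.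
        apply: Rmult_le_pos => //; exact: Rmult_le_pos.
      exact: Rmult_le_compat_r.
    lra.
  have Ke : 0 <= (C + 4 * C ^ 2 + 8 * C ^ 3) * eps.
    apply: Rmult_le_pos => //; have := pow_lt C 2 ltac:(lra); have := pow_lt C 3 ltac:(lra); lra.
  have KG := Rmult_le_compat_l _ _ _ Ke G1.
  have T5 := Rabs_plus_le _ _ _ _ (Rabs_plus_le _ _ _ _ (Rabs_plus_le _ _ _ _ T1 HEP) T2) (Rle_trans _ _ _ T3 T3').
  rewrite -Rabs_Ropp in T4.
  apply: Rle_trans (Rabs_plus_le _ _ _ _ T4 T5) _.
  lra.
Qed.

Lemma is_derive_Cdot (f g : R -> C) t l m :
  is_Cderive f t l -> is_Cderive g t m ->
  is_derive (fun s => Cdot (f s) (g s)) t (Cdot l (g t) + Cdot (f t) m).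
Proof.
  move=> [H1 H2] [H3 H4]; apply: is_derive_eq.
    apply: (is_derive_plus (V := R_NormedModule)); apply: is_derive_Rmult; eassumption.
  rewrite /plus /= /Cdot; ring.
Qed.

Lemma continuity_pt_Cdot (f g : R -> C) t :
  Ccont f t -> Ccont g t -> continuity_pt (fun s => Cdot (f s) (g s)) t.
Proof. by move=> [H1 H2] [H3 H4]; apply: continuity_pt_plus; apply: continuity_pt_mult. Qed.

Lemma is_derive_Rpower (x t : R) : 0 < t -> is_derive (fun s => Rpower s x) t (x * Rpower t (x - 1)).
Proof. by move=> Ht; apply/is_derive_Reals; exact: derivable_pt_lim_power. Qed.

Lemma Rpower_pos (x y : R) : 0 < Rpower x y.
Proof. exact: exp_pos. Qed.

Lemma Rpower_minus_1 (t x : R) : 0 < t -> Rpower t (x - 1) = Rpower t x / t.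
Proof. by move=> Ht; rewrite Rpower_plus Rpower_Ropp Rpower_1. Qed.

Lemma energy_components_le (x y P : R) : 0 <= x -> 0 <= y -> P = x ^ 2 + y ^ 2 ->
  x ^ 2 <= P /\ y ^ 2 <= P /\ 2 * (x * y) <= P /\ (x + y) ^ 2 <= 2 * P.
Proof.
 move=> x0 y0 ->.
 have := pow2_ge_0 (x - y); 
 have := pow2_ge_0 x.
 have := pow2_ge_0 y => h1 h2 h3.
 by do 3 (split; first lra); lra. 
Qed.

Lemma Cmod_Ci_mult (z : C) : Cmod (Ci * z) = Cmod z.
Proof.
  rewrite Cmod_mult; have -> : Cmod Ci = 1; last by rewrite Rmult_1_l.
  by rewrite /Cmod /Ci; transitivity (sqrt 1); [congr sqrt; rewrite /=; ring|exact: sqrt_1].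
Qed.

(** [w] and [y] are coupled by the large rotation [th] and carry the common phase
    [sg], neither of which changes the energy. Of the terms of order [/ t], the
    mean of [l] and [- Re g0] gives the growth [l - Re g0], the real part of
    [ka] gives the unavoidable loss [D], and the remaining ones oscillate; they
    are removed with [corrected_energy_rate], [A] and [B] being
    [|y|^2 - |w|^2] and [2 <w, y>]. The correction has the size of the inverse of
    [X * t^(l+1)], so it is small compared with the energy only where that
    quantity is large. *)
Lemma oscillatory_energy (K0 l be T : R) :
  1 <= K0 -> -1 < l -> l + 1 <= K0 -> 0 < be -> 0 < T ->
  exists K, 0 < K /\
  forall (X al0 D t2 : R) (al sg : R -> R) (g0 ka : C) (w y e1 e2 : R -> C),
  0 < X -> 0 < t2 <= T -> 32 * K0 ^ 2 <= X * Rpower t2 (l + 1) ->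
  0 < al0 -> / (2 * al0) <= K0 ->
  (forall t, t2 < t < T -> Rabs (1 - al t / al0) <= K0 * Rpower t be) ->
  Cmod g0 <= K0 -> Cmod ka <= K0 -> Rabs (Re ka) <= D ->
  (forall t, t2 < t < T ->
     let th := X * Rpower t l * al t in
     is_Cderive w t (- (th * y t) - Ci * sg t * w t - g0 / t * w t - Ci * ka / t * y t + e1 t)%C /\
     is_Cderive y t (th * w t - Ci * sg t * y t + (l / t)%R * y t + e2 t)%C /\
     let eps := Rpower t (be - 1) + Rpower t (- l - 2) / X in
     Cmod (e1 t) <= K0 * eps * (Cmod (w t) + Cmod (y t)) /\
     Cmod (e2 t) <= K0 * eps * (Cmod (w t) + Cmod (y t))) ->
  (forall t, t2 <= t <= T -> Ccont w t /\ Ccont y t) ->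
  let P t := Cmod (w t) ^ 2 + Cmod (y t) ^ 2 in
  P T <= K * Rpower (T / t2) (l - Re g0 + D) * P t2 /\
  P t2 <= K * Rpower (T / t2) (- (l - Re g0) + D) * P T.
Proof.
  move=> K1 hl lK be0 T0.
  pose C' := 8 * K0.
  pose K' := 2 * (C' + 4 * C' ^ 2 + 8 * C' ^ 3).
  have K'0 : 0 <= K'.
    have c0 : 0 <= C' by rewrite /C'; lra.
    rewrite /K'; have := pow_le C' 2 c0; have := pow_le C' 3 c0; lra.
  exists (4 * exp (K' * (Rpower T be / be + / ((l + 1) * 1)))); split.
    by have := exp_pos (K' * (Rpower T be / be + / ((l + 1) * 1))); lra.
  move=> X al0 D t2 al sg g0 ka w y e1 e2 X0 [t20 t2T] HL al00 Hal0 Hal Hg0 Hka HD Hd Hc P.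
  pose gr := Re g0; pose ki := Im ka; pose kr := Re ka.
  pose A t := Cmod (y t) ^ 2 - Cmod (w t) ^ 2.
  pose B t := 2 * Cdot (w t) (y t).
  pose eta t := Rpower t (- l - 1) * / (2 * X * al0).
  pose L t := (l + gr) * B t - ki * A t.
  pose G t := P t + eta t * L t.
  pose th t := X * Rpower t l * al t.
  pose eps t := Rpower t (be - 1) + Rpower t (- l - 2) / X.
  pose dw t := (- (th t * y t) - Ci * sg t * w t - g0 / t * w t - Ci * ka / t * y t + e1 t)%C.
  pose dy t := (th t * w t - Ci * sg t * y t + (l / t)%R * y t + e2 t)%C.
  pose dP t := 2 * Cdot (w t) (dw t) + 2 * Cdot (y t) (dy t).
  pose dA t := 2 * Cdot (y t) (dy t) - 2 * Cdot (w t) (dw t).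
  pose dB t := 2 * (Cdot (dw t) (y t) + Cdot (w t) (dy t)).
  pose dG t := dP t + - ((l + 1) * / t * eta t) * L t + eta t * ((l + gr) * dB t - ki * dA t).
  have i2 : 0 < / (2 * X * al0) by apply: Rinv_0_lt_compat; nra.
  have eta0 t : 0 <= eta t by apply: Rmult_le_pos; [exact/Rlt_le/Rpower_pos|lra].
  have Heta t : t2 <= t -> 4 * C' * eta t <= 1.
    move=> Ht; have h : Rpower t2 (l + 1) <= Rpower t (l + 1) by apply: Rle_Rpower_l; lra.
    have E : Rpower t (- l - 1) * Rpower t (l + 1) = 1.
      rewrite -Rpower_plus; have -> : - l - 1 + (l + 1) = 0 by ring.
      by rewrite Rpower_O //; lra.
    have Hx : 32 * K0 ^ 2 <= X * Rpower t (l + 1).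
      by apply: Rle_trans HL _; apply: Rmult_le_compat_l => //; lra.
    have E2 : eta t * (X * Rpower t (l + 1)) = / (2 * al0).
      have -> : eta t * (X * Rpower t (l + 1)) = (Rpower t (- l - 1) * Rpower t (l + 1)) * (X * / (2 * X * al0)) by rewrite /eta; ring.
      rewrite E; field; lra.
    have h3 : eta t * (32 * K0 ^ 2) <= K0.
      apply: Rle_trans Hal0; rewrite -E2; exact: Rmult_le_compat_l.
    apply: (Rmult_le_reg_l K0); first lra.
    rewrite /C'; lra.
  have R0 t : 0 < t -> 0 < Rpower t (- l - 2) / X.
    by move=> Ht; apply: Rdiv_lt_0_compat => //; exact: Rpower_pos.
  have seta t : 0 < t -> / t * eta t = Rpower t (- l - 2) / X * / (2 * al0).
    move=> Ht; rewrite /eta; have -> : - l - 2 = (- l - 1) - 1 by ring.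
    rewrite (Rpower_minus_1 t (- l - 1)) //; field; lra.
  have point t : t2 < t < T ->
     P t <= 2 * G t /\ G t <= 2 * P t /\
     Rabs (dG t - (l - gr) * / t * G t) <= (D * / t + K' * eps t) * G t.
    move=> Ht.
    have [_ [_ [He1 He2]]] := Hd t Ht.
    have w0 := Cmod_ge_0 (w t); have y0 := Cmod_ge_0 (y t).
    have [b1 [b2 [b3 b4]]] := energy_components_le _ _ (P t) w0 y0 erefl.
    have t0 : 0 < t by lra.
    have s0 : 0 < / t by apply: Rinv_0_lt_compat.
    have eps0 : 0 <= eps t.
      by apply: Rplus_le_le_0_compat; [exact/Rlt_le/Rpower_pos|exact/Rlt_le/R0].
    have P0 : 0 <= P t by apply: Rplus_le_le_0_compat; exact: pow2_ge_0.
    have hC' : 1 <= C' by rewrite /C'; lra.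
    have cdot_e (x e : C) : Cmod x <= Cmod (w t) + Cmod (y t) ->
        Cmod e <= K0 * eps t * (Cmod (w t) + Cmod (y t)) -> Rabs (2 * Cdot x e) <= 4 * K0 * eps t * P t.
      move=> hx he; rewrite Rabs_mult (Rabs_pos_eq 2); last lra.
      have := Cdot_le x e.
      have : Cmod x * Cmod e <= (Cmod (w t) + Cmod (y t)) * (K0 * eps t * (Cmod (w t) + Cmod (y t))).
        by apply: Rmult_le_compat => //; exact: Cmod_ge_0.
      have hKe : 0 <= K0 * eps t by apply: Rmult_le_pos; lra.
      have := Rmult_le_compat_l _ _ _ hKe b4; lra.
    have f1 := cdot_e (w t) (e1 t) ltac:(lra) He1.
    have f2 := cdot_e (y t) (e2 t) ltac:(lra) He2.
    have f3 := cdot_e (y t) (e1 t) ltac:(lra) He1.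
    have f4 := cdot_e (w t) (e2 t) ltac:(lra) He2.
    have ae : forall z : R, 0 <= z -> Rabs z <= z by move=> z Hz; rewrite Rabs_pos_eq //; lra.
    have hgr : Rabs gr <= K0 by apply: Rle_trans (Rabs_Re_le _) _.
    have hkr : Rabs kr <= K0 by apply: Rle_trans (Rabs_Re_le _) _.
    have hki : Rabs ki <= K0 by apply: Rle_trans (Rabs_Im_le _) _.
    have hll : Rabs l <= 2 * K0 by apply/Rabs_le_between; lra.
    pose S t := 2 * Cdot (w t) (Ci * y t)%C.
    have hS : Rabs (S t) <= P t.
      rewrite /S Rabs_mult (Rabs_pos_eq 2); last lra.
      have := Cdot_le (w t) (Ci * y t)%C; rewrite Cmod_Ci_mult; lra.
    have hB : Rabs (B t) <= P t.
      rewrite /B Rabs_mult (Rabs_pos_eq 2); last lra.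
      have := Cdot_le (w t) (y t); lra.
    have hA : Rabs (A t) <= P t.
      apply/Rabs_le_between; rewrite /A /P.
      have := pow2_ge_0 (Cmod (w t)); have := pow2_ge_0 (Cmod (y t)); lra.
    pose EP t := 2 * Cdot (w t) (e1 t) + 2 * Cdot (y t) (e2 t).
    pose EA t := / t * (2 * l * Cmod (y t) ^ 2 + 2 * gr * Cmod (w t) ^ 2 + (kr * S t - ki * B t))
        + (2 * Cdot (y t) (e2 t) - 2 * Cdot (w t) (e1 t)).
    pose EB t := / t * (- (2 * Cdot (g0 * w t)%C (y t)) + 2 * ki * Cmod (y t) ^ 2 + l * B t)
        + (2 * Cdot (y t) (e1 t) + 2 * Cdot (w t) (e2 t)).
    have tn : t <> 0 by lra.
    have EdP : dP t = (l - gr) * / t * P t + (l + gr) * / t * A t - kr * / t * S t + ki * / t * B t + EP t.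
      rewrite /dP /dw /dy /P /A /B /S /EP !Cmod_sqr /gr /kr /ki /Cdot /Cdiv -RtoC_inv //=.
      move: (w t) (y t) (e1 t) (e2 t) (g0) (ka) => [? ?] [? ?] [? ?] [? ?] [? ?] [? ?] /=; rewrite /Rdiv; ring.
    have EdA : dA t = 2 * th t * B t + EA t.
      rewrite /dA /dw /dy /A /B /EA /S /B !Cmod_sqr /gr /kr /ki /Cdot /Cdiv -RtoC_inv //=.
      move: (w t) (y t) (e1 t) (e2 t) (g0) (ka) => [? ?] [? ?] [? ?] [? ?] [? ?] [? ?] /=; rewrite /Rdiv; ring.
    have EdB : dB t = - (2 * th t * A t) + EB t.
      rewrite /dB /dw /dy /A /B /EB /B !Cmod_sqr /gr /kr /ki /Cdot /Cdiv -RtoC_inv //=.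
      move: (w t) (y t) (e1 t) (e2 t) (g0) (ka) => [? ?] [? ?] [? ?] [? ?] [? ?] [? ?] /=; rewrite /Rdiv; ring.
    have EP_le : Rabs (EP t) <= C' * eps t * P t.
      apply: Rle_trans (Rabs_plus_le _ _ _ _ f1 f2) _; rewrite /C'; lra.
    have KP : 0 <= K0 * P t by apply: Rmult_le_pos; lra.
    have EA_le : Rabs (EA t) <= (C' * / t + C' * eps t) * P t.
      have h1 : Rabs (2 * l * Cmod (y t) ^ 2) <= (4 * K0) * P t.
        apply: Rabs_mult_le; first by rewrite Rabs_mult (Rabs_pos_eq 2); lra.
        by rewrite Rabs_pos_eq //; exact: pow2_ge_0.
      have h2 : Rabs (2 * gr * Cmod (w t) ^ 2) <= (2 * K0) * P t.
        apply: Rabs_mult_le; first by rewrite Rabs_mult (Rabs_pos_eq 2); lra.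
        by rewrite Rabs_pos_eq //; exact: pow2_ge_0.
      have h3 := Rabs_minus_le _ _ _ _ (Rabs_mult_le _ _ _ _ hkr hS) (Rabs_mult_le _ _ _ _ hki hB).
      have h4 := Rabs_mult_le _ _ _ _ (ae _ (Rlt_le _ _ s0)) (Rabs_plus_le _ _ _ _ (Rabs_plus_le _ _ _ _ h1 h2) h3).
      apply: Rle_trans (Rabs_plus_le _ _ _ _ h4 (Rabs_minus_le _ _ _ _ f2 f1)) _; rewrite /C'; lra.
    have EB_le : Rabs (EB t) <= (C' * / t + C' * eps t) * P t.
      have h1 : Rabs (- (2 * Cdot (g0 * w t)%C (y t))) <= K0 * P t.
        rewrite Rabs_Ropp Rabs_mult (Rabs_pos_eq 2); last lra.
        have := Cdot_le (g0 * w t)%C (y t); rewrite Cmod_mult.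
        have := Rmult_le_compat _ _ _ _ (Cmod_ge_0 g0) (Rmult_le_pos _ _ w0 y0) Hg0 (Rle_refl _).
        have := Rmult_le_compat_l K0 _ _ ltac:(lra) b3; lra.
      have h2 : Rabs (2 * ki * Cmod (y t) ^ 2) <= (2 * K0) * P t.
        apply: Rabs_mult_le; first by rewrite Rabs_mult (Rabs_pos_eq 2); lra.
        by rewrite Rabs_pos_eq //; exact: pow2_ge_0.
      have h4 := Rabs_mult_le _ _ _ _ (ae _ (Rlt_le _ _ s0))
        (Rabs_plus_le _ _ _ _ (Rabs_plus_le _ _ _ _ h1 h2) (Rabs_mult_le _ _ _ _ hll hB)).
      have sKP : 0 <= / t * (K0 * P t) by apply: Rmult_le_pos => //; lra.
      apply: Rle_trans (Rabs_plus_le _ _ _ _ h4 (Rabs_plus_le _ _ _ _ f3 f4)) _; rewrite /C'; lra.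
    have KE : 0 <= K0 * eps t by apply: Rmult_le_pos; lra.
    rewrite /dG EdP EdA EdB.
    apply: (corrected_energy_rate C' (/ t) (eta t) (eps t) l gr kr ki (al t / al0) D (P t) (A t) (B t) (S t)
       (EP t) (EA t) (EB t) (th t)) => //; try lra; try (rewrite /C'; lra).
    - exact: Heta (Rlt_le _ _ (proj1 Ht)).
    - rewrite seta //; have e0 := Rpower_pos t (be - 1); have r0 := R0 t t0.
      have h1 : Rpower t (- l - 2) / X * / (2 * al0) <= Rpower t (- l - 2) / X * K0.
        by apply: Rmult_le_compat_l => //; lra.
      have h2 : 0 <= Rpower t (be - 1) * K0 by apply: Rmult_le_pos; lra.
      move: KE; rewrite /eps /C'; lra.
    - have h := Rabs_mult_le _ _ _ _ (ae _ (Rlt_le _ _ s0)) (Hal t Ht).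
      apply: Rle_trans h _.
      have -> : / t * (K0 * Rpower t be) = K0 * Rpower t (be - 1) by rewrite Rpower_minus_1 //; field.
      have r0 := R0 t t0.
      have h2 : 0 <= K0 * (Rpower t (- l - 2) / X) by apply: Rmult_le_pos; lra.
      move: KE; rewrite /eps /C'; lra.
    - rewrite /th /eta; have -> : - l - 1 = - (l + 1) by ring.
      rewrite Rpower_Ropp Rpower_plus Rpower_1 //; field.
      have := Rpower_pos t l; lra.
    - by apply: Rle_trans (Rabs_plus_le _ _ _ _ hll hgr) _; rewrite /C'; lra.
    - by apply: Rle_trans (Rabs_minus_le _ _ _ _ hll hgr) _; rewrite /C'; lra.
    - by rewrite Rabs_pos_eq /C'; lra.
  (* The corrected energy is comparable with the energy, end points included. *)
  have GP t : t2 <= t -> P t <= 2 * G t /\ G t <= 2 * P t.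
    move=> Ht.
    have [b1 [b2 [b3 b4]]] := energy_components_le _ _ (P t) (Cmod_ge_0 (w t)) (Cmod_ge_0 (y t)) erefl.
    have hB : Rabs (B t) <= P t.
      rewrite /B Rabs_mult (Rabs_pos_eq 2); last lra.
      have := Cdot_le (w t) (y t); lra.
    have hA : Rabs (A t) <= P t.
      apply/Rabs_le_between; rewrite /A /P.
      have := pow2_ge_0 (Cmod (w t)); have := pow2_ge_0 (Cmod (y t)); lra.
    have P0 : 0 <= P t by apply: Rplus_le_le_0_compat; exact: pow2_ge_0.
    have hlg : Rabs (l + gr) <= C'.
      have hl2 : Rabs l <= 2 * K0 by apply/Rabs_le_between; lra.
      apply: Rle_trans (Rabs_plus_le _ _ _ _ hl2 (Rle_trans _ _ _ (Rabs_Re_le g0) Hg0)) _; rewrite /C'; lra.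
    have hki : Rabs ki <= C' by apply: Rle_trans (Rabs_Im_le _) _; rewrite /C'; lra.
    have hL := Rabs_minus_le _ _ _ _ (Rabs_mult_le _ _ _ _ hlg hB) (Rabs_mult_le _ _ _ _ hki hA).
    have hetaL : Rabs (eta t * L t) <= eta t * (C' * P t + C' * P t).
      by apply: Rabs_mult_le => //; rewrite Rabs_pos_eq //; lra.
    have := Rmult_le_compat_r _ _ _ P0 (Heta t Ht).
    move/Rabs_le_between: hetaL; rewrite /G; lra.
  have l1 : 0 < l + 1 by lra.
  have deta t : 0 < t -> is_derive eta t (- ((l + 1) * / t * eta t)).
    move=> Ht; apply: is_derive_eq.
      by apply: is_derive_Rmult; [exact: is_derive_Rpower|exact: is_derive_const].
    rewrite (Rpower_minus_1 t (- l - 1)) // /eta /zero /=; field; lra.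
  have dln t : 0 < t -> is_derive ln t (/ t).
    by move=> Ht; apply/is_derive_Reals; exact: derivable_pt_lim_ln.
  pose r t := D * ln t + K' * (Rpower t be * / be - Rpower t (- l - 1) * / ((l + 1) * X)).
  have dr t : 0 < t -> is_derive r t (D * / t + K' * eps t).
    move=> Ht; apply: is_derive_eq.
      apply: (is_derive_plus (V := R_NormedModule)); apply: is_derive_Rmult;
       [exact: is_derive_const|exact: dln|exact: is_derive_const|].
      apply: (is_derive_minus (V := R_NormedModule)); apply: is_derive_Rmult;
       [exact: is_derive_Rpower|exact: is_derive_const|exact: is_derive_Rpower|exact: is_derive_const].
    rewrite /eps /plus /minus /opp /zero /=.
    have -> : - l - 1 - 1 = - l - 2 by ring.
    rewrite /plus /=; field; lra.
  pose p t := (l - gr) * ln t.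
  have dp t : 0 < t -> is_derive p t ((l - gr) * / t).
    move=> Ht; apply: is_derive_eq.
      by apply: is_derive_Rmult; [exact: is_derive_const|exact: dln].
    rewrite /zero /=; ring.
  have cP t : t2 <= t <= T -> continuity_pt P t.
    by move=> Ht; have [c1 c2] := Hc t Ht; apply: continuity_pt_plus; exact: continuity_pt_Cmod_sqr.
  have cG t : t2 <= t <= T -> continuity_pt G t.
    move=> Ht; have [c1 c2] := Hc t Ht; apply: continuity_pt_plus; first exact: cP.
    apply: continuity_pt_mult.
      apply: is_derive_continuity_pt; apply: deta; lra.
    apply: continuity_pt_minus; apply: continuity_pt_mult; try by apply: continuity_pt_const.
      apply: continuity_pt_mult; first by apply: continuity_pt_const.
      exact: continuity_pt_Cdot.
    by apply: continuity_pt_minus; exact: continuity_pt_Cmod_sqr.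
  have dGt t : t2 < t < T -> is_derive G t (dG t).
    move=> Ht; have [Hw [Hy _]] := Hd t Ht.
    have Hw2 := is_derive_Cmod_sqr _ _ _ Hw; have Hy2 := is_derive_Cmod_sqr _ _ _ Hy.
    have HB := is_derive_Rmult _ _ _ _ _ (is_derive_const 2 t) (is_derive_Cdot _ _ _ _ _ Hw Hy).
    have HA := is_derive_minus (V := R_NormedModule) _ _ _ _ _ Hy2 Hw2.
    have HLt := is_derive_minus (V := R_NormedModule) _ _ _ _ _
      (is_derive_Rmult _ _ _ _ _ (is_derive_const (l + gr) t) HB)
      (is_derive_Rmult _ _ _ _ _ (is_derive_const ki t) HA).
    apply: is_derive_eq.
      apply: (is_derive_plus (V := R_NormedModule)).
        exact: (is_derive_plus (V := R_NormedModule) _ _ _ _ _ Hw2 Hy2).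
      apply: is_derive_Rmult; [apply: deta; lra|exact: HLt].
    rewrite /dG /dP /dA /dB /dw /dy /th /plus /minus /opp /zero /L /=; rewrite /plus /G /P /B /A /=; match goal with |- @eq _ ?x ?y => change (@eq R x y) end; ring.
  have [H1 H2] : G T <= G t2 * exp (p T - p t2 + (r T - r t2)) /\
                 G t2 <= G T * exp (- (p T - p t2) + (r T - r t2)).
    refine (gronwall G dG p (fun t => (l - gr) * / t) r (fun t => D * / t + K' * eps t) t2 T t2T _ _ _ _ _ _ _) => t Ht.
    - exact: dGt.
    - apply: dp; lra.
    - apply: dr; lra.
    - exact: cG.
    - apply: is_derive_continuity_pt; apply: dp; lra.
    - apply: is_derive_continuity_pt; apply: dr; lra.
    - by have [_ [_ h]] := point t Ht.
  set E := exp (K' * (Rpower T be / be + / ((l + 1) * 1))).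
  have Hr : r T - r t2 <= D * ln (T / t2) + K' * (Rpower T be / be + / ((l + 1) * 1)).
    rewrite ln_div // /r.
    have h1 : 0 <= Rpower t2 be * / be.
      by apply: Rmult_le_pos; [exact/Rlt_le/Rpower_pos|exact/Rlt_le/Rinv_0_lt_compat].
    have iX : 0 < / ((l + 1) * X) by apply: Rinv_0_lt_compat; exact: Rmult_lt_0_compat.
    have h2 : 0 <= Rpower T (- l - 1) * / ((l + 1) * X).
      by apply: Rmult_le_pos; [exact/Rlt_le/Rpower_pos|exact/Rlt_le].
    have h3 : Rpower t2 (- l - 1) * / ((l + 1) * X) <= / ((l + 1) * 1).
      have -> : - l - 1 = - (l + 1) by ring.
      rewrite Rpower_Ropp.
      have rp := Rpower_pos t2 (l + 1).
      have -> : / Rpower t2 (l + 1) * / ((l + 1) * X) = / ((l + 1) * (X * Rpower t2 (l + 1))) by field; lra.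
      apply: Rinv_le_contravar; first lra.
      apply: Rmult_le_compat_l; first lra.
      apply: Rle_trans HL; nra.
    have := Rmult_le_compat_l _ _ _ K'0 (Rplus_le_compat _ _ _ _ (Rplus_le_compat _ _ _ _ h3 h1) h2).
    rewrite /Rdiv; lra.
  have Hp : p T - p t2 = (l - gr) * ln (T / t2) by rewrite ln_div // /p; ring.
  have E0 := exp_pos (K' * (Rpower T be / be + / ((l + 1) * 1))).
  have R1 : exp (p T - p t2 + (r T - r t2)) <= Rpower (T / t2) (l - gr + D) * E.
    rewrite /Rpower /E -exp_plus; apply: exp_le_compat; rewrite Hp; lra.
  have R2 : exp (- (p T - p t2) + (r T - r t2)) <= Rpower (T / t2) (- (l - gr) + D) * E.
    rewrite /Rpower /E -exp_plus; apply: exp_le_compat; rewrite Hp; lra.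
  have [g1 g2] := GP t2 ltac:(lra); have [g3 g4] := GP T ltac:(lra).
  have P0 t : 0 <= P t by apply: Rplus_le_le_0_compat; exact: pow2_ge_0.
  have comb (Ga Gb Pa Pb e f : R) : 0 <= e -> e <= f * E -> 0 <= Pa -> Pb <= 2 * Gb -> Gb <= Ga * e -> Ga <= 2 * Pa ->
      Pb <= 4 * E * f * Pa.
    move=> he hef hPa k1 k2 k3.
    have := Rmult_le_compat_r _ _ _ he k3; have := Rmult_le_compat_l _ _ _ hPa hef; lra.
  split.
  - by apply: (comb (G t2) (G T) _ _ (exp (p T - p t2 + (r T - r t2)))) => //; exact/Rlt_le/exp_pos.
  - by apply: (comb (G T) (G t2) _ _ (exp (- (p T - p t2) + (r T - r t2)))) => //; exact/Rlt_le/exp_pos.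
Qed.

(** The coefficient of the first derivative in (W), at the frequency of length [X]. *)
Definition damping (l X t b : R) (g : C) : C :=
  (2 * Ci * RtoC (Rpower t l * X * b) + RtoC (/ t) * g)%C.

(** The coefficient of the function itself in (W). *)
Definition stiffness (l X t a : R) (c h : C) : C :=
  (RtoC (Rpower t (2 * l) * X ^ 2 * a) + Ci * RtoC (Rpower t (l - 1) * X) * c + RtoC (/ t ^ 2) * h)%C.

Lemma Cmod_minus_le (x y : C) : Cmod (x - y) <= Cmod x + Cmod y.
Proof. by apply: Rle_trans (Cmod_triangle _ _) _; rewrite Cmod_opp; exact: Rle_refl. Qed.

Lemma Cmod_plus_sqr (x y : C) : Cmod (x + y) ^ 2 <= 2 * Cmod x ^ 2 + 2 * Cmod y ^ 2.
Proof.
  rewrite !Cmod_sqr /=; have := pow2_ge_0 (Re x - Re y); have := pow2_ge_0 (Im x - Im y).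
  rewrite /Re /Im /=; lra.
Qed.

(** Coefficients of class [T^be] differ from their values at 0 by a multiple of
    [e = t^be]; after division by [t] the error of freezing them is integrable,
    and the frozen quotient is constant, so it need not be differentiated. *)
Lemma frozen_quotient_close (M m L l e al al0 b b0 : R) (c c0 g g0 : C) :
  1 <= M -> 0 < m -> Rabs l <= L -> 0 <= e -> m <= al -> m <= al0 -> Rabs b <= M -> Rabs b0 <= M ->
  Cmod c0 <= M -> Cmod g0 <= M ->
  Rabs (al - al0) <= M * e -> Rabs (b - b0) <= M * e -> Cmod (c - c0)%C <= M * e -> Cmod (g - g0)%C <= M * e ->
  let N := (c - (RtoC l + g) * RtoC b)%C in let N0 := (c0 - (RtoC l + g0) * RtoC b0)%C in
  Cmod (N0 / RtoC al0)%C <= (M + (L + M) * M) / m /\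
  Cmod (N / RtoC al - N0 / RtoC al0)%C <=
    ((M + (L + M) * M + M * M) / m + (M + (L + M) * M) / m * (M / m)) * e.
Proof.
  move=> M1 m0 hl e0 hal hal0 hb hb0 hc0 hg0 dal db dc dg N N0.
  have cal : RtoC al <> RtoC 0 by move=> /RtoC_inj; lra.
  have cal0 : RtoC al0 <> RtoC 0 by move=> /RtoC_inj; lra.
  have inv_le (z : R) : m <= z -> Cmod (/ RtoC z) <= / m.
    move=> hz; rewrite -RtoC_inv; last lra.
    rewrite Cmod_R Rabs_pos_eq; last by apply/Rlt_le/Rinv_0_lt_compat; lra.
    by apply: Rinv_le_contravar.
  have L0 : 0 <= L by apply: Rle_trans hl; exact: Rabs_pos.
  have im := Rinv_0_lt_compat _ m0.
  have lg : Cmod (RtoC l + g0)%C <= L + M.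
    by apply: Rle_trans (Cmod_triangle _ _) _; rewrite Cmod_R; lra.
  have HN0 : Cmod N0 <= M + (L + M) * M.
    apply: Rle_trans (Cmod_minus_le _ _) _; rewrite Cmod_mult Cmod_R.
    have := Rmult_le_compat _ _ _ _ (Cmod_ge_0 _) (Rabs_pos b0) lg hb0; lra.
  have H1 : Cmod (N0 / RtoC al0)%C <= (M + (L + M) * M) / m.
    rewrite /Cdiv Cmod_mult; apply: Rmult_le_compat; try exact: Cmod_ge_0; first exact: HN0.
    exact: inv_le.
  split => //.
  have -> : (N / RtoC al - N0 / RtoC al0 = (N - N0) * / RtoC al + N0 / RtoC al0 * (RtoC (al0 - al) * / RtoC al))%C.
    by rewrite RtoC_minus; field.
  have HNN : Cmod (N - N0)%C <= (M + (L + M) * M + M * M) * e.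
    have -> : (N - N0 = (c - c0) - ((RtoC l + g0) * RtoC (b - b0) + (g - g0) * RtoC b))%C.
      by rewrite /N /N0 RtoC_minus; ring.
    apply: Rle_trans (Cmod_minus_le _ _) _.
    have h1 := Cmod_triangle ((RtoC l + g0) * RtoC (b - b0)) ((g - g0) * RtoC b).
    rewrite !Cmod_mult !Cmod_R in h1.
    have := Rmult_le_compat _ _ _ _ (Cmod_ge_0 _) (Rabs_pos _) lg db.
    have := Rmult_le_compat _ _ _ _ (Cmod_ge_0 _) (Rabs_pos _) dg hb; lra.
  apply: Rle_trans (Cmod_triangle _ _) _; rewrite !Cmod_mult !Cmod_R.
  have h1 := Rmult_le_compat _ _ _ _ (Cmod_ge_0 _) (Cmod_ge_0 _) HNN (inv_le al hal).
  rewrite Rabs_minus_sym in dal.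
  have h2 := Rmult_le_compat _ _ _ _ (Rabs_pos _) (Cmod_ge_0 _) dal (inv_le al hal).
  have h3 := Rmult_le_compat _ _ _ _ (Cmod_ge_0 _) (Rmult_le_pos _ _ (Rabs_pos _) (Cmod_ge_0 _)) H1 h2.
  rewrite Cmod_mult in h3; rewrite /Rdiv in h3 *; lra.
Qed.

(** With [lam = X * t^l], the unknowns [w = v + i lam b u] and [y = lam al u]
    diagonalize the principal part over the reals: [v] plus or minus [i lam al u]
    are the two waves. In these unknowns (W) has the form treated by
    [oscillatory_energy], with [ka = (c - (l + g) b) / al] frozen at 0, and the
    derivatives of [al] and [b] only enter through the error terms. *)
Lemma oscillatory_comparison (M m l be T : R) :
  1 <= M -> 0 < m -> -1 < l -> 0 < be -> 0 < T ->
  exists Lam K, 0 < K /\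
  forall (X al0 b0 D t2 : R) (c0 g0 : C) (a b al db dal : R -> R) (c g h u v : R -> C),
  0 < X -> 0 < t2 <= T -> Lam <= X * Rpower t2 (l + 1) ->
  m <= al0 -> Rabs b0 <= M -> Cmod c0 <= M -> Cmod g0 <= M ->
  Rabs (Re ((c0 - (RtoC l + g0) * RtoC b0) / RtoC al0)%C) <= D ->
  (forall t, t2 <= t <= T -> al t ^ 2 = a t + b t ^ 2 /\ m <= al t <= M /\ Rabs (b t) <= M /\
     continuity_pt al t /\ continuity_pt b t /\ Ccont u t /\ Ccont v t) ->
  (forall t, t2 < t < T -> Cmod (h t) <= M /\
     Rabs (al t - al0) <= M * Rpower t be /\ Rabs (b t - b0) <= M * Rpower t be /\
     Cmod (c t - c0)%C <= M * Rpower t be /\ Cmod (g t - g0)%C <= M * Rpower t be /\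
     is_derive al t (dal t) /\ Rabs (dal t) <= M * Rpower t (be - 1) /\
     is_derive b t (db t) /\ Rabs (db t) <= M * Rpower t (be - 1) /\
     is_Cderive u t (v t) /\
     is_Cderive v t (- (stiffness l X t (a t) (c t) (h t) * u t) - damping l X t (b t) (g t) * v t)%C) ->
  let N t := (X * Rpower t l) ^ 2 * Cmod (u t) ^ 2 + Cmod (v t) ^ 2 in
  N T <= K * Rpower (T / t2) (l - Re g0 + D) * N t2 /\
  N t2 <= K * Rpower (T / t2) (- (l - Re g0) + D) * N T.
Proof.
  move=> M1 m0 hl be0 T0.
  pose Kk := (M + (Rabs l + M) * M) / m.
  pose Ck := (M + (Rabs l + M) * M + M * M) / m + (M + (Rabs l + M) * M) / m * (M / m).
  have im := Rinv_0_lt_compat _ m0.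
  have al_ := Rabs_pos l.
  have n1 : 0 <= (Rabs l + M) * M by apply: Rmult_le_pos; lra.
  have n2 : 0 <= M * M by apply: Rmult_le_pos; lra.
  have Kk0 : 0 <= Kk by apply: Rmult_le_pos; lra.
  have Mm0 : 0 < M / m by apply: Rdiv_lt_0_compat; lra.
  have Ck0 : 0 <= Ck.
    apply: Rplus_le_le_0_compat; first by apply: Rmult_le_pos; lra.
    by apply: Rmult_le_pos; [exact: Kk0|lra].
  pose K0 := 2 + Rabs l + M + / m + 2 * (M / m) + Kk + Ck.
  have [K [Kp HK]] := oscillatory_energy K0 l be T ltac:(rewrite /K0; lra) hl
     ltac:(rewrite /K0; have := Rle_abs l; lra) be0 T0.
  pose K1 := 3 * M ^ 2. pose K2 := 2 + (2 * M ^ 2 + 1) / m ^ 2.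
  have K10 : 0 < K1 by rewrite /K1; have := pow_lt M 2 ltac:(lra); lra.
  have K20 : 0 < K2.
    have : 0 <= (2 * M ^ 2 + 1) / m ^ 2; last by rewrite /K2; lra.
    apply: Rmult_le_pos; first by have := pow2_ge_0 M; lra.
    by apply/Rlt_le/Rinv_0_lt_compat/pow_lt.
  exists (32 * K0 ^ 2), (K2 * K * K1); split.
    by apply: Rmult_lt_0_compat => //; exact: Rmult_lt_0_compat.
  move=> X al0 b0 D t2 c0 g0 a b al db dal c g h u v X0 [t20 t2T] HL hal0 hb0 hc0 hg0 hD Hcl Hop N.
  pose ka := ((c0 - (RtoC l + g0) * RtoC b0) / RtoC al0)%C.
  pose lam t := X * Rpower t l.
  have lam0 t : 0 < lam t by apply: Rmult_lt_0_compat => //; exact: Rpower_pos.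
  pose w t := (v t + Ci * RtoC (lam t * b t) * u t)%C.
  pose y t := (RtoC (lam t * al t) * u t)%C.
  pose dw t := (- (stiffness l X t (a t) (c t) (h t) * u t) - damping l X t (b t) (g t) * v t
     + Ci * (RtoC (lam t * / t * l * b t + lam t * db t) * u t + RtoC (lam t * b t) * v t))%C.
  pose dy t := (RtoC (lam t * / t * l * al t + lam t * dal t) * u t + RtoC (lam t * al t) * v t)%C.
  pose e1 t := (dw t - (- ((X * Rpower t l * al t)%R * y t) - Ci * RtoC (lam t * b t) * w t - g0 / t * w t - Ci * ka / t * y t))%C.
  pose e2 t := (dy t - ((X * Rpower t l * al t)%R * w t - Ci * RtoC (lam t * b t) * y t + (l / t)%R * y t))%C.
  pose kt t := ((c t - (RtoC l + g t) * RtoC (b t)) / RtoC (al t))%C.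
  have dlam t : 0 < t -> is_derive lam t (lam t * / t * l).
    move=> Ht; apply: is_derive_eq.
      by apply: is_derive_Rmult; [exact: is_derive_const|exact: is_derive_Rpower].
    rewrite (Rpower_minus_1 t l) // /lam /zero /=; field; lra.
  (* [c t] and [a t] are eliminated in favour of [kt t] and [al t], which makes
     the identity polynomial. *)
  have He1 t : t2 < t < T -> e1 t = (- ((g t - g0) * / t * w t) - Ci * (kt t - ka) * / t * y t
      + Ci * RtoC (db t) * (RtoC (lam t) * u t) - RtoC (/ t ^ 2) * h t * u t)%C.
    move=> Ht; have [Ea [[hal _] _]] := Hcl t ltac:(lra).
    have Ec : c t = (kt t * RtoC (al t) + (RtoC l + g t) * RtoC (b t))%C.
      rewrite /kt; field; move=> /RtoC_inj; lra.
    have Ea' : a t = al t ^ 2 - b t ^ 2 by lra.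
    rewrite /e1 /dw /w /y /stiffness /damping Ec Ea'.
    have -> : Rpower t (2 * l) = Rpower t l * Rpower t l.
      by rewrite -Rpower_plus; congr Rpower; ring.
    rewrite (Rpower_minus_1 t l); last lra.
    rewrite /Cdiv -RtoC_inv; last lra.
    rewrite -pow_inv /lam /Rdiv.
    move: (kt t) (g t) (h t) (u t) (v t) (g0) (ka) (/ t) => [? ?] [? ?] [? ?] [? ?] [? ?] [? ?] [? ?] s.
    by apply: injective_projections => /=; ring.
  have He2 t : t2 < t < T -> e2 t = (RtoC (dal t) * (RtoC (lam t) * u t))%C.
    move=> Ht.
    rewrite /e2 /dy /w /y /lam /Rdiv.
    move: (u t) (v t) (/ t) => [? ?] [? ?] s.
    by apply: injective_projections => /=; ring.
  have lamu t : t2 <= t <= T -> Cmod (RtoC (lam t) * u t)%C <= / m * Cmod (y t).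
    move=> Ht; have [Ea [[hal _] _]] := Hcl t ltac:(lra).
    rewrite /y RtoC_mult !Cmod_mult !Cmod_R (Rabs_pos_eq (al t)); last lra.
    have -> : / m * (Rabs (lam t) * al t * Cmod (u t)) = (/ m * al t) * (Rabs (lam t) * Cmod (u t)) by ring.
    rewrite -{1}[Rabs (lam t) * Cmod (u t)]Rmult_1_l.
    apply: Rmult_le_compat_r; first by apply: Rmult_le_pos; [exact: Rabs_pos|exact: Cmod_ge_0].
    by apply: (Rmult_le_reg_l m) => //; rewrite -Rmult_assoc Rinv_r; lra.
  have close t (Ht : t2 < t < T) : Cmod ka <= Kk /\ Cmod (kt t - ka)%C <= Ck * Rpower t be.
    have [_ [[hal _] [hb _]]] := Hcl t ltac:(lra).
    have [_ [k1 [k2 [k3 [k4 _]]]]] := Hop t Ht.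
    by apply: (frozen_quotient_close M m (Rabs l) l (Rpower t be) (al t) al0 (b t) b0 (c t) c0 (g t) g0) => //;
      [exact: Rle_refl|exact/Rlt_le/Rpower_pos].
  have Hka : Cmod ka <= Kk.
    have [h1 _] := frozen_quotient_close M m (Rabs l) l 0 al0 al0 b0 b0 c0 c0 g0 g0 M1 m0 (Rle_refl _) (Rle_refl _)
      hal0 hal0 hb0 hb0 hc0 hg0 ltac:(rewrite Rminus_diag Rabs_R0; lra) ltac:(rewrite Rminus_diag Rabs_R0; lra)
      ltac:(rewrite /Cminus Cplus_opp_r Cmod_0; lra) ltac:(rewrite /Cminus Cplus_opp_r Cmod_0; lra).
    exact: h1.
  have i0 : / (2 * al0) <= K0.
    apply: (Rle_trans _ (/ m)); last by rewrite /K0; lra.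
    apply: Rinv_le_contravar; lra.
  have A1 t : t2 < t < T -> Rabs (1 - al t / al0) <= K0 * Rpower t be.
    move=> Ht; have [_ [k1 _]] := Hop t Ht.
    have -> : 1 - al t / al0 = (al0 - al t) * / al0 by field; lra.
    rewrite Rabs_minus_sym in k1.
    have k2 : Rabs (/ al0) <= / m.
      rewrite Rabs_pos_eq; last by apply/Rlt_le/Rinv_0_lt_compat; lra.
      apply: Rinv_le_contravar; lra.
    apply: Rle_trans (Rabs_mult_le _ _ _ _ k1 k2) _.
    have rp := Rpower_pos t be.
    have : 0 <= (K0 - M / m) * Rpower t be.
      by apply: Rmult_le_pos; [rewrite /K0; lra|lra].
    rewrite /Rdiv; lra.
  have A2 t (Ht : t2 < t < T) :
     is_Cderive w t (- ((X * Rpower t l * al t)%R * y t) - Ci * RtoC (lam t * b t) * w t - g0 / t * w t - Ci * ka / t * y t + e1 t)%C /\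
     is_Cderive y t ((X * Rpower t l * al t)%R * w t - Ci * RtoC (lam t * b t) * y t + (l / t)%R * y t + e2 t)%C /\
     let eps := Rpower t (be - 1) + Rpower t (- l - 2) / X in
     Cmod (e1 t) <= K0 * eps * (Cmod (w t) + Cmod (y t)) /\
     Cmod (e2 t) <= K0 * eps * (Cmod (w t) + Cmod (y t)).
    have [hh [k1 [k2 [k3 [k4 [k5 [k6 [k7 [k8 [k9 k10]]]]]]]]]] := Hop t Ht.
    have t0 : 0 < t by lra.
    split.
      apply: is_Cderive_eq.
        apply: is_Cderive_plus; first exact: k10.
        apply: is_Cderive_mult; last exact: k9.
        apply: is_Cderive_mult; first exact: is_Cderive_const.
        apply: is_Cderive_RtoC; apply: is_derive_Rmult; [exact: dlam|exact: k7].
      rewrite /e1 /dw; ring.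
    split.
      apply: is_Cderive_eq.
        apply: is_Cderive_mult; last exact: k9.
        apply: is_Cderive_RtoC; apply: is_derive_Rmult; [exact: dlam|exact: k5].
      rewrite /e2 /dy; ring.
    have [_ hk] := close t Ht.
    have lu := lamu t ltac:(lra).
    have w0 := Cmod_ge_0 (w t); have y0 := Cmod_ge_0 (y t).
    have rp := Rpower_pos t (be - 1).
    have rq : 0 < Rpower t (- l - 2) / X by apply: Rdiv_lt_0_compat => //; exact: Rpower_pos.
    have ti := Rinv_0_lt_compat _ t0.
    have sbe : Rpower t be * / t = Rpower t (be - 1) by rewrite Rpower_minus_1.
    have ct : Cmod (/ RtoC t)%C = / t by rewrite -RtoC_inv; [rewrite Cmod_R Rabs_pos_eq //; lra|lra].
    rewrite He1 // He2 //.
    set e := Rpower t (be - 1) + Rpower t (- l - 2) / X.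
    have b1 : Cmod ((g t - g0) * / t * w t)%C <= M * Rpower t (be - 1) * Cmod (w t).
      rewrite !Cmod_mult ct -sbe -Rmult_assoc; apply: Rmult_le_compat_r => //; apply: Rmult_le_compat_r => //; lra.
    have b2 : Cmod (Ci * (kt t - ka) * / t * y t)%C <= Ck * Rpower t (be - 1) * Cmod (y t).
      rewrite -!Cmult_assoc Cmod_Ci_mult Cmod_mult (Cmod_mult _ (y t)) ct -sbe.
      have := Rmult_le_compat_r _ _ _ (Rmult_le_pos _ _ (Rlt_le _ _ ti) y0) hk; lra.
    have b3 (z : R) : Rabs z <= M * Rpower t (be - 1) ->
        Cmod (RtoC z * (RtoC (lam t) * u t))%C <= (M / m) * Rpower t (be - 1) * Cmod (y t).
      move=> hz; rewrite Cmod_mult Cmod_R.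
      have := Rmult_le_compat _ _ _ _ (Rabs_pos z) (Cmod_ge_0 _) hz lu; rewrite /Rdiv; lra.
    have b4 : Cmod (RtoC (/ t ^ 2) * h t * u t)%C <= (M / m) * (Rpower t (- l - 2) / X) * Cmod (y t).
      rewrite (Cmod_mult _ (u t)) (Cmod_mult _ (h t)) Cmod_R.
      rewrite Cmod_mult Cmod_R (Rabs_pos_eq (lam t)) in lu; last exact/Rlt_le.
      have E : Rpower t (- l - 2) / X * lam t = / t ^ 2.
        rewrite /lam; have -> : Rpower t (- l - 2) / X * (X * Rpower t l) = Rpower t (- l - 2) * Rpower t l by field; lra.
        rewrite -Rpower_plus; have -> : - l - 2 + l = - INR 2 by rewrite /=; ring.
        by rewrite Rpower_Ropp Rpower_pow.
      rewrite -E Rabs_pos_eq; last by apply: Rmult_le_pos; exact/Rlt_le.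
      have -> : Rpower t (- l - 2) / X * lam t * Cmod (h t) * Cmod (u t) =
         Cmod (h t) * ((Rpower t (- l - 2) / X) * (lam t * Cmod (u t))) by ring.
      have -> : M / m * (Rpower t (- l - 2) / X) * Cmod (y t) = M * ((Rpower t (- l - 2) / X) * (/ m * Cmod (y t))).
        by rewrite /Rdiv; ring.
      apply: Rmult_le_compat => //; first exact: Cmod_ge_0.
        by apply: Rmult_le_pos; [lra|apply: Rmult_le_pos; [exact/Rlt_le|exact: Cmod_ge_0]].
      apply: Rmult_le_compat_l => //; lra.
    have p1 := Rmult_le_pos _ _ (Rlt_le _ _ rp) w0; have p2 := Rmult_le_pos _ _ (Rlt_le _ _ rp) y0.
    have p3 := Rmult_le_pos _ _ (Rlt_le _ _ rq) w0; have p4 := Rmult_le_pos _ _ (Rlt_le _ _ rq) y0.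
    have big (x1 x2 x3 : R) : x1 <= K0 -> x2 <= K0 -> x3 <= K0 -> 
        x1 * Rpower t (be - 1) * Cmod (w t) + x2 * Rpower t (be - 1) * Cmod (y t) + x3 * (Rpower t (- l - 2) / X) * Cmod (y t)
         <= K0 * e * (Cmod (w t) + Cmod (y t)).
      move=> h1 h2 h3.
      have K00 : 0 <= K0 by rewrite /K0; lra.
      have := Rmult_le_compat_r _ _ _ p1 h1; have := Rmult_le_compat_r _ _ _ p2 h2.
      have := Rmult_le_compat_r _ _ _ p4 h3; have := Rmult_le_pos _ _ K00 p3; rewrite /e; lra.
    split.
    - apply: (Rle_trans _ (M * Rpower t (be - 1) * Cmod (w t) + (Ck + M / m) * Rpower t (be - 1) * Cmod (y t)
          + (M / m) * (Rpower t (- l - 2) / X) * Cmod (y t))); last by apply: big; rewrite /K0; lra.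
      have b3' := b3 _ k8.
      apply: Rle_trans (Cmod_minus_le _ _) _.
      have q1 := Cmod_triangle (- ((g t - g0) * / t * w t) - Ci * (kt t - ka) * / t * y t) (Ci * RtoC (db t) * (RtoC (lam t) * u t)).
      have q2 := Cmod_minus_le (- ((g t - g0) * / t * w t)) (Ci * (kt t - ka) * / t * y t).
      rewrite Cmod_opp in q2.
      rewrite -(Cmult_assoc Ci (RtoC (db t))) Cmod_Ci_mult in q1 *.
      lra.
    - apply: Rle_trans (b3 _ k6) _.
      have := big 0 (M / m) 0 ltac:(rewrite /K0; lra) ltac:(rewrite /K0; lra) ltac:(rewrite /K0; lra); lra.
  have A3 t : t2 <= t <= T -> Ccont w t /\ Ccont y t.
    move=> Ht; have [_ [_ [_ [cal [cb [cu cv]]]]]] := Hcl t Ht.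
    have cl : continuity_pt lam t by apply: is_derive_continuity_pt; apply: dlam; lra.
    split.
      apply: Ccont_plus => //; apply: Ccont_mult => //; apply: Ccont_mult; first exact: Ccont_const.
      by apply: Ccont_RtoC; exact: continuity_pt_mult.
    by apply: Ccont_mult => //; apply: Ccont_RtoC; exact: continuity_pt_mult.
  have [H1 H2] := HK X al0 D t2 al (fun t => lam t * b t) g0 ka w y e1 e2 X0 (conj t20 t2T) HL ltac:(lra) i0 A1
     ltac:(rewrite /K0; lra) ltac:(rewrite /K0; lra) hD A2 A3.
  pose P t := Cmod (w t) ^ 2 + Cmod (y t) ^ 2.
  have PN t : t2 <= t <= T -> P t <= K1 * N t /\ N t <= K2 * P t.
    move=> Ht; have [_ [[hal1 hal2] [hb _]]] := Hcl t Ht.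
    have EN : N t = Cmod (RtoC (lam t) * u t)%C ^ 2 + Cmod (v t) ^ 2.
      by rewrite Cmod_mult Cmod_R (Rabs_pos_eq (lam t)); [rewrite (Rpow_mult_distr (lam t))|exact/Rlt_le].
    set x := (RtoC (lam t) * u t)%C in EN *.
    have Ey : Cmod (y t) = al t * Cmod x.
      rewrite /y /x RtoC_mult !Cmod_mult !Cmod_R (Rabs_pos_eq (al t)); [ring|lra].
    have Ew : w t = (v t + Ci * (RtoC (b t) * x))%C by rewrite /w /x RtoC_mult; ring.
    have Ev : v t = (w t + Ci * (RtoC (- b t) * x))%C by rewrite Ew RtoC_opp; ring.
    have bx (z : R) : Rabs z <= M -> Cmod (Ci * (RtoC z * x))%C ^ 2 <= M ^ 2 * Cmod x ^ 2.
      move=> hz; rewrite Cmod_Ci_mult Cmod_mult Cmod_R Rpow_mult_distr.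
      apply: Rmult_le_compat_r; first exact: pow2_ge_0.
      by apply: pow_incr; split => //; exact: Rabs_pos.
    have x2 := pow2_ge_0 (Cmod x); have v2 := pow2_ge_0 (Cmod (v t)); have w2 := pow2_ge_0 (Cmod (w t)).
    have y2 := pow2_ge_0 (Cmod (y t)).
    have M2 : 1 <= M ^ 2 by nra.
    have ya : Cmod (y t) ^ 2 <= M ^ 2 * Cmod x ^ 2.
      rewrite Ey Rpow_mult_distr; apply: Rmult_le_compat_r => //; apply: pow_incr; lra.
    have xa : Cmod x ^ 2 <= / m ^ 2 * Cmod (y t) ^ 2.
      have m2 : 0 < m ^ 2 by exact: pow_lt.
      apply: (Rmult_le_reg_l (m ^ 2)) => //; rewrite -Rmult_assoc Rinv_r ?Rmult_1_l; last lra.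
      rewrite Ey Rpow_mult_distr; apply: Rmult_le_compat_r => //; apply: pow_incr; lra.
    split.
    - have := Cmod_plus_sqr (v t) (Ci * (RtoC (b t) * x)); have := bx _ hb.
      rewrite -Ew EN /P /K1 => h1 h2.
      have := Rmult_le_compat_r _ _ _ v2 M2; lra.
    - have hb' : Rabs (- b t) <= M by rewrite Rabs_Ropp.
      have := Cmod_plus_sqr (w t) (Ci * (RtoC (- b t) * x)); have := bx _ hb'.
      rewrite -Ev EN /P /K2 => h1 h2.
      have hM : 0 <= 2 * M ^ 2 + 1 by lra.
      have := Rmult_le_compat_l _ _ _ hM xa.
      have : 0 <= (2 * M ^ 2 + 1) * / m ^ 2 * Cmod (w t) ^ 2.
        apply: Rmult_le_pos => //; apply: Rmult_le_pos => //.
        by apply/Rlt_le/Rinv_0_lt_compat/pow_lt.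
      rewrite /Rdiv; lra.
  have comb (s : R) (Pa Pb Na Nb : R) : Nb <= K2 * Pb -> Pb <= K * Rpower (T / t2) s * Pa -> Pa <= K1 * Na ->
      Nb <= K2 * K * K1 * Rpower (T / t2) s * Na.
    move=> h1 h2 h3.
    have rp := Rpower_pos (T / t2) s.
    have := Rmult_le_compat_l _ _ _ (Rlt_le _ _ K20) h2.
    have kr : 0 <= K2 * (K * Rpower (T / t2) s).
      by apply: Rmult_le_pos; [lra|apply: Rmult_le_pos; lra].
    have := Rmult_le_compat_l _ _ _ kr h3; lra.
  have [g1 g2] := PN t2 ltac:(lra); have [g3 g4] := PN T ltac:(lra).
  by split; apply: comb; eassumption.
Qed.

(** * Fuchsian systems with an integrable perturbation *)

(** Powers of the logarithm in the symbol classes are traded once and for all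
    for an arbitrarily small power of [z]. *)
Lemma log_power_absorb (eta : R) (p : nat) : 0 < eta ->
  exists K, 1 <= K /\ forall z, 0 < z <= 1 -> (1 + Rabs (ln z)) ^ p <= K * Rpower z (- eta).
Proof.
  move=> eta0.
  pose k := eta / (INR p + 1).
  have p0 := pos_INR p.
  have k0 : 0 < k by apply: Rdiv_lt_0_compat; lra.
  have ik := Rinv_0_lt_compat _ k0.
  exists ((1 + / k) ^ p); split; first by apply: pow_R1_Rle; lra.
  move=> z [z0 z1].
  have lz : ln z <= 0 by rewrite -ln_1; apply: ln_le.
  rewrite Rabs_left1 //; set x := - ln z; have x0 : 0 <= x by rewrite /x; lra.
  have h1 : 1 + x <= (1 + / k) * exp (k * x).
    have := exp_ineq1_le (k * x); have : / k * (k * x) = x by field; lra.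
    have := Rmult_le_pos _ _ (Rlt_le _ _ k0) x0; have := exp_pos (k * x).
    move=> a1 a2 a3 a4.
    have := Rmult_le_compat_l _ _ _ (Rlt_le _ _ ik) a4; lra.
  apply: (Rle_trans _ (((1 + / k) * exp (k * x)) ^ p)); first by apply: pow_incr; lra.
  rewrite Rpow_mult_distr; apply: Rmult_le_compat_l; first by apply: pow_le; lra.
  rewrite /Rpower -/x; have -> : - eta * ln z = eta * x by rewrite /x; ring.
  have -> : exp (k * x) ^ p = exp (INR p * (k * x)).
    elim: (p) => [|n IH]; first by rewrite /= Rmult_0_l exp_0.
    by rewrite S_INR Rmult_plus_distr_r Rmult_1_l exp_plus -IH /=; ring.
  apply: exp_le_compat.
  have -> : eta = k * (INR p + 1) by rewrite /k; field; lra.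
  have := Rmult_le_pos _ _ (Rlt_le _ _ k0) x0; lra.
Qed.

(** Limits at [0+] with the modulus, free of the filter of the zone. *)
Definition tends_at_0 (f : R -> C) (l : C) : Prop :=
  forall e, 0 < e -> exists d, 0 < d /\ forall t, 0 < t < d -> Cmod (f t - l)%C < e.

Lemma tends_at_0_ext (f g : R -> C) l a : 0 < a -> (forall t, 0 < t < a -> f t = g t) ->
  tends_at_0 f l -> tends_at_0 g l.
Proof.
  move=> a0 H Hf e e0; have [d [d0 Hd]] := Hf e e0; exists (Rmin a d).
  split; first exact: Rmin_glb_lt.
  move=> t [t0 t1]; have := Rmin_l a d; have := Rmin_r a d => h1 h2.
  rewrite -H; [apply: Hd|]; lra.
Qed.

Lemma tends_at_0_lin (f g : R -> C) l m (c c' : C) : tends_at_0 f l -> tends_at_0 g m ->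
  tends_at_0 (fun t => c * f t + c' * g t)%C (c * l + c' * m)%C.
Proof.
  move=> Hf Hg e e0.
  have k0 : 0 < Cmod c + Cmod c' + 1 by have := Cmod_ge_0 c; have := Cmod_ge_0 c'; lra.
  have e1 : 0 < e / (Cmod c + Cmod c' + 1) by apply: Rdiv_lt_0_compat.
  have [d [d0 Hd]] := Hf _ e1; have [d' [d0' Hd']] := Hg _ e1.
  exists (Rmin d d'); split; first exact: Rmin_glb_lt.
  move=> t [t0 t1]; have := Rmin_l d d'; have := Rmin_r d d' => h1 h2.
  have -> : (c * f t + c' * g t - (c * l + c' * m) = c * (f t - l) + c' * (g t - m))%C by ring.
  apply: Rle_lt_trans (Cmod_triangle _ _) _; rewrite !Cmod_mult.
  have a1 := Rmult_le_compat_l _ _ _ (Cmod_ge_0 c) (Rlt_le _ _ (Hd t ltac:(lra))).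
  have a2 := Rmult_le_compat_l _ _ _ (Cmod_ge_0 c') (Rlt_le _ _ (Hd' t ltac:(lra))).
  have E : e / (Cmod c + Cmod c' + 1) * (Cmod c + Cmod c' + 1) = e by field; lra.
  lra.
Qed.

Lemma tends_at_0_unique (f : R -> C) l m : tends_at_0 f l -> tends_at_0 f m -> l = m.
Proof.
  move=> Hl Hm.
  have H : Cmod (l - m)%C = 0.
    apply: Rle_antisym; last exact: Cmod_ge_0.
    apply: Rnot_lt_le => h.
    have h2 : 0 < Cmod (l - m)%C / 2 by lra.
    have [d [d0 Hd]] := Hl _ h2; have [d' [d0' Hd']] := Hm _ h2.
    have hm : 0 < Rmin d d' by exact: Rmin_glb_lt.
    have := Rmin_l d d'; have := Rmin_r d d' => h3 h4.
    pose t := Rmin d d' / 2.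
    have a1 := Hd t ltac:(rewrite /t; lra); have a2 := Hd' t ltac:(rewrite /t; lra).
    have := Cmod_minus_le (f t - m) (f t - l).
    have -> : (f t - m - (f t - l) = l - m)%C by ring.
    lra.
  have := Cmod_eq_0 _ H => h.
  have -> : l = (l - m + m)%C by ring.
  by rewrite h Cplus_0_l.
Qed.

Lemma tends_at_0_Cmod_sqr (f g : R -> C) l m (A B : R) a : 0 < a ->
  tends_at_0 f l -> tends_at_0 g m ->
  (forall t, 0 < t < a -> A <= Cmod (f t) ^ 2 + Cmod (g t) ^ 2 <= B) ->
  A <= Cmod l ^ 2 + Cmod m ^ 2 <= B.
Proof.
  move=> a0 Hf Hg H.
  set X := Cmod l ^ 2 + Cmod m ^ 2.
  have appr e : 0 < e -> exists S, A <= S <= B /\ Rabs (S - X) < e.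
    move=> e0.
    pose k := 2 * (Cmod l + Cmod m) + 2.
    have l0 := Cmod_ge_0 l; have m0 := Cmod_ge_0 m.
    have e1 : 0 < Rmin 1 (e / (2 * k)).
      apply: Rmin_glb_lt; first lra.
      by apply: Rdiv_lt_0_compat; rewrite /k; lra.
    have [d [d0 Hd]] := Hf _ e1; have [d' [d0' Hd']] := Hg _ e1.
    set t := Rmin a (Rmin d d') / 2.
    have mm := Rmin_glb_lt _ _ _ d0 d0'; have mm2 := Rmin_glb_lt _ _ _ a0 mm.
    have q1 := Rmin_l a (Rmin d d'); have q2 := Rmin_r a (Rmin d d').
    have q3 := Rmin_l d d'; have q4 := Rmin_r d d'.
    exists (Cmod (f t) ^ 2 + Cmod (g t) ^ 2); split; first by apply: H; rewrite /t; lra.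
    have w1 := Hd t ltac:(rewrite /t; lra); have w2 := Hd' t ltac:(rewrite /t; lra).
    have r1 := Rmin_l 1 (e / (2 * k)); have r2 := Rmin_r 1 (e / (2 * k)).
    have key (x y : C) : Cmod (x - y)%C < Rmin 1 (e / (2 * k)) ->
       Cmod y <= Cmod l + Cmod m -> Rabs (Cmod x ^ 2 - Cmod y ^ 2) < k * Rmin 1 (e / (2 * k)).
      move=> hx hy.
      have t1 := Cmod_triangle (x - y) y; have t2 := Cmod_minus_le x (x - y).
      have e2 : (x - y + y = x)%C by ring.
      have e3 : (x - (x - y) = y)%C by ring.
      rewrite e2 in t1; rewrite e3 in t2.
      have x0 := Cmod_ge_0 x; have y0 := Cmod_ge_0 y; have xy0 := Cmod_ge_0 (x - y)%C.
      have -> : Cmod x ^ 2 - Cmod y ^ 2 = (Cmod x + Cmod y) * (Cmod x - Cmod y) by ring.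
      have b1 : Rabs (Cmod x + Cmod y) <= k by rewrite Rabs_pos_eq /k; lra.
      have b2 : Rabs (Cmod x - Cmod y) <= Cmod (x - y)%C by apply/Rabs_le_between; lra.
      apply: Rle_lt_trans (Rabs_mult_le _ _ _ _ b1 b2) _.
      apply: Rmult_lt_compat_l => //; rewrite /k; lra.
    have k1 := key _ _ w1 ltac:(lra); have k2 := key _ _ w2 ltac:(lra).
    have -> : Cmod (f t) ^ 2 + Cmod (g t) ^ 2 - X = (Cmod (f t) ^ 2 - Cmod l ^ 2) + (Cmod (g t) ^ 2 - Cmod m ^ 2) by rewrite /X; ring.
    apply: Rle_lt_trans (Rabs_triang _ _) _.
    have kp : 0 < k by rewrite /k; lra.
    have E : k * (e / (2 * k)) = e / 2 by field; lra.
    have := Rmult_le_compat_l _ _ _ (Rlt_le _ _ kp) r2; lra.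
  split; apply: Rnot_lt_le => h.
  - have [S [HS /Rabs_lt_between hS]] := appr (A - X) ltac:(lra); lra.
  - have [S [HS /Rabs_lt_between hS]] := appr (X - B) ltac:(lra); lra.
Qed.

(** [f] varies less than the primitive [r] of the bound for its derivative, and
    [r] vanishes at 0; so [f] satisfies the Cauchy criterion. *)
Lemma tends_at_0_of_derive (f df : R -> C) (r dr : R -> R) (a : R) :
  0 < a ->
  (forall t, 0 < t < a -> is_Cderive f t (df t) /\ is_derive r t (dr t) /\ Cmod (df t) <= dr t /\ 0 <= r t) ->
  (forall e, 0 < e -> exists d, 0 < d /\ forall t, 0 < t < d -> r t < e) ->
  exists l, tends_at_0 f l.
Proof.
  move=> a0 H Hr.
  have main (g dg : R -> R) : (forall t, 0 < t < a -> is_derive g t (dg t) /\ Rabs (dg t) <= dr t) ->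
      exists l, forall e, 0 < e -> exists d, 0 < d /\ forall t, 0 < t < d -> Rabs (g t - l) < e.
    move=> Hg.
    have inc s t : 0 < s -> s <= t -> t < a -> Rabs (g t - g s) <= r t - r s.
      move=> s0 st ta; apply: (abs_increment_le_of_derive g dg r dr) => // x Hx.
      - by have [h _] := Hg x ltac:(lra).
      - by have [_ [h _]] := H x ltac:(lra).
      - have [h _] := Hg x ltac:(lra); apply: is_derive_continuity_pt; exact: h.
      - have [_ [h _]] := H x ltac:(lra); apply: is_derive_continuity_pt; exact: h.
      - by have [_ h] := Hg x ltac:(lra).
    have [l Hl] : exists l : R, filterlim g (at_right 0) (locally l).
      apply/(filterlim_locally_cauchy (F := at_right 0)) => e.
      have [d [d0 Hd]] := Hr e (cond_pos e).
      exists (fun t => 0 < t < Rmin a d); split.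
        have m0 := Rmin_glb_lt _ _ _ a0 d0.
        exists (mkposreal _ m0) => t /ball_Rabs /Rabs_lt_between /= h1 h2; lra.
      have q1 := Rmin_l a d; have q2 := Rmin_r a d.
      move=> s t Hs Ht; apply/ball_Rabs.
      have rs := Hd s ltac:(lra); have rt := Hd t ltac:(lra).
      have [_ [_ [_ rs0]]] := H s ltac:(lra); have [_ [_ [_ rt0]]] := H t ltac:(lra).
      case: (Rle_dec s t) => hst; first by have := inc s t ltac:(lra) hst ltac:(lra); lra.
      rewrite Rabs_minus_sym; have := inc t s ltac:(lra) ltac:(lra) ltac:(lra); lra.
    exists l => e e0.
    have : locally l (fun y => Rabs (y - l) < e).
      by exists (mkposreal _ e0) => y /ball_Rabs.
    move=> /Hl [d Hd]; exists d; split; first exact: cond_pos.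
    move=> t [t0 td]; apply: Hd => //; apply/ball_Rabs; apply/Rabs_lt_between; lra.
  have [l1 H1] : exists l, forall e, 0 < e -> exists d, 0 < d /\ forall t, 0 < t < d -> Rabs (Re (f t) - l) < e.
    apply: (main (fun t => Re (f t)) (fun t => Re (df t))) => t Ht; have [[h _] [_ [h2 _]]] := H t Ht.
    by split => //; apply: Rle_trans (Rabs_Re_le _) _.
  have [l2 H2] : exists l, forall e, 0 < e -> exists d, 0 < d /\ forall t, 0 < t < d -> Rabs (Im (f t) - l) < e.
    apply: (main (fun t => Im (f t)) (fun t => Im (df t))) => t Ht; have [[_ h] [_ [h2 _]]] := H t Ht.
    by split => //; apply: Rle_trans (Rabs_Im_le _) _.
  exists (l1, l2) => e e0.
  have e2 : 0 < e / 2 by lra.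
  have [d [d0 Hd]] := H1 _ e2; have [d' [d0' Hd']] := H2 _ e2.
  exists (Rmin d d'); split; first exact: Rmin_glb_lt.
  move=> t [t0 t1]; have := Rmin_l d d'; have := Rmin_r d d' => h1 h2.
  apply: Rle_lt_trans (Cmod_le_Rabs _) _.
  have -> : Re (f t - (l1, l2))%C = Re (f t) - l1 by [].
  have -> : Im (f t - (l1, l2))%C = Im (f t) - l2 by [].
  have := Hd t ltac:(lra); have := Hd' t ltac:(lra); lra.
Qed.

(** In the variable [z = J * t] the coefficient is [z^(eta - 1)], whose integral
    over [0 < z <= 1] is [/ eta] for every [J]. This is where uniformity in the
    frequency comes from. *)
Lemma integrable_system_limits (K eta J t1 : R) (y1 y2 dy1 dy2 : R -> C) :
  0 <= K -> 0 < eta -> 0 < J -> 0 < t1 -> J * t1 <= 1 ->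
  (forall t, 0 < t < t1 -> is_Cderive y1 t (dy1 t) /\ is_Cderive y2 t (dy2 t) /\
     Cmod (dy1 t) <= J * K * Rpower (J * t) (eta - 1) * (Cmod (y1 t) + Cmod (y2 t)) /\
     Cmod (dy2 t) <= J * K * Rpower (J * t) (eta - 1) * (Cmod (y1 t) + Cmod (y2 t))) ->
  exists l1 l2, tends_at_0 y1 l1 /\ tends_at_0 y2 l2 /\
    forall t, 0 < t < t1 ->
      Cmod l1 ^ 2 + Cmod l2 ^ 2 <= exp (4 * (K / eta)) * (Cmod (y1 t) ^ 2 + Cmod (y2 t) ^ 2) /\
      Cmod (y1 t) ^ 2 + Cmod (y2 t) ^ 2 <= exp (4 * (K / eta)) * (Cmod l1 ^ 2 + Cmod l2 ^ 2).
Proof.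
  move=> K0 eta0 J0 t10 Jt1 H.
  pose r t := K / eta * Rpower (J * t) eta.
  pose dr t := J * K * Rpower (J * t) (eta - 1).
  have Jt t : 0 < t -> 0 < J * t by move=> Ht; exact: Rmult_lt_0_compat.
  have dRt t : 0 < t -> is_derive (fun s => Rpower (J * s) eta) t (J * eta * Rpower (J * t) (eta - 1)).
    move=> Ht; apply: is_derive_eq.
      apply: (is_derive_comp (fun x => Rpower x eta) (fun s => J * s)).
        by apply: is_derive_Rpower; exact: Jt.
      by apply: is_derive_Rmult; [exact: is_derive_const|exact: is_derive_id].
    by rewrite /scal /= /mult /one /zero /=; ring.
  have dr_ t : 0 < t -> is_derive r t (dr t).
    move=> Ht; apply: is_derive_eq.
      by apply: is_derive_Rmult; [exact: is_derive_const|exact: dRt].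
    rewrite /dr /zero /=; field; lra.
  have Ke0 : 0 <= K / eta by apply: Rmult_le_pos => //; exact/Rlt_le/Rinv_0_lt_compat.
  have r0 t : 0 < t -> 0 <= r t by move=> Ht; apply: Rmult_le_pos => //; exact/Rlt_le/Rpower_pos.
  have r1 t : 0 < t < t1 -> r t <= K / eta.
    move=> Ht; rewrite -[X in _ <= X]Rmult_1_r; apply: Rmult_le_compat_l => //.
    rewrite /Rpower -exp_0; apply: exp_le_compat.
    have l0 : ln (J * t) <= 0.
      rewrite -ln_1; apply: ln_le; first by apply: Jt; lra.
      apply: Rle_trans Jt1; apply: Rmult_le_compat_l; lra.
    nra.
  have small e : 0 < e -> exists d, 0 < d /\ forall t, 0 < t < d -> r t < e.
    move=> e0.
    pose e' := e / (K / eta + 1).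
    have e'0 : 0 < e' by apply: Rdiv_lt_0_compat; lra.
    exists (Rpower e' (/ eta) / J); split; first by apply: Rdiv_lt_0_compat => //; exact: Rpower_pos.
    move=> t [Ht /Rlt_div_r Ht2]; have {Ht2} := Ht2 J0; rewrite Rmult_comm => Ht2.
    have h : Rpower (J * t) eta <= e'.
      have -> : e' = Rpower (Rpower e' (/ eta)) eta.
        by rewrite Rpower_mult Rinv_l ?Rpower_1 //; lra.
      apply: Rle_Rpower_l; first lra.
      by split; [exact: Jt|exact/Rlt_le].
    have rp := Rpower_pos (J * t) eta.
    have E : (K / eta + 1) * e' = e by rewrite /e'; field; split; lra.
    have := Rmult_le_compat_l (K / eta + 1) _ _ ltac:(lra) h; rewrite /r; lra.
  pose G t := Cmod (y1 t) ^ 2 + Cmod (y2 t) ^ 2.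
  have cmp s t : 0 < s -> s <= t -> t < t1 -> G t <= G s * exp (4 * (K / eta)) /\ G s <= G t * exp (4 * (K / eta)).
    move=> s0 st tt1.
    have [h1 h2] : G t <= G s * exp (4 * (r t - r s)) /\ G s <= G t * exp (4 * (r t - r s)).
      apply: (pair_energy_bound y1 y2 dy1 dy2 r dr s t st) => x Hx.
      - have [a1 [a2 _]] := H x ltac:(lra); do 2 split => //; apply: dr_; lra.
      - have [a1 [a2 _]] := H x ltac:(lra); split; first exact: is_Cderive_Ccont a1.
        split; first exact: is_Cderive_Ccont a2.
        apply: is_derive_continuity_pt; apply: dr_; lra.
      - by have [_ [_ [a1 a2]]] := H x ltac:(lra).
    have he : exp (4 * (r t - r s)) <= exp (4 * (K / eta)).
      apply: exp_le_compat; have := r0 s s0; have := r1 t ltac:(lra); lra.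
    have G0 x : 0 <= G x by apply: Rplus_le_le_0_compat; exact: pow2_ge_0.
    split; [apply: Rle_trans h1 _|apply: Rle_trans h2 _]; exact: Rmult_le_compat_l.
  pose B := 2 * (1 + G (t1 / 2) * exp (4 * (K / eta))).
  have bd s : 0 < s < t1 / 2 -> Cmod (y1 s) + Cmod (y2 s) <= B.
    move=> Hs; have [_ h] := cmp s (t1 / 2) ltac:(lra) ltac:(lra) ltac:(lra).
    have hh : Cmod (y1 s) ^ 2 + Cmod (y2 s) ^ 2 <= G (t1 / 2) * exp (4 * (K / eta)) := h.
    have := pow2_ge_0 (Cmod (y1 s) - 1); have := pow2_ge_0 (Cmod (y2 s) - 1).
    have := pow2_ge_0 (Cmod (y1 s)); have := pow2_ge_0 (Cmod (y2 s)); rewrite /B; lra.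
  have B0 : 0 <= B.
    have := bd (t1 / 4) ltac:(lra); have := Cmod_ge_0 (y1 (t1 / 4)); have := Cmod_ge_0 (y2 (t1 / 4)); lra.
  have lim (y dy : R -> C) : (forall t, 0 < t < t1 -> is_Cderive y t (dy t) /\
      Cmod (dy t) <= J * K * Rpower (J * t) (eta - 1) * (Cmod (y1 t) + Cmod (y2 t))) -> exists l, tends_at_0 y l.
    move=> Hy.
    apply: (tends_at_0_of_derive y dy (fun t => B * r t) (fun t => B * dr t) (t1 / 2)); first lra.
    - move=> t Ht; have [a1 a2] := Hy t ltac:(lra); split => //; split.
        apply: is_derive_eq.
          by apply: is_derive_Rmult; [exact: is_derive_const|apply: dr_; lra].
        rewrite /zero /=; ring.
      split; last by apply: Rmult_le_pos => //; apply: r0; lra.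
      apply: Rle_trans a2 _; rewrite (Rmult_comm B); apply: Rmult_le_compat_l; last exact: bd.
      apply: Rmult_le_pos; first by apply: Rmult_le_pos; lra.
      exact/Rlt_le/Rpower_pos.
    - move=> e e0.
      have e1 : 0 < e / (B + 1) by apply: Rdiv_lt_0_compat; lra.
      have [d [d0 Hd]] := small _ e1; exists d; split => // t Ht.
      have h := Hd t Ht; have h0 := r0 t (proj1 Ht).
      have E : (B + 1) * (e / (B + 1)) = e by field; lra.
      have := Rmult_lt_compat_l (B + 1) _ _ ltac:(lra) h; lra.
  have [l1 Hl1] := lim y1 dy1 (fun t Ht => let '(conj a (conj _ (conj b _))) := H t Ht in conj a b).
  have [l2 Hl2] := lim y2 dy2 (fun t Ht => let '(conj _ (conj a (conj _ b))) := H t Ht in conj a b).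
  exists l1, l2; do 2 split => //.
  move=> t Ht.
  have e0 := exp_pos (4 * (K / eta)).
  have [h1 h2] : G t * / exp (4 * (K / eta)) <= Cmod l1 ^ 2 + Cmod l2 ^ 2 <= G t * exp (4 * (K / eta)).
    apply: (tends_at_0_Cmod_sqr y1 y2 l1 l2 _ _ t) => //; first lra.
    move=> s Hs; have [a1 a2] := cmp s t ltac:(lra) ltac:(lra) ltac:(lra).
    split => //; apply: (Rmult_le_reg_r (exp (4 * (K / eta)))) => //.
    by rewrite Rmult_assoc Rinv_l ?Rmult_1_r //; lra.
  split; first by rewrite Rmult_comm.
  have := Rmult_le_compat_l _ _ _ (Rlt_le _ _ e0) h1.
  have -> : exp (4 * (K / eta)) * (G t * / exp (4 * (K / eta))) = G t by field; lra.
  by [].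
Qed.

Lemma RpowerC_derive (s : C) (t : R) : 0 < t ->
  is_Cderive (fun x => RpowerC x s) t (RtoC (/ t) * s * RpowerC t s)%C.
Proof.
  move=> Ht.
  have dl : is_derive (fun x => Im s * ln x) t (Im s * / t).
    apply: is_derive_eq.
      apply: is_derive_Rmult; first exact: is_derive_const.
      by apply/is_derive_Reals; exact: derivable_pt_lim_ln.
    rewrite /zero /=; ring.
  split; rewrite /RpowerC /=.
  - apply: is_derive_eq.
      apply: is_derive_Rmult; first exact: is_derive_Rpower.
      apply: (is_derive_comp cos (fun x => Im s * ln x)); last exact: dl.
      exact: is_derive_cos.
    rewrite Rpower_minus_1 // /scal /= /mult /= /Re /Im /=; field; lra.
  - apply: is_derive_eq.
      apply: is_derive_Rmult; first exact: is_derive_Rpower.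
      apply: (is_derive_comp sin (fun x => Im s * ln x)); last exact: dl.
      exact: is_derive_sin.
    rewrite Rpower_minus_1 // /scal /= /mult /= /Re /Im /=; field; lra.
Qed.

Lemma Cmod_RpowerC (s : C) (t : R) : Cmod (RpowerC t s) = Rpower t (Re s).
Proof.
  have h := Rlt_le _ _ (Rpower_pos t (Re s)).
  apply: Rsqr_inj => //; first exact: Cmod_ge_0.
  rewrite !Rsqr_pow2 Cmod_sqr /RpowerC /Re /Im /=.
  have := sin2_cos2 (snd s * ln t); rewrite /Rsqr => H.
  have -> : Rpower t (fst s) * cos (snd s * ln t) * (Rpower t (fst s) * cos (snd s * ln t) * 1) +
    Rpower t (fst s) * sin (snd s * ln t) * (Rpower t (fst s) * sin (snd s * ln t) * 1) =
    Rpower t (fst s) * Rpower t (fst s) * (sin (snd s * ln t) * sin (snd s * ln t) + cos (snd s * ln t) * cos (snd s * ln t)) by ring.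
  rewrite H; ring.
Qed.

Lemma Rpower_le_1_antitone (z a b : R) : 0 < z <= 1 -> b <= a -> Rpower z a <= Rpower z b.
Proof.
  move=> [z0 z1] h; rewrite /Rpower; apply: exp_le_compat.
  have : ln z <= 0 by rewrite -ln_1; apply: ln_le.
  nra.
Qed.

Lemma Cminus_0_eq (x y : C) : (x - y = 0)%C -> x = y.
Proof.
  move=> h; have -> : x = (x - y + y)%C by ring.
  by rewrite h Cplus_0_l.
Qed.

Lemma sqr_le_linear (k a b : R) : 1 <= k -> 0 <= a -> 0 <= b -> a ^ 2 <= k * b ^ 2 -> a <= k * b.
Proof.
  move=> hk a0 b0 h; apply: Rnot_lt_le => hl.
  have h2 : (k * b) ^ 2 < a ^ 2.
    have kb : 0 <= k * b by apply: Rmult_le_pos; lra.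
    by have := Rsqr_incrst_1 _ _ hl kb a0; rewrite !Rsqr_pow2.
  have := pow2_ge_0 b; rewrite Rpow_mult_distr in h2 => hb.
  have : k * b ^ 2 <= k ^ 2 * b ^ 2 by apply: Rmult_le_compat_r => //; nra.
  lra.
Qed.

(** Multiplication by [t^e1] and [t^e2], together with the subtraction of the
    logarithm when [nu = 1], conjugates the singular part [B / t] away. The diagonal
    matrix of [d1] and [d2] is only affected through the logarithm, and the
    remainder by at most the power [Re e1 - Re e2] of [z], which the hypothesis
    on [r1] and [r2] provides. The factors [J^(Re e)] make the
    transformed unknowns functions of size comparable with that of [W] at
    [z] of order 1. *)
Lemma fuchsian_pair_limits (C0 eta zm : R) (e1 e2 : C) (nu : R) :
  0 <= C0 -> 0 < eta -> 0 < zm -> (nu = 0 \/ nu = 1 /\ e1 = e2) ->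
  exists K, 0 < K /\
  forall (J t1 : R) (W1 W2 d1 d2 r1 r2 : R -> C), 0 < J -> 0 < t1 -> J * t1 <= 1 ->
  (forall t, 0 < t < t1 ->
     is_Cderive W1 t (RtoC (/ t) * (RtoC nu * W2 t - e1 * W1 t) + RtoC J * (d1 t * W1 t + r1 t))%C /\
     is_Cderive W2 t (RtoC (/ t) * (- (e2 * W2 t)) + RtoC J * (d2 t * W2 t + r2 t))%C /\
     Cmod (d1 t) <= C0 * Rpower (J * t) (3 * eta - 1) /\
     Cmod (d2 t) <= C0 * Rpower (J * t) (3 * eta - 1) /\
     Cmod (r1 t) <= C0 * Rpower (J * t) (Rabs (Re e1 - Re e2) + 3 * eta - 1) * (Cmod (W1 t) + Cmod (W2 t)) /\
     Cmod (r2 t) <= C0 * Rpower (J * t) (Rabs (Re e1 - Re e2) + 3 * eta - 1) * (Cmod (W1 t) + Cmod (W2 t))) ->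
  exists l1 l2,
    tends_at_0 (fun t => RpowerC t e1 * (W1 t - RtoC (nu * ln (J * t)) * W2 t))%C l1 /\
    tends_at_0 (fun t => RpowerC t e2 * W2 t)%C l2 /\
    forall t, 0 < t < t1 -> zm <= J * t ->
      let S := Rpower J (Re e1) * Cmod l1 + Rpower J (Re e2) * Cmod l2 in
      S <= K * (Cmod (W1 t) + Cmod (W2 t)) /\ Cmod (W1 t) + Cmod (W2 t) <= K * S.
Proof.
  move=> C00 eta0 zm0 Hnu.
  have [Kl [Kl1 HKl]] := log_power_absorb eta 1 eta0.
  have nu01 : 0 <= nu <= 1 by case: Hnu => [->|[-> _]]; lra.
  pose K := 2 * C0 * Kl ^ 2.
  have K0 : 0 <= K by apply: Rmult_le_pos; [lra|exact: pow2_ge_0].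
  pose Ex := exp (4 * (K / eta)).
  have Ke0 : 0 <= K / eta by apply: Rmult_le_pos => //; exact/Rlt_le/Rinv_0_lt_compat.
  have Ex1 : 1 <= Ex by rewrite /Ex -exp_0; apply: exp_le_compat; lra.
  pose c := Rpower zm (- (Rabs (Re e1) + Rabs (Re e2))).
  pose lam := Rabs (ln zm).
  have c0 : 0 < c by exact: Rpower_pos.
  have lam0 : 0 <= lam by exact: Rabs_pos.
  exists (2 * Ex * (c * (1 + lam))); split.
    by apply: Rmult_lt_0_compat; [lra|apply: Rmult_lt_0_compat; lra].
  move=> J t1 W1 W2 d1 d2 r1 r2 J0 t10 Jt1 H.
  pose j1 := Rpower J (Re e1); pose j2 := Rpower J (Re e2).
  have j10 : 0 < j1 by exact: Rpower_pos.
  have j20 : 0 < j2 by exact: Rpower_pos.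
  pose y1 t := (RtoC j1 * (RpowerC t e1 * (W1 t - RtoC (nu * ln (J * t)) * W2 t)))%C.
  pose y2 t := (RtoC j2 * (RpowerC t e2 * W2 t))%C.
  pose dy1 t := (RtoC j1 * (RpowerC t e1 * (RtoC J * (d1 t * W1 t + r1 t - RtoC (nu * ln (J * t)) * (d2 t * W2 t + r2 t)))))%C.
  pose dy2 t := (RtoC j2 * (RpowerC t e2 * (RtoC J * (d2 t * W2 t + r2 t))))%C.
  have ee : (RtoC nu * e1 = RtoC nu * e2)%C by case: Hnu => [->|[_ ->]] //; rewrite !Cmult_0_l.
  have dl t : 0 < t -> is_derive (fun s => nu * ln (J * s)) t (nu * / t).
    move=> Ht; have Jt : 0 < J * t by exact: Rmult_lt_0_compat.
    auto_derive => //; field; lra.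
  have Hder t (Ht : 0 < t < t1) : is_Cderive y1 t (dy1 t) /\ is_Cderive y2 t (dy2 t).
    have [H1 [H2 _]] := H t Ht; have t0 : 0 < t by lra.
    split.
    - apply: is_Cderive_eq.
        apply: is_Cderive_mult; first exact: is_Cderive_const.
        apply: is_Cderive_mult; first exact: RpowerC_derive.
        apply: is_Cderive_minus; first exact: H1.
        by apply: is_Cderive_mult; [apply: is_Cderive_RtoC; exact: dl|exact: H2].
      rewrite /dy1 (RtoC_mult nu (/ t)) (RtoC_mult nu (ln (J * t))).
      set X := RpowerC t e1; set i := RtoC (/ t); set L := RtoC (ln (J * t)).
      apply: Cminus_0_eq.
      transitivity (RtoC j1 * X * i * L * W2 t * (RtoC nu * e2 - RtoC nu * e1))%C; first by ring.
      rewrite ee; ring.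
    - apply: is_Cderive_eq.
        apply: is_Cderive_mult; first exact: is_Cderive_const.
        by apply: is_Cderive_mult; [exact: RpowerC_derive|exact: H2].
      rewrite /dy2; ring.
  have mod1 t x : 0 < t -> Cmod (RtoC j1 * (RpowerC t e1 * x))%C = Rpower (J * t) (Re e1) * Cmod x.
    move=> Ht; rewrite !Cmod_mult Cmod_R Cmod_RpowerC Rabs_pos_eq; last lra.
    by rewrite -Rmult_assoc -Rpower_mult_distr.
  have mod2 t x : 0 < t -> Cmod (RtoC j2 * (RpowerC t e2 * x))%C = Rpower (J * t) (Re e2) * Cmod x.
    move=> Ht; rewrite !Cmod_mult Cmod_R Cmod_RpowerC Rabs_pos_eq; last lra.
    by rewrite -Rmult_assoc -Rpower_mult_distr.
  have nuL t : Cmod (RtoC (nu * ln (J * t))) = nu * Rabs (ln (J * t)).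
    by rewrite Cmod_R Rabs_mult Rabs_pos_eq; lra.
  (* [nu] can be 1 only if both weights coincide; this is what allows the
     logarithmic term to be bounded by [y2]. *)
  have comp t (Ht : 0 < t < t1) :
      let z := J * t in let lg := Rabs (ln z) in
      let x1 := Rpower z (Re e1) * Cmod (W1 t) in let x2 := Rpower z (Re e2) * Cmod (W2 t) in
      x2 = Cmod (y2 t) /\ x1 <= Cmod (y1 t) + lg * Cmod (y2 t) /\ Cmod (y1 t) <= x1 + lg * x2 /\
      nu * Rpower z (Re e1) <= Rpower z (Re e2).
    move=> z lg x1 x2; have t0 : 0 < t by lra.
    have lg0 : 0 <= lg by exact: Rabs_pos.
    have E2 : x2 = Cmod (y2 t) by rewrite mod2.
    have Hnz : nu * Rpower z (Re e1) <= Rpower z (Re e2).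
      by case: Hnu => [->|[-> ->]]; rewrite ?Rmult_0_l ?Rmult_1_l; [exact/Rlt_le/Rpower_pos|exact: Rle_refl].
    have aux : Rpower z (Re e1) * (nu * lg * Cmod (W2 t)) <= lg * x2.
      have := Rmult_le_compat_r _ _ _ (Rmult_le_pos _ _ lg0 (Cmod_ge_0 (W2 t))) Hnz; rewrite /x2; lra.
    have z0 := Rlt_le _ _ (Rpower_pos z (Re e1)).
    have LW : Cmod (RtoC (nu * ln z) * W2 t)%C = nu * lg * Cmod (W2 t) by rewrite Cmod_mult nuL.
    split => //; rewrite -E2; split; last split => //.
    - rewrite mod1 // -/z.
      have h := Cmod_triangle (W1 t - RtoC (nu * ln z) * W2 t) (RtoC (nu * ln z) * W2 t).
      have E : (W1 t - RtoC (nu * ln z) * W2 t + RtoC (nu * ln z) * W2 t = W1 t)%C by ring.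
      rewrite E LW in h; have := Rmult_le_compat_l _ _ _ z0 h; rewrite -/x1; lra.
    - rewrite mod1 // -/z.
      have h := Cmod_minus_le (W1 t) (RtoC (nu * ln z) * W2 t).
      rewrite LW in h; have := Rmult_le_compat_l _ _ _ z0 h; rewrite Rmult_plus_distr_l -/x1; lra.
  have Jt t : 0 < t < t1 -> 0 < J * t <= 1.
    move=> Ht; split; first by apply: Rmult_lt_0_compat; lra.
    apply: Rle_trans Jt1; apply: Rmult_le_compat_l; lra.
  have Hb t (Ht : 0 < t < t1) :
     Cmod (dy1 t) <= J * K * Rpower (J * t) (eta - 1) * (Cmod (y1 t) + Cmod (y2 t)) /\
     Cmod (dy2 t) <= J * K * Rpower (J * t) (eta - 1) * (Cmod (y1 t) + Cmod (y2 t)).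
    have [_ [_ [hd1 [hd2 [hr1 hr2]]]]] := H t Ht; have t0 : 0 < t by lra.
    have [E2 [X1 [_ Hnz]]] := comp t Ht.
    have [z0 z1] := Jt t Ht.
    rewrite /dy1 /dy2 mod1 // mod2 // 2!(Cmod_mult (RtoC J)) (Cmod_R J) (Rabs_pos_eq J); last lra.
    move: hd1 hd2 hr1 hr2 X1 E2 Hnz z0 z1; set z := J * t; set lg := Rabs (ln z).
    set x1 := Rpower z (Re e1) * Cmod (W1 t); set x2 := Rpower z (Re e2) * Cmod (W2 t).
    move=> hd1 hd2 hr1 hr2 X1 E2 Hnz z0 z1.
    have lg0 : 0 <= lg by exact: Rabs_pos.
    have W10 := Cmod_ge_0 (W1 t); have W20 := Cmod_ge_0 (W2 t).
    pose q := C0 * Rpower z (3 * eta - 1).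
    have q0 : 0 <= q by apply: Rmult_le_pos => //; exact/Rlt_le/Rpower_pos.
    have p1 := Rlt_le _ _ (Rpower_pos z (Re e1)); have p2 := Rlt_le _ _ (Rpower_pos z (Re e2)).
    have x10 : 0 <= x1 by exact: Rmult_le_pos.
    have x20 : 0 <= x2 by exact: Rmult_le_pos.
    have D1 : Rpower z (Re e1) * Cmod (d1 t * W1 t)%C <= q * x1.
      rewrite Cmod_mult; have := Rmult_le_compat_r _ _ _ (Rmult_le_pos _ _ p1 W10) hd1; rewrite /q /x1; lra.
    have D2 : Rpower z (Re e2) * Cmod (d2 t * W2 t)%C <= q * x2.
      rewrite Cmod_mult; have := Rmult_le_compat_r _ _ _ (Rmult_le_pos _ _ p2 W20) hd2; rewrite /q /x2; lra.
    have gap (ei ej : C) : (ei = e1 /\ ej = e2 \/ ei = e2 /\ ej = e1 \/ ei = ej) ->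
       Rpower z (Re ei) * Rpower z (Rabs (Re e1 - Re e2)) <= Rpower z (Re ej).
      move=> hij; rewrite -Rpower_plus; apply: Rpower_le_1_antitone; first lra.
      have := Rle_abs (Re e1 - Re e2); have := Rle_abs (- (Re e1 - Re e2)); rewrite Rabs_Ropp.
      by case: hij => [[-> ->]|[[-> ->]|->]]; lra.
    have R_ (ei : C) (r : C) : (ei = e1 \/ ei = e2) ->
       Cmod r <= C0 * Rpower z (Rabs (Re e1 - Re e2) + 3 * eta - 1) * (Cmod (W1 t) + Cmod (W2 t)) ->
       Rpower z (Re ei) * Cmod r <= q * (x1 + x2).
      move=> hei hr; have pi := Rlt_le _ _ (Rpower_pos z (Re ei)).
      have := Rmult_le_compat_l _ _ _ pi hr.
      have -> : Rabs (Re e1 - Re e2) + 3 * eta - 1 = Rabs (Re e1 - Re e2) + (3 * eta - 1) by ring.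
      rewrite Rpower_plus.
      have g1 := gap ei e1 ltac:(case: hei => ->; tauto); have g2 := gap ei e2 ltac:(case: hei => ->; tauto).
      have := Rmult_le_compat_r _ _ _ (Rmult_le_pos _ _ q0 W10) g1.
      have := Rmult_le_compat_r _ _ _ (Rmult_le_pos _ _ q0 W20) g2.
      rewrite /q /x1 /x2; lra.
    have R1 := R_ e1 _ (or_introl erefl) hr1; have R2 := R_ e2 _ (or_intror erefl) hr2.
    have T2 : Rpower z (Re e2) * Cmod (d2 t * W2 t + r2 t)%C <= 2 * q * (x1 + x2).
      have := Rmult_le_compat_l _ _ _ p2 (Cmod_triangle (d2 t * W2 t) (r2 t)).
      have := Rmult_le_pos _ _ q0 x10; lra.
    have T1 : Rpower z (Re e1) * Cmod (d1 t * W1 t + r1 t - RtoC (nu * ln z) * (d2 t * W2 t + r2 t))%C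
        <= 2 * q * (x1 + x2) * (1 + lg).
      have h := Cmod_minus_le (d1 t * W1 t + r1 t) (RtoC (nu * ln z) * (d2 t * W2 t + r2 t)).
      rewrite Cmod_mult nuL -/z -/lg in h.
      have h1 := Rmult_le_compat_l _ _ _ p1 (Cmod_triangle (d1 t * W1 t) (r1 t)).
      have h2 := Rmult_le_compat_l _ _ _ p1 h.
      have h3 := Rmult_le_compat_r _ _ _ (Rmult_le_pos _ _ lg0 (Cmod_ge_0 (d2 t * W2 t + r2 t)%C)) Hnz.
      have h4 := Rmult_le_compat_l _ _ _ lg0 T2.
      have := Rmult_le_pos _ _ q0 x20; lra.
    have X12 : x1 + x2 <= (1 + lg) * (Cmod (y1 t) + Cmod (y2 t)).
      have := Rmult_le_pos _ _ lg0 (Cmod_ge_0 (y1 t)); lra.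
    have lg2 : (1 + lg) ^ 2 <= Kl ^ 2 * Rpower z (- (2 * eta)).
      have h := HKl z (conj z0 z1); rewrite pow_1 -/lg in h.
      have -> : Rpower z (- (2 * eta)) = Rpower z (- eta) ^ 2.
        by rewrite /= Rmult_1_r -Rpower_plus; congr Rpower; ring.
      rewrite -Rpow_mult_distr; apply: pow_incr; lra.
    have Y0 : 0 <= Cmod (y1 t) + Cmod (y2 t) by have := Cmod_ge_0 (y1 t); have := Cmod_ge_0 (y2 t); lra.
    have final : 2 * q * (x1 + x2) * (1 + lg) <= K * Rpower z (eta - 1) * (Cmod (y1 t) + Cmod (y2 t)).
      have a1 := Rmult_le_compat_l (2 * q * (1 + lg)) _ _ ltac:(apply: Rmult_le_pos; lra) X12.
      have a2 := Rmult_le_compat_l (2 * q * (Cmod (y1 t) + Cmod (y2 t))) _ _ ltac:(apply: Rmult_le_pos; lra) lg2.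
      have E : Rpower z (eta - 1) = Rpower z (3 * eta - 1) * Rpower z (- (2 * eta)).
        by rewrite -Rpower_plus; congr Rpower; ring.
      rewrite E /K; rewrite /q in a1 a2 *; lra.
    have final2 : 2 * q * (x1 + x2) <= K * Rpower z (eta - 1) * (Cmod (y1 t) + Cmod (y2 t)).
      apply: Rle_trans final; rewrite -[X in X <= _]Rmult_1_r; apply: Rmult_le_compat_l; last lra.
      by apply: Rmult_le_pos; lra.
    have k1 := Rmult_le_compat_l _ _ _ (Rlt_le _ _ J0) (Rle_trans _ _ _ T1 final).
    have k2 := Rmult_le_compat_l _ _ _ (Rlt_le _ _ J0) (Rle_trans _ _ _ T2 final2).
    split; lra.
  have [L1 [L2 [HL1 [HL2 HL]]]] := integrable_system_limits K eta J t1 y1 y2 dy1 dy2 K0 eta0 J0 t10 Jt1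
     (fun t Ht => conj (proj1 (Hder t Ht)) (conj (proj2 (Hder t Ht)) (Hb t Ht))).
  have nj1 : RtoC j1 <> RtoC 0 by move=> /RtoC_inj; lra.
  have nj2 : RtoC j2 <> RtoC 0 by move=> /RtoC_inj; lra.
  exists (/ RtoC j1 * L1)%C, (/ RtoC j2 * L2)%C; split; last split.
  - have := tends_at_0_lin _ _ _ _ (/ RtoC j1) 0 HL1 HL1; rewrite Cmult_0_l Cplus_0_r.
    by apply: (tends_at_0_ext _ _ _ 1); [lra|move=> t Ht; rewrite /y1; field].
  - have := tends_at_0_lin _ _ _ _ (/ RtoC j2) 0 HL2 HL2; rewrite Cmult_0_l Cplus_0_r.
    by apply: (tends_at_0_ext _ _ _ 1); [lra|move=> t Ht; rewrite /y2; field].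
  move=> t Ht zt S.
  have [E2 [X1 [X2 _]]] := comp t Ht.
  have ES : S = Cmod L1 + Cmod L2.
    rewrite /S !Cmod_mult !Cmod_inv ?Cmod_R //.
    rewrite !Rabs_pos_eq; [|lra|lra]; rewrite -/j1 -/j2; field; lra.
  have [b1 b2] := HL t Ht; rewrite -/Ex in b1 b2.
  have sq (a b a' b' : R) : 0 <= a -> 0 <= b -> 0 <= a' -> 0 <= b' ->
     a ^ 2 + b ^ 2 <= Ex * (a' ^ 2 + b' ^ 2) -> a + b <= 2 * Ex * (a' + b').
    move=> a0 b0 a0' b0' h; apply: sqr_le_linear; try lra.
    have := pow2_ge_0 (a - b).
    have h2 : a' ^ 2 + b' ^ 2 <= (a' + b') ^ 2 by have := Rmult_le_pos _ _ a0' b0'; lra.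
    have := Rmult_le_compat_l _ _ _ (Rle_trans _ _ _ Rle_0_1 Ex1) h2; lra.
  have c1 := sq _ _ _ _ (Cmod_ge_0 _) (Cmod_ge_0 _) (Cmod_ge_0 _) (Cmod_ge_0 _) b1.
  have c2 := sq _ _ _ _ (Cmod_ge_0 _) (Cmod_ge_0 _) (Cmod_ge_0 _) (Cmod_ge_0 _) b2.
  have [z0 z1] := Jt t Ht.
  have lgz : Rabs (ln (J * t)) <= lam.
    have l1 : ln (J * t) <= 0 by rewrite -ln_1; apply: ln_le.
    have l2 : ln zm <= ln (J * t) by apply: ln_le.
    rewrite /lam !Rabs_left1; lra.
  have pw (e : R) : Rabs e <= Rabs (Re e1) + Rabs (Re e2) -> Rpower (J * t) e <= c.
    move=> he; rewrite /c /Rpower; apply: exp_le_compat.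
    have l1 : ln (J * t) <= 0 by rewrite -ln_1; apply: ln_le.
    have l2 : ln zm <= ln (J * t) by apply: ln_le.
    have e1_ := Rle_abs (- e); rewrite Rabs_Ropp in e1_.
    have p := Rabs_pos e.
    have q1 : e * ln (J * t) <= Rabs e * (- ln (J * t)).
      have := Rmult_le_compat_l (- ln (J * t)) _ _ ltac:(lra) e1_; lra.
    have q2 : Rabs e * (- ln (J * t)) <= Rabs e * (- ln zm) by apply: Rmult_le_compat_l; lra.
    have q3 : Rabs e * (- ln zm) <= (Rabs (Re e1) + Rabs (Re e2)) * (- ln zm) by apply: Rmult_le_compat_r; lra.
    lra.
  have a1 := Rabs_pos (Re e1); have a2 := Rabs_pos (Re e2).
  have P1 := pw (Re e1) ltac:(lra); have P2 := pw (Re e2) ltac:(lra).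
  have P3 := pw (- Re e1) ltac:(rewrite Rabs_Ropp; lra); have P4 := pw (- Re e2) ltac:(rewrite Rabs_Ropp; lra).
  have W10 := Cmod_ge_0 (W1 t); have W20 := Cmod_ge_0 (W2 t).
  have Y1 := Cmod_ge_0 (y1 t); have Y2 := Cmod_ge_0 (y2 t).
  have lg0 := Rabs_pos (ln (J * t)).
  have V1 : Cmod (y1 t) + Cmod (y2 t) <= c * (1 + lam) * (Cmod (W1 t) + Cmod (W2 t)).
    have k1 := Rmult_le_compat_r _ _ _ W10 P1; have k2 := Rmult_le_compat_r _ _ _ W20 P2.
    have k3 : Rabs (ln (J * t)) * (Rpower (J * t) (Re e2) * Cmod (W2 t)) <= lam * (c * Cmod (W2 t)).
      apply: Rmult_le_compat => //; apply: Rmult_le_pos => //; exact/Rlt_le/Rpower_pos.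
    have := Rmult_le_pos _ _ lam0 (Rmult_le_pos _ _ (Rlt_le _ _ c0) W10).
    rewrite -E2; lra.
  have V2 : Cmod (W1 t) + Cmod (W2 t) <= c * (1 + lam) * (Cmod (y1 t) + Cmod (y2 t)).
    have inv (e x : R) : x = Rpower (J * t) (- e) * (Rpower (J * t) e * x).
      by rewrite -Rmult_assoc -Rpower_plus Rplus_opp_l Rpower_O // Rmult_1_l.
    have k1 : Cmod (W1 t) <= c * (Cmod (y1 t) + lam * Cmod (y2 t)).
      rewrite (inv (Re e1) (Cmod (W1 t))); apply: Rmult_le_compat => //; first exact/Rlt_le/Rpower_pos.
        by apply: Rmult_le_pos => //; exact/Rlt_le/Rpower_pos.
      have := Rmult_le_compat_r _ _ _ Y2 lgz; lra.
    have k2 : Cmod (W2 t) <= c * Cmod (y2 t).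
      rewrite (inv (Re e2) (Cmod (W2 t))) E2; apply: Rmult_le_compat_r => //.
    have := Rmult_le_pos _ _ lam0 (Rmult_le_pos _ _ (Rlt_le _ _ c0) Y1); lra.
  have Ex0 : 0 <= 2 * Ex by lra.
  have cl0 : 0 <= c * (1 + lam) by apply: Rmult_le_pos; lra.
  rewrite ES; split.
  - have := Rmult_le_compat_l _ _ _ Ex0 V1; lra.
  - have := Rmult_le_compat_l _ _ _ cl0 c2; lra.
Qed.

(** * Algebra of the diagonalization *)

Lemma entry_Mplus {k : nat} (A B : @matrix C 2 k) i j : (i < 2)%nat -> (j < k)%nat ->
  entry (Mplus A B) i j = (entry A i j + entry B i j)%C.
Proof. by move=> Hi Hj; rewrite /entry /Mplus coeff_mat_bij. Qed.

Lemma entry_Mscal {k : nat} c (A : @matrix C 2 k) i j : (i < 2)%nat -> (j < k)%nat ->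
  entry (Mscal c A) i j = (c * entry A i j)%C.
Proof. by move=> Hi Hj; rewrite {1}/entry /Mscal coeff_mat_bij. Qed.

Lemma entry_Msub {k : nat} (A B : @matrix C 2 k) i j : (i < 2)%nat -> (j < k)%nat ->
  entry (Msub A B) i j = (entry A i j - entry B i j)%C.
Proof. by move=> Hi Hj; rewrite /Msub entry_Mplus // /Mopp {2}/entry coeff_mat_bij. Qed.

Lemma entry_Mmult {k : nat} (A : mat2) (B : @matrix C 2 k) i j : (i < 2)%nat -> (j < k)%nat ->
  entry (Mmult A B) i j = (entry A i 0 * entry B 0 j + entry A i 1 * entry B 1 j)%C.
Proof.
  by move=> Hi Hj; rewrite {1}/entry /Mmult coeff_mat_bij // /= sum_Sn sum_O.
Qed.

Lemma entry_Mone i j : (i < 2)%nat -> (j < 2)%nat ->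
  entry (Mone (n := 2) : mat2) i j = if Nat.eqb i j then RtoC 1 else RtoC 0.
Proof.
  by move=> Hi Hj; case: i Hi => [|[|i]] Hi; case: j Hj => [|[|j]] Hj //; lia.
Qed.

Lemma Msum_0 (F : nat -> mat2) i j : (i < 2)%nat -> (j < 2)%nat -> entry (Msum 0 F) i j = RtoC 0.
Proof.
  move=> Hi Hj; rewrite /Msum sum_n_m_zero; last by lia.
  by case: i Hi => [|[|i]] Hi; case: j Hj => [|[|j]] Hj //; lia.
Qed.

Lemma Msum_S (F : nat -> mat2) m : Msum (S m) F = Mplus (Msum m F) (F (S m)).
Proof. by rewrite /Msum sum_n_Sm //; lia. Qed.

Lemma entry_Msum_Mscal m (F : nat -> mat2) c i j : (i < 2)%nat -> (j < 2)%nat ->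
  entry (Msum m (fun k => Mscal c (F k))) i j = (c * entry (Msum m F) i j)%C.
Proof.
  move=> Hi Hj; elim: m => [|m IH]; first by rewrite !Msum_0 // Cmult_0_r.
  by rewrite !Msum_S !entry_Mplus // IH entry_Mscal //; ring.
Qed.

Lemma entry_Msum_derive m (F dF : nat -> R -> mat2) t i j : (i < 2)%nat -> (j < 2)%nat ->
  (forall k, (1 <= k)%nat -> is_Cderive (fun s => entry (F k s) i j) t (entry (dF k t) i j)) ->
  is_Cderive (fun s => entry (Msum m (fun k => F k s)) i j) t (entry (Msum m (fun k => dF k t)) i j).
Proof.
  move=> Hi Hj H; elim: m => [|m IH].
    have E : (fun s => entry (Msum 0 (fun k => F k s)) i j) = (fun _ => RtoC 0).
      by apply: functional_extensionality => s; rewrite Msum_0.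
    rewrite E Msum_0 //; exact: is_Cderive_const.
  rewrite Msum_S entry_Mplus //.
  have E s : (entry (Msum m (fun k => F k s)) i j + entry (F (S m) s) i j)%C
      = entry (Msum (S m) (fun k => F k s)) i j by rewrite Msum_S entry_Mplus.
  apply: (is_Cderive_ext_loc _ _ t _ (t - 1) (t + 1) ltac:(lra) (fun s _ => E s)).
  by apply: is_Cderive_plus => //; apply: H; lia.
Qed.

(** The identity that defines the remainder, applied to [V], is the system for
    [W = Q V]; the remainder acts on [V], so that the inverse of [Q] never
    appears. *)
Lemma conjugated_system (J it e1 e2 nu d1 d2 q11 q12 q21 q22 L11 L12 L21 L22 s11 s12 s21 s22
    r11 r12 r21 r22 V1 V2 dV1 dV2 : C) :
  J <> RtoC 0 ->
  let iz := (/ J * it)%C in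
  (r11 = / J * s11 + (q11 * L11 + q12 * L21) - ((iz * - e1 + d1) * q11 + (iz * nu) * q21))%C ->
  (r12 = / J * s12 + (q11 * L12 + q12 * L22) - ((iz * - e1 + d1) * q12 + (iz * nu) * q22))%C ->
  (r21 = / J * s21 + (q21 * L11 + q22 * L21) - (iz * - e2 + d2) * q21)%C ->
  (r22 = / J * s22 + (q21 * L12 + q22 * L22) - (iz * - e2 + d2) * q22)%C ->
  (dV1 = J * (L11 * V1 + L12 * V2))%C -> (dV2 = J * (L21 * V1 + L22 * V2))%C ->
  let W1 := (q11 * V1 + q12 * V2)%C in let W2 := (q21 * V1 + q22 * V2)%C in
  (s11 * V1 + q11 * dV1 + (s12 * V2 + q12 * dV2) = it * (nu * W2 - e1 * W1) + J * (d1 * W1 + (r11 * V1 + r12 * V2)))%C /\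
  (s21 * V1 + q21 * dV1 + (s22 * V2 + q22 * dV2) = it * (- (e2 * W2)) + J * (d2 * W2 + (r21 * V1 + r22 * V2)))%C.
Proof. by move=> HJ iz -> -> -> -> -> -> W1 W2; rewrite /W1 /W2 /iz; split; field. Qed.

(** Since [/ z] equals [/ J * / t], the term [/ z * B] of the normal form cancels
    the one subtracted in the rescaled remainder [R]; what is left is the companion
    matrix conjugated by [M], acting on [V = M U]. *)
Lemma conjugated_generator (J iz it m11 m12 m21 m22 a11 a12 a21 a22 b11 b12 b21 b22 U1 U2 : C) :
  J <> RtoC 0 -> (J * iz = it)%C -> (m11 * m22 - m12 * m21)%C <> RtoC 0 ->
  let id := (/ (m11 * m22 - m12 * m21))%C in
  let n11 := (id * m22)%C in let n12 := (id * - m12)%C in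
  let n21 := (id * - m21)%C in let n22 := (id * m11)%C in
  let c11 := (m11 * a11 + m12 * a21)%C in let c12 := (m11 * a12 + m12 * a22)%C in
  let c21 := (m21 * a11 + m22 * a21)%C in let c22 := (m21 * a12 + m22 * a22)%C in
  let L x b := (iz * b + / J * (x - it * b))%C in
  let V1 := (m11 * U1 + m12 * U2)%C in let V2 := (m21 * U1 + m22 * U2)%C in
  (c11 * U1 + c12 * U2 = J * (L (c11 * n11 + c12 * n21) b11 * V1 + L (c11 * n12 + c12 * n22) b12 * V2))%C /\
  (c21 * U1 + c22 * U2 = J * (L (c21 * n11 + c22 * n21) b21 * V1 + L (c21 * n12 + c22 * n22) b22 * V2))%C.
Proof.
  move=> HJ <- Hd id n11 n12 n21 n22 c11 c12 c21 c22 L V1 V2.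
  by rewrite /L /V1 /V2 /n11 /n12 /n21 /n22 /id; split; field.
Qed.

(** * The two brackets and the symbol classes *)

Lemma big_Rmax_ge (I : eqType) (r : seq I) (F : I -> R) (i : I) :
  i \in r -> F i <= \big[Rmax/0]_(j <- r) F j.
Proof.
  elim: r => [|x r IH] //; rewrite in_cons big_cons => /orP [/eqP ->|/IH H]; first exact: Rmax_l.
  apply: Rle_trans H _; exact: Rmax_r.
Qed.

Lemma big_Rmax_le (I : Type) (r : seq I) (F : I -> R) (B : R) :
  0 <= B -> (forall i, F i <= B) -> \big[Rmax/0]_(j <- r) F j <= B.
Proof.
  move=> B0 H; elim: r => [|x r IH]; first by rewrite big_nil.
  by rewrite big_cons; apply: Rmax_lub.
Qed.

Lemma big_Rplus_ge0 (I : Type) (r : seq I) (F : I -> R) :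
  (forall i, 0 <= F i) -> 0 <= \big[Rplus/0]_(j <- r) F j.
Proof.
  move=> H; elim: r => [|x r IH]; first by rewrite big_nil; exact: Rle_refl.
  by rewrite big_cons; exact: Rplus_le_le_0_compat.
Qed.

Lemma big_Rplus_ge (I : eqType) (r : seq I) (F : I -> R) (i : I) :
  (forall i, 0 <= F i) -> i \in r -> F i <= \big[Rplus/0]_(j <- r) F j.
Proof.
  move=> H; elim: r => [|x r IH] //; rewrite in_cons big_cons => /orP [/eqP ->|/IH h].
    by have := big_Rplus_ge0 _ r F H; lra.
  by have := H x; lra.
Qed.

Lemma big_Rplus_le (I : Type) (r : seq I) (F : I -> R) (B : R) :
  (forall i, F i <= B) -> \big[Rplus/0]_(j <- r) F j <= INR (size r) * B.
Proof.
  move=> H; elim: r => [|x r IH]; first by rewrite big_nil /=; lra.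
  rewrite big_cons [size _]/= S_INR; have := H x; lra.
Qed.

Lemma big_Rplus_scal (I : Type) (r : seq I) (F : I -> R) (c : R) :
  \big[Rplus/0]_(j <- r) (c * F j) = c * \big[Rplus/0]_(j <- r) F j.
Proof.
  elim: r => [|x r IH]; first by rewrite !big_nil Rmult_0_r.
  by rewrite !big_cons IH Rmult_plus_distr_l.
Qed.

Lemma vnorm_sqr {d : nat} (xi : vec d) : vnorm xi ^ 2 = \big[Rplus/0]_(i < d) (xi i) ^ 2.
Proof.
  rewrite /vnorm /= Rmult_1_r sqrt_sqrt //; apply: big_Rplus_ge0 => i.
  by have := pow2_ge_0 (xi i).
Qed.

Lemma vnorm_ge0 {d : nat} (xi : vec d) : 0 <= vnorm xi.
Proof. exact: sqrt_pos. Qed.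

Lemma coord_le_vnorm {d : nat} (xi : vec d) i : Rabs (xi i) <= vnorm xi.
Proof.
  apply: (Rsqr_incr_0_var _ _ _ (vnorm_ge0 xi)); rewrite -Rsqr_abs !Rsqr_pow2 vnorm_sqr.
  by apply: (big_Rplus_ge _ _ (fun i => xi i ^ 2)) => [j|]; [exact: pow2_ge_0|exact: mem_index_enum].
Qed.

Lemma bracket_sqr (x : R) : bracket x ^ 2 = 1 + x ^ 2.
Proof. by rewrite /bracket pow2_sqrt //; have := pow2_ge_0 x; lra. Qed.

Lemma bracket_ge1 (x : R) : 1 <= bracket x.
Proof. by rewrite -sqrt_1; apply: sqrt_le_1_alt; have := pow2_ge_0 x; lra. Qed.

Lemma bracket_mono (x y : R) : Rabs x <= y -> bracket x <= bracket y.
Proof.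
  move=> h; apply: sqrt_le_1_alt; rewrite -(pow2_abs x).
  by have := pow_incr _ _ 2 (conj (Rabs_pos x) h); lra.
Qed.

Lemma Rpower_ge1 (x y : R) : 1 <= x -> 0 <= y -> 1 <= Rpower x y.
Proof.
  move=> hx hy; rewrite /Rpower -exp_0; apply: exp_le_compat.
  apply: Rmult_le_pos => //; rewrite -ln_1; apply: ln_le; lra.
Qed.

(** Powers of the variable [dbracket] of the zone are converted into the powers
    of the bracket of the norm in which the theorem is stated. *)
Lemma dbracket_comparison (d : nat) : (1 <= d)%nat ->
  exists k, 1 <= k /\ forall (E : wave_data d) (xi : vec d), -1 < wl E ->
    1 <= dbracket E xi /\ Rpower (dbracket E xi) (wl E + 1) <= bracket (vnorm xi) /\
    bracket (vnorm xi) <= k * Rpower (dbracket E xi) (wl E + 1).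
Proof.
  move=> hd; pose n := INR (size (index_enum 'I_d)).
  have n0 : 0 <= n by exact: pos_INR.
  exists (1 + n); split; first lra.
  move=> E xi hl; set l := wl E in hl *.
  have il : 0 < / (l + 1) by apply: Rinv_0_lt_compat; lra.
  have Hi i : Rpower (bracket (xi i)) (/ (l + 1)) <= dbracket E xi.
    by apply: (big_Rmax_ge _ _ (fun i => Rpower (bracket (xi i)) (/ (l + 1)))); exact: mem_index_enum.
  have [i0] : exists i : 'I_d, True.
    case: d hd E xi l hl il Hi n n0 => [|d] hd *; first lia.
    by exists ord0.
  move=> _.
  have J1 : 1 <= dbracket E xi.
    apply: Rle_trans (Hi i0); apply: Rpower_ge1; [exact: bracket_ge1|lra].
  have b1 := bracket_ge1 (vnorm xi).
  have back (x : R) : 0 < x -> Rpower (Rpower x (/ (l + 1))) (l + 1) = x.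
    by move=> x0; rewrite Rpower_mult Rinv_l ?Rpower_1 //; lra.
  split => //; split.
  - rewrite -[X in _ <= X]back; last lra.
    apply: Rle_Rpower_l; first lra.
    split; first lra.
    apply: big_Rmax_le; first exact/Rlt_le/Rpower_pos.
    move=> i; apply: Rle_Rpower_l; first exact: Rlt_le.
    split; first by have := bracket_ge1 (xi i); lra.
    by apply: bracket_mono; exact: coord_le_vnorm.
  - set P := Rpower (dbracket E xi) (l + 1).
    have P1 : 1 <= P by apply: Rpower_ge1; lra.
    have Hb i : xi i ^ 2 <= P ^ 2.
      have hb : bracket (xi i) <= P.
        rewrite -[X in X <= _]back; last by have := bracket_ge1 (xi i); lra.
        apply: Rle_Rpower_l; first lra.
        by split; [exact: Rpower_pos|exact: Hi].
      have := bracket_sqr (xi i); have := bracket_ge1 (xi i) => h1 h2.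
      have := pow_incr _ _ 2 (conj (Rle_trans _ _ _ Rle_0_1 h1) hb); lra.
    have hs : vnorm xi ^ 2 <= n * P ^ 2 by rewrite vnorm_sqr; exact: big_Rplus_le.
    apply: Rsqr_incr_0_var; last by apply: Rmult_le_pos; lra.
    rewrite !Rsqr_pow2 bracket_sqr Rpow_mult_distr.
    have : 1 <= P ^ 2 by apply: pow_R1_Rle.
    have : 0 <= (n + n ^ 2) * P ^ 2.
      by apply: Rmult_le_pos; [have := pow2_ge_0 n; lra|exact: pow2_ge_0].
    lra.
Qed.

Lemma zvar_bounds {d : nat} (E : wave_data d) rho t xi : 0 < dbracket E xi -> rho <= 1 ->
  ZP E rho t xi -> 0 < zvar E t xi <= 1.
Proof.
  move=> J0 r1 [[t0 tT] hz]; split; last lra.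
  exact: Rmult_lt_0_compat.
Qed.

Lemma Sclass_bound {d : nat} (E : wave_data d) (rho q eta : R) (F : R -> vec d -> mat2) :
  (forall xi, 0 < dbracket E xi) -> rho <= 1 -> 0 < eta -> in_Sclass E rho q F ->
  exists K, 0 <= K /\ forall t xi, ZP E rho t xi -> forall i j, (i < 2)%nat -> (j < 2)%nat ->
    Cmod (entry (F t xi) i j) <= K * Rpower (zvar E t xi) (q - eta).
Proof.
  move=> J0 r1 eta0 [p H].
  have [Kl [Kl1 HKl]] := log_power_absorb eta p eta0.
  have one i j : (i < 2)%nat -> (j < 2)%nat -> exists K, 0 <= K /\ forall t xi, ZP E rho t xi ->
      Cmod (entry (F t xi) i j) <= K * Rpower (zvar E t xi) (q - eta).
    move=> Hi Hj; have [_ [_ [G [HG HB]]]] := H i j Hi Hj.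
    have [K HK] := HB 0%nat.
    exists (Rabs K * Kl); split; first by apply: Rmult_le_pos; [exact: Rabs_pos|lra].
    move=> t xi Hz; have [G0 _] := HG xi; rewrite -(G0 t Hz).
    have [z0 z1] := zvar_bounds E rho t xi (J0 xi) r1 Hz.
    apply: Rle_trans (HK t xi Hz) _.
    have h := HKl _ (conj z0 z1).
    have -> : q - eta = q + - eta by ring.
    rewrite Rpower_plus.
    have rp := Rpower_pos (zvar E t xi) q.
    have a1 : K * Rpower (zvar E t xi) q <= Rabs K * Rpower (zvar E t xi) q.
      by apply: Rmult_le_compat_r; [lra|exact: Rle_abs].
    have a2 : 0 <= Rabs K * Rpower (zvar E t xi) q by apply: Rmult_le_pos; [exact: Rabs_pos|lra].
    have a3 : 0 <= (1 + Rabs (ln (zvar E t xi))) ^ p.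
      by apply: pow_le; have := Rabs_pos (ln (zvar E t xi)); lra.
    have := Rmult_le_compat_r _ _ _ a3 a1; have := Rmult_le_compat_l _ _ _ a2 h; lra.
  have [K1 [p1 H1]] := one 0%nat 0%nat ltac:(lia) ltac:(lia).
  have [K2 [p2 H2]] := one 0%nat 1%nat ltac:(lia) ltac:(lia).
  have [K3 [p3 H3]] := one 1%nat 0%nat ltac:(lia) ltac:(lia).
  have [K4 [p4 H4]] := one 1%nat 1%nat ltac:(lia) ltac:(lia).
  exists (K1 + K2 + K3 + K4); split; first lra.
  move=> t xi Hz i j Hi Hj.
  have rp := Rlt_le _ _ (Rpower_pos (zvar E t xi) (q - eta)).
  have q1 := Rmult_le_pos _ _ p1 rp; have q2 := Rmult_le_pos _ _ p2 rp.
  have q3 := Rmult_le_pos _ _ p3 rp; have q4 := Rmult_le_pos _ _ p4 rp.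
  case: i Hi => [|[|i]] Hi; last lia; case: j Hj => [|[|j]] Hj; try lia;
   [have := H1 t xi Hz|have := H2 t xi Hz|have := H3 t xi Hz|have := H4 t xi Hz]; lra.
Qed.

Lemma Sclass_Msum_bound {d : nat} (E : wave_data d) (rho s c eta : R) (F : nat -> R -> vec d -> mat2) (m : nat) :
  (forall xi, 0 < dbracket E xi) -> rho <= 1 -> 0 < eta -> 0 <= s ->
  (forall k, (1 <= k)%nat -> in_Sclass E rho (INR k * s + c) (F k)) ->
  exists K, 0 <= K /\ forall t xi, ZP E rho t xi -> forall i j, (i < 2)%nat -> (j < 2)%nat ->
    Cmod (entry (Msum m (fun k => F k t xi)) i j) <= K * Rpower (zvar E t xi) (s + c - eta).
Proof.
  move=> J0 r1 eta0 s0 H; elim: m => [|m [K [K0 HK]]].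
    exists 0; split; first lra.
    by move=> t xi Hz i j Hi Hj; rewrite Msum_0 // Cmod_0; lra.
  have [K' [K0' HK']] := Sclass_bound E rho _ eta _ J0 r1 eta0 (H (S m) ltac:(lia)).
  exists (K + K'); split; first lra.
  move=> t xi Hz i j Hi Hj; rewrite Msum_S entry_Mplus //.
  apply: Rle_trans (Cmod_triangle _ _) _.
  have h1 := HK t xi Hz i j Hi Hj; have h2 := HK' t xi Hz i j Hi Hj.
  have h3 : Rpower (zvar E t xi) (INR (S m) * s + c - eta) <= Rpower (zvar E t xi) (s + c - eta).
    apply: Rpower_le_1_antitone; first exact: zvar_bounds Hz.
    rewrite S_INR; have := Rmult_le_pos _ _ (pos_INR m) s0; lra.
  have := Rmult_le_compat_l _ _ _ K0' h3; lra.
Qed.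

(** * The diagonalized system of the wave equation *)

Definition exponent_plus {d} (E : wave_data d) (gamma : C) : C := ((wg E 0%R + 1 + gamma) / 2)%C.
Definition exponent_minus {d} (E : wave_data d) (gamma : C) : C := ((wg E 0%R + 1 - gamma) / 2)%C.
(** The nilpotent entry of [BP]; it is also the coefficient of [ln z] in the
    definition of the asymptotic data. *)
Definition log_weight (gamma : C) : R := if Ceq_dec gamma 0 then 1 else 0.

Lemma C2_neq0 : RtoC 2 <> RtoC 0.
Proof. by move=> /RtoC_inj; lra. Qed.

Lemma entry_mk2 (a b c e : C) : (entry (mk2 a b c e) 0 0 = a) * (entry (mk2 a b c e) 0 1 = b) *
  (entry (mk2 a b c e) 1 0 = c) * (entry (mk2 a b c e) 1 1 = e).
Proof. by []. Qed.

Lemma entry_col2 (a b : C) : (entry (col2 a b) 0 0 = a) * (entry (col2 a b) 1 0 = b).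
Proof. by []. Qed.

Lemma BP_entries {d} (E : wave_data d) (gamma : C) :
  entry (BP E gamma) 0 0 = (- exponent_plus E gamma)%C /\
  entry (BP E gamma) 0 1 = RtoC (log_weight gamma) /\
  entry (BP E gamma) 1 0 = RtoC 0 /\
  entry (BP E gamma) 1 1 = (- exponent_minus E gamma)%C.
Proof.
  rewrite /BP /log_weight /exponent_plus /exponent_minus; case: (Ceq_dec gamma 0) => H /=.
  - rewrite H !entry_mk2; split; first by rewrite /Cdiv; ring.
    do 2 split => //; rewrite /Cdiv; ring.
  - do 3 split => //.
Qed.

Lemma MP_det {d} (E : wave_data d) (gamma : C) :
  let m i j := entry (MP E gamma) i j in (m 0%nat 0%nat * m 1%nat 1%nat - m 0%nat 1%nat * m 1%nat 0%nat)%C <> RtoC 0.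
Proof.
  rewrite /MP /=; case: (Ceq_dec gamma 0) => H /=; rewrite !entry_mk2.
  - set x := ((_ - _)%C); have -> : x = RtoC 1 by rewrite /x; field; exact: C2_neq0.
    by move=> /RtoC_inj; lra.
  - set x := ((_ - _)%C); have -> : x = (- gamma)%C by rewrite /x; field; exact: C2_neq0.
    move=> h; apply: H; have -> : gamma = (- - gamma)%C by ring.
    rewrite h; ring.
Qed.

(** One formula for both cases [gamma = 0] and [gamma <> 0]: from here on the
    cases differ only through [log_weight]. *)
Lemma varphi_entries {d} (E : wave_data d) (gamma : C) (N : nat -> R -> vec d -> mat2) (mP : nat)
    (phi dphi : R -> vec d -> C) (t : R) (xi : vec d) : 0 < t ->
  let m i j := entry (MP E gamma) i j in
  let q i j := entry (QP N mP t xi) i j in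
  let U1 := (phi t xi * RtoC (/ t))%C in let U2 := dphi t xi in
  let V1 := (m 0%nat 0%nat * U1 + m 0%nat 1%nat * U2)%C in
  let V2 := (m 1%nat 0%nat * U1 + m 1%nat 1%nat * U2)%C in
  varphi_plus E gamma N mP phi dphi t xi =
    (RpowerC t (exponent_plus E gamma) * (q 0%nat 0%nat * V1 + q 0%nat 1%nat * V2))%C /\
  varphi_minus E gamma N mP phi dphi t xi =
    (RpowerC t (exponent_minus E gamma) * (q 1%nat 0%nat * V1 + q 1%nat 1%nat * V2))%C.
Proof.
  move=> Ht m q U1 U2 V1 V2.
  have nt : RtoC t <> RtoC 0 by move=> /RtoC_inj; lra.
  have n2 := C2_neq0.
  have iE : RtoC (/ t) = (/ RtoC t)%C by rewrite RtoC_inv //; lra.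
  rewrite /varphi_plus /varphi_minus /varphi /V1 /V2 /U1 /U2 /m /MP /exponent_plus /exponent_minus iE.
  case: (Ceq_dec gamma 0) => H /=.
  - rewrite H !entry_Mscal ?entry_Mmult; try lia.
    have E1 : ((wg E 0%R + 1 + 0) / 2 = (wg E 0%R + 1) / 2)%C by congr Cdiv; ring.
    have E2 : ((wg E 0%R + 1 - 0) / 2 = (wg E 0%R + 1) / 2)%C by congr Cdiv; ring.
    rewrite E1 E2 -/(q 0%nat 0%nat) -/(q 0%nat 1%nat) -/(q 1%nat 0%nat) -/(q 1%nat 1%nat).
    rewrite !entry_mk2 !entry_col2.
    by split; field.
  - rewrite !entry_Mmult; try lia.
    rewrite -/(q 0%nat 0%nat) -/(q 0%nat 1%nat) -/(q 1%nat 0%nat) -/(q 1%nat 1%nat).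
    rewrite !entry_mk2 !entry_col2.
    by split; field.
Qed.

Definition wave_damping {d} (E : wave_data d) (xi : vec d) (t : R) : C :=
  damping (wl E) (vnorm xi) t (frb E t (dir xi)) (wg E t).

Definition wave_stiffness {d} (E : wave_data d) (xi : vec d) (t : R) : C :=
  stiffness (wl E) (vnorm xi) t (fra E t (dir xi)) (frc E t (dir xi)) (wh E t).

(** [calA] is the companion matrix of (W) for the unknowns [u / t] and [v]. *)
Lemma calA_system {d} (E : wave_data d) (xi : vec d) (t : R) (u v : C) : 0 < t ->
  let U1 := (u * RtoC (/ t))%C in
  let a i j := entry (calA E t xi) i j in
  (v * RtoC (/ t) + u * RtoC (- / t ^ 2) = a 0%nat 0%nat * U1 + a 0%nat 1%nat * v)%C /\
  (- (wave_stiffness E xi t * u) - wave_damping E xi t * v = a 1%nat 0%nat * U1 + a 1%nat 1%nat * v)%C.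
Proof.
  move=> Ht U1 a.
  have nt : RtoC t <> RtoC 0 by move=> /RtoC_inj; lra.
  have tn : t <> 0 by lra.
  have e1 : Rpower t (2 * wl E + 1) = Rpower t (2 * wl E) * t by rewrite Rpower_plus Rpower_1.
  have e2 := Rpower_minus_1 t (wl E) Ht.
  rewrite /a /U1 /wave_stiffness /wave_damping /stiffness /damping /calA !entry_mk2 -RtoC_inv // e1 e2.
  have -> : / t ^ 2 = / t * / t by field.
  rewrite /Rdiv; have : t * / t = 1 by field.
  move: (/ t) => s Hs.
  have Hs' : (RtoC t * RtoC s = 1)%C by rewrite -RtoC_mult Hs.
  split; rewrite !(RtoC_mult, RtoC_opp).
    ring.
  apply: Cminus_0_eq.
  transitivity ((RtoC t * RtoC s - 1) * (RtoC (Rpower t (2 * wl E)) * (RtoC (vnorm xi) * RtoC (vnorm xi)) *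
    RtoC (fra E t (dir xi)) * u))%C; first by ring.
  rewrite Hs'; ring.
Qed.

Lemma Minv_entries (A : mat2) :
  let id := (/ (entry A 0 0 * entry A 1 1 - entry A 0 1 * entry A 1 0))%C in
  entry (Minv A) 0 0 = (id * entry A 1 1)%C /\ entry (Minv A) 0 1 = (id * - entry A 0 1)%C /\
  entry (Minv A) 1 0 = (id * - entry A 1 0)%C /\ entry (Minv A) 1 1 = (id * entry A 0 0)%C.
Proof. by move=> id; rewrite /Minv !entry_Mscal ?entry_mk2; try lia. Qed.

Lemma Msum_diagonal m (F : nat -> mat2) : (forall k, (1 <= k)%nat -> Mdiagonal (F k)) ->
  entry (Msum m F) 0 1 = RtoC 0 /\ entry (Msum m F) 1 0 = RtoC 0.
Proof.
  move=> H; elim: m => [|m [I1 I2]]; first by rewrite !Msum_0; try lia.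
  have [h1 h2] := H (S m) ltac:(lia).
  by rewrite Msum_S !entry_Mplus ?I1 ?I2 ?h1 ?h2 ?Cplus_0_l; try lia.
Qed.

Lemma linear_pair_bound (a b c e x y : C) :
  Cmod (a * x + b * y)%C + Cmod (c * x + e * y)%C <=
    (Cmod a + Cmod b + Cmod c + Cmod e) * (Cmod x + Cmod y).
Proof.
  have h1 := Cmod_triangle (a * x) (b * y); have h2 := Cmod_triangle (c * x) (e * y).
  rewrite !Cmod_mult in h1 h2.
  have pa := Cmod_ge_0 a; have pb := Cmod_ge_0 b; have pc := Cmod_ge_0 c; have pe := Cmod_ge_0 e.
  have px := Cmod_ge_0 x; have py := Cmod_ge_0 y.
  have := Rmult_le_pos _ _ pa py; have := Rmult_le_pos _ _ pb px.
  have := Rmult_le_pos _ _ pc py; have := Rmult_le_pos _ _ pe px; lra.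
Qed.

(** Replaces a Neumann series for the inverse of [Q]. *)
Lemma near_identity_pair (n11 n12 n21 n22 x y : C) (e : R) :
  0 <= e <= / 8 -> Cmod n11 <= e -> Cmod n12 <= e -> Cmod n21 <= e -> Cmod n22 <= e ->
  let w1 := ((1 + n11) * x + n12 * y)%C in let w2 := (n21 * x + (1 + n22) * y)%C in
  Cmod w1 + Cmod w2 <= 2 * (Cmod x + Cmod y) /\ Cmod x + Cmod y <= 2 * (Cmod w1 + Cmod w2).
Proof.
  move=> he h11 h12 h21 h22 w1 w2.
  have B := linear_pair_bound n11 n12 n21 n22 x y.
  have px := Cmod_ge_0 x; have py := Cmod_ge_0 y.
  have B2 : Cmod (n11 * x + n12 * y)%C + Cmod (n21 * x + n22 * y)%C <= / 2 * (Cmod x + Cmod y).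
    by apply: Rle_trans B _; apply: Rmult_le_compat_r; lra.
  have a1 : Cmod w1 <= Cmod x + Cmod (n11 * x + n12 * y)%C.
    have -> : w1 = (x + (n11 * x + n12 * y))%C by rewrite /w1; ring.
    exact: Cmod_triangle.
  have a2 : Cmod w2 <= Cmod y + Cmod (n21 * x + n22 * y)%C.
    have -> : w2 = (y + (n21 * x + n22 * y))%C by rewrite /w2; ring.
    exact: Cmod_triangle.
  have a3 : Cmod x <= Cmod w1 + Cmod (n11 * x + n12 * y)%C.
    have -> : x = (w1 - (n11 * x + n12 * y))%C by rewrite /w1; ring.
    have -> : (n11 * (w1 - (n11 * x + n12 * y)) + n12 * y = n11 * x + n12 * y)%C by rewrite /w1; ring.
    exact: Cmod_minus_le.
  have a4 : Cmod y <= Cmod w2 + Cmod (n21 * x + n22 * y)%C.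
    have -> : y = (w2 - (n21 * x + n22 * y))%C by rewrite /w2; ring.
    have -> : (n21 * x + n22 * (w2 - (n21 * x + n22 * y)) = n21 * x + n22 * y)%C by rewrite /w2; ring.
    exact: Cmod_minus_le.
  split; lra.
Qed.

(** For [mP] with [INR mP * (aP E + 1)] at least [|Re gamma|] the remainder absorbs
    the quotient of the weights, and [fuchsian_pair_limits] applies; [rhos] is
    chosen such that [Q] is close to the identity. The comparison is made at
    the time [t0] in the middle of the zone, where [z] is bounded below and where
    all functions are differentiable on both sides. *)
Lemma zone_estimate (d : nat) (E : wave_data d) (gamma : C) (rho1 : R)
    (D N Rem : nat -> R -> vec d -> mat2) (mP : nat) :
  (1 <= d)%nat -> 0 < wT E -> -1 < wl E -> 0 < wbeta E -> 0 < rho1 < 1 ->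
  diagonalization E gamma rho1 D N Rem -> (1 <= mP)%nat ->
  Rabs (Re gamma) <= INR mP * (aP E + 1) ->
  exists rhos, 0 < rhos <= rho1 /\ forall rho0, 0 < rho0 <= rhos ->
  exists K, 0 < K /\ forall (xi : vec d) (u v : R -> C),
    is_classical_solution (wT E) (wave_damping E xi) (wave_stiffness E xi) u v ->
    let vp t := varphi_plus E gamma N mP (fun s _ => u s) (fun s _ => v s) t xi in
    let vm t := varphi_minus E gamma N mP (fun s _ => u s) (fun s _ => v s) t xi in
    exists l1 l2,
      tends_at_0 (fun t => vp t - RtoC (log_weight gamma * ln (zvar E t xi)) * vm t)%C l1 /\
      tends_at_0 vm l2 /\
      let t0 := Rmin (wT E) (rho0 / dbracket E xi) / 2 in
      let S := Rpower (dbracket E xi) (Re (exponent_plus E gamma)) * Cmod l1 +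
               Rpower (dbracket E xi) (Re (exponent_minus E gamma)) * Cmod l2 in
      let U := Cmod (u t0) / t0 + Cmod (v t0) in
      S <= K * U /\ U <= K * S.
Proof.
  move=> hd T0 hl hb [r10 r11] [Hcl [dN [HdN Hid]]] hm hmg.
  have [kd [_ HJ]] := dbracket_comparison d hd.
  have J1 xi : 1 <= dbracket E xi by have [h _] := HJ E xi hl.
  have J0 xi : 0 < dbracket E xi by have := J1 xi; lra.
  pose s := aP E + 1.
  have s0 : 0 < s by rewrite /s /aP; have := Rmin_glb_lt _ _ _ hl (_ : -1 < -1 + wbeta E); lra.
  (* A quarter of the gain [s] pays for the logarithms of the symbol classes,
     which leaves [3 * eta]; two more [eta] are used in the Fuchsian system. *)
  pose eta := s / 4.
  have eta0 : 0 < eta by rewrite /eta; lra.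
  have r1 : rho1 <= 1 by lra.
  have [CN [CN0 HN]] := Sclass_Msum_bound E rho1 s 0 eta N mP J0 r1 eta0 (Rlt_le _ _ s0)
     (fun k hk => eq_ind_r (fun q => in_Sclass E rho1 q (N k)) (proj1 (proj2 (proj2 (Hcl k hk)))) (Rplus_0_r _)).
  have [CD [CD0 HD]] := Sclass_Msum_bound E rho1 s (- (1)) eta D mP J0 r1 eta0 (Rlt_le _ _ s0)
     (fun k hk => proj1 (Hcl k hk)).
  have [CR [CR0 HR]] := Sclass_bound E rho1 _ eta _ J0 r1 eta0 (proj2 (proj2 (proj2 (Hcl mP hm)))).
  pose k8 := / (8 * (CN + 1)).
  have k80 : 0 < k8 by apply: Rinv_0_lt_compat; lra.
  exists (Rmin rho1 (Rpower k8 (/ (3 * eta)))); split.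
    split; last exact: Rmin_l.
    by apply: Rmin_glb_lt => //; exact: Rpower_pos.
  move=> rho0 [rho00 rho0s].
  have rho01 : rho0 <= rho1 by apply: Rle_trans rho0s (Rmin_l _ _).
  have smallN z : 0 < z <= rho0 -> CN * Rpower z (3 * eta) <= / 8.
    move=> [z0 z1].
    have h : Rpower z (3 * eta) <= k8.
      have -> : k8 = Rpower (Rpower k8 (/ (3 * eta))) (3 * eta).
        by rewrite Rpower_mult Rinv_l ?Rpower_1 //; lra.
      apply: Rle_Rpower_l; first lra.
      by split => //; apply: Rle_trans z1 _; apply: Rle_trans rho0s (Rmin_r _ _).
    have E8 : (CN + 1) * k8 = / 8 by rewrite /k8; field; lra.
    have := Rmult_le_compat_l (CN + 1) _ _ ltac:(lra) h; have := Rpower_pos z (3 * eta); lra.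
  pose e1 := exponent_plus E gamma. pose e2 := exponent_minus E gamma. pose nu := log_weight gamma.
  have Hnu : nu = 0 \/ nu = 1 /\ e1 = e2.
    rewrite /nu /log_weight /e1 /e2 /exponent_plus /exponent_minus.
    case: (Ceq_dec gamma 0) => H /=; [right|by left].
    by split => //; rewrite H; congr Cdiv; ring.
  have Hgap : Rabs (Re e1 - Re e2) = Rabs (Re gamma).
    have -> : Re e1 - Re e2 = Re (e1 - e2)%C by [].
    have -> : (e1 - e2 = gamma)%C by rewrite /e1 /e2 /exponent_plus /exponent_minus; field; exact: C2_neq0.
    by [].
  pose C0 := CD + 2 * CR.
  pose zm := Rmin (wT E) rho0 / 2.
  have zm0 : 0 < zm by have := Rmin_glb_lt _ _ _ T0 rho00; rewrite /zm; lra.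
  have [K1 [K10 HK1]] := fuchsian_pair_limits C0 eta zm e1 e2 nu ltac:(rewrite /C0; lra) eta0 zm0 Hnu.
  pose m i j := entry (MP E gamma) i j.
  pose n i j := entry (Minv (MP E gamma)) i j.
  pose KM := Cmod (m 0%nat 0%nat) + Cmod (m 0%nat 1%nat) + Cmod (m 1%nat 0%nat) + Cmod (m 1%nat 1%nat).
  pose KN := Cmod (n 0%nat 0%nat) + Cmod (n 0%nat 1%nat) + Cmod (n 1%nat 0%nat) + Cmod (n 1%nat 1%nat).
  have KM0 : 0 <= KM.
    have := Cmod_ge_0 (m 0%nat 0%nat); have := Cmod_ge_0 (m 0%nat 1%nat); have := Cmod_ge_0 (m 1%nat 0%nat).
    by have := Cmod_ge_0 (m 1%nat 1%nat); rewrite /KM; lra.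
  have KN0 : 0 <= KN.
    have := Cmod_ge_0 (n 0%nat 0%nat); have := Cmod_ge_0 (n 0%nat 1%nat); have := Cmod_ge_0 (n 1%nat 0%nat).
    by have := Cmod_ge_0 (n 1%nat 1%nat); rewrite /KN; lra.
  pose K := K1 * 2 * (KM + KN + 1).
  exists K; split; first by apply: Rmult_lt_0_compat; lra.
  move=> xi u v [Hd _] vp vm.
  pose J := dbracket E xi.
  have J0' : 0 < J := J0 xi. have J1' : 1 <= J := J1 xi.
  pose t1 := Rmin (wT E) (rho0 / J).
  have t10 : 0 < t1 by apply: Rmin_glb_lt => //; exact: Rdiv_lt_0_compat.
  have Jt1 : J * t1 <= rho0.
    have := Rmult_le_compat_l _ _ _ (Rlt_le _ _ J0') (Rmin_r (wT E) (rho0 / J)).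
    have -> : J * (rho0 / J) = rho0 by field; lra.
    by [].
  have inZ t : 0 < t < t1 -> ZP E rho1 t xi.
    move=> [h1 h2]; split.
      by split => //; have := Rmin_l (wT E) (rho0 / J); rewrite -/t1; lra.
    rewrite /zvar -/J; have := Rmult_le_compat_l _ _ _ (Rlt_le _ _ J0') (Rlt_le _ _ h2); lra.
  have nJ : RtoC J <> RtoC 0 by move=> /RtoC_inj; lra.
  pose U1 t := (u t * RtoC (/ t))%C.
  pose V1 t := (m 0%nat 0%nat * U1 t + m 0%nat 1%nat * v t)%C.
  pose V2 t := (m 1%nat 0%nat * U1 t + m 1%nat 1%nat * v t)%C.
  pose q i j t := entry (QP N mP t xi) i j.
  pose W1 t := (q 0%nat 0%nat t * V1 t + q 0%nat 1%nat t * V2 t)%C.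
  pose W2 t := (q 1%nat 0%nat t * V1 t + q 1%nat 1%nat t * V2 t)%C.
  pose r i j t := entry (Rem mP t xi) i j.
  pose d1 t := entry (Msum mP (fun k => D k t xi)) 0 0.
  pose d2 t := entry (Msum mP (fun k => D k t xi)) 1 1.
  pose R1 t := (r 0%nat 0%nat t * V1 t + r 0%nat 1%nat t * V2 t)%C.
  pose R2 t := (r 1%nat 0%nat t * V1 t + r 1%nat 1%nat t * V2 t)%C.
  pose nn i j t := entry (Msum mP (fun k => N k t xi)) i j.
  have Eq i j t : (i < 2)%nat -> (j < 2)%nat -> q i j t = ((if Nat.eqb i j then RtoC 1 else RtoC 0) + nn i j t)%C.
    by move=> Hi Hj; rewrite /q /QP entry_Mplus // entry_Mone.
  have VW t (Ht : 0 < t < t1) : Cmod (W1 t) + Cmod (W2 t) <= 2 * (Cmod (V1 t) + Cmod (V2 t)) /\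
      Cmod (V1 t) + Cmod (V2 t) <= 2 * (Cmod (W1 t) + Cmod (W2 t)).
    have hz : 0 < zvar E t xi <= rho0.
      rewrite /zvar -/J; split; first by apply: Rmult_lt_0_compat; lra.
      apply: Rle_trans Jt1; apply: Rmult_le_compat_l; lra.
    have hs := smallN _ hz.
    have hn i j : (i < 2)%nat -> (j < 2)%nat -> Cmod (nn i j t) <= CN * Rpower (zvar E t xi) (3 * eta).
      move=> Hi Hj; have := HN t xi (inZ t Ht) i j Hi Hj.
      by have -> : s + 0 - eta = 3 * eta by rewrite /eta; field.
    have h0 : 0 <= CN * Rpower (zvar E t xi) (3 * eta) by apply: Rmult_le_pos => //; exact/Rlt_le/Rpower_pos.
    rewrite /W1 /W2 !Eq /=; try lia; rewrite !Cplus_0_l.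
    by apply: near_identity_pair (conj h0 hs) _ _ _ _; apply: hn; lia.
  have Hsys t (Ht : 0 < t < t1) :
    is_Cderive W1 t (RtoC (/ t) * (RtoC nu * W2 t - e1 * W1 t) + RtoC J * (d1 t * W1 t + R1 t))%C /\
    is_Cderive W2 t (RtoC (/ t) * (- (e2 * W2 t)) + RtoC J * (d2 t * W2 t + R2 t))%C.
    have t0 : 0 < t by lra.
    have tT : 0 < t < wT E by have := Rmin_l (wT E) (rho0 / J); rewrite -/t1; lra.
    have Hz := inZ t Ht.
    have [du dv] := Hd t tT.
    have dU1 : is_Cderive U1 t (v t * RtoC (/ t) + u t * RtoC (- / t ^ 2))%C.
      apply: is_Cderive_mult; first exact: du.
      apply: is_Cderive_RtoC; auto_derive; first lra.
      by field; lra.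
    have [A1 A2] := calA_system E xi t (u t) (v t) t0.
    have dq i j : (i < 2)%nat -> (j < 2)%nat ->
        is_Cderive (q i j) t (entry (Msum mP (fun k => dN k t xi)) i j).
      move=> Hi Hj.
      have h : is_Cderive (nn i j) t (entry (Msum mP (fun k => dN k t xi)) i j).
        apply: (entry_Msum_derive mP (fun k t => N k t xi) (fun k t => dN k t xi)) => // k hk.
        apply: (is_deriv_on_is_Cderive _ _ _ _ (HdN k hk xi i j Hi Hj)) => //.
        exact: (locally_open_interval t 0 t1).
      apply: (is_Cderive_ext_loc _ _ t _ 0 t1 Ht (fun s _ => esym (Eq i j s Hi Hj))).
      apply: is_Cderive_eq; first (apply: is_Cderive_plus; [exact: is_Cderive_const|exact: h]).
      by rewrite Cplus_0_l.
    pose dV1 := (m 0%nat 0%nat * (v t * RtoC (/ t) + u t * RtoC (- / t ^ 2)) + m 0%nat 1%nat * (- (wave_stiffness E xi t * u t) - wave_damping E xi t * v t))%C.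
    pose dV2 := (m 1%nat 0%nat * (v t * RtoC (/ t) + u t * RtoC (- / t ^ 2)) + m 1%nat 1%nat * (- (wave_stiffness E xi t * u t) - wave_damping E xi t * v t))%C.
    have HdV i : is_Cderive (fun t => m i 0%nat * U1 t + m i 1%nat * v t)%C t
       (m i 0%nat * (v t * RtoC (/ t) + u t * RtoC (- / t ^ 2)) + m i 1%nat * (- (wave_stiffness E xi t * u t) - wave_damping E xi t * v t))%C.
      apply: is_Cderive_eq.
        apply: is_Cderive_plus; (apply: is_Cderive_mult; first exact: is_Cderive_const); [exact: dU1|exact: dv].
      cbv beta; ring.
    have dW i : (i < 2)%nat -> is_Cderive (fun t => q i 0%nat t * V1 t + q i 1%nat t * V2 t)%C t
       (entry (Msum mP (fun k => dN k t xi)) i 0 * V1 t + q i 0%nat t * dV1 +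
        (entry (Msum mP (fun k => dN k t xi)) i 1 * V2 t + q i 1%nat t * dV2))%C.
      move=> Hi; apply: is_Cderive_plus; apply: is_Cderive_mult; try exact: HdV; apply: dq => //; lia.
    pose L i j := entry (Mplus (Mscal (RtoC (/ zvar E t xi)) (BP E gamma)) (RP E gamma t xi)) i j.
    have Eiz : RtoC (/ zvar E t xi) = (/ RtoC J * RtoC (/ t))%C.
      by rewrite /zvar -/J -RtoC_inv; [rewrite -RtoC_mult; congr RtoC; field; lra|lra].
    have EiJ : RtoC (/ J) = (/ RtoC J)%C by rewrite RtoC_inv //; lra.
    have [B1 [B2 [B3 B4]]] := BP_entries E gamma.
    have [n1 [n2 [n3 n4]]] := Minv_entries (MP E gamma).
    have Gen := conjugated_generator (RtoC J) (/ RtoC J * RtoC (/ t))%C (RtoC (/ t)) (m 0%nat 0%nat) (m 0%nat 1%nat)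
      (m 1%nat 0%nat) (m 1%nat 1%nat) (entry (calA E t xi) 0 0) (entry (calA E t xi) 0 1)
      (entry (calA E t xi) 1 0) (entry (calA E t xi) 1 1) (entry (BP E gamma) 0 0) (entry (BP E gamma) 0 1)
      (entry (BP E gamma) 1 0) (entry (BP E gamma) 1 1) (U1 t) (v t) nJ ltac:(field; exact: nJ) (MP_det E gamma).
    have ELij i j : (i < 2)%nat -> (j < 2)%nat -> L i j =
       (/ RtoC J * RtoC (/ t) * entry (BP E gamma) i j + / RtoC J *
         (((m i 0%nat * entry (calA E t xi) 0 0 + m i 1%nat * entry (calA E t xi) 1 0) * n 0%nat j +
           (m i 0%nat * entry (calA E t xi) 0 1 + m i 1%nat * entry (calA E t xi) 1 1) * n 1%nat j)
          - RtoC (/ t) * entry (BP E gamma) i j))%C.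
      move=> Hi Hj; rewrite /L entry_Mplus // entry_Mscal // Eiz /RP entry_Mscal // entry_Msub //
        entry_Mmult // !entry_Mmult; try lia.
      by rewrite entry_Mscal // -/J EiJ.
    have [V1' V2'] : dV1 = (RtoC J * (L 0%nat 0%nat * V1 t + L 0%nat 1%nat * V2 t))%C /\
                     dV2 = (RtoC J * (L 1%nat 0%nat * V1 t + L 1%nat 1%nat * V2 t))%C.
      rewrite /dV1 /dV2 A1 A2 !ELij; try lia.
      rewrite /n n1 n2 n3 n4; move: Gen => /= [g1 g2]; split.
        by rewrite /V1 /V2 -g1 -/(U1 t); ring.
      by rewrite /V1 /V2 -g2 -/(U1 t); ring.
    have [D1 D2] := Msum_diagonal mP (fun k => D k t xi) (fun k hk => proj1 (proj2 (Hcl k hk)) t xi Hz).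
    have Er i j : (i < 2)%nat -> (j < 2)%nat -> r i j t =
       (/ RtoC J * entry (Msum mP (fun k => dN k t xi)) i j + (q i 0%nat t * L 0%nat j + q i 1%nat t * L 1%nat j)
        - ((/ RtoC J * RtoC (/ t) * entry (BP E gamma) i 0 + entry (Msum mP (fun k => D k t xi)) i 0) * q 0%nat j t +
           (/ RtoC J * RtoC (/ t) * entry (BP E gamma) i 1 + entry (Msum mP (fun k => D k t xi)) i 1) * q 1%nat j t))%C.
      move=> Hi Hj; rewrite /r (Hid mP hm t xi Hz) entry_Msub // entry_Mplus // entry_Msum_Mscal // !entry_Mmult; try lia.
      rewrite (entry_Mplus _ (Msum _ _)); try lia.
      rewrite (entry_Mplus _ (Msum _ _) _ 1); try lia.
      rewrite !(entry_Mscal _ (BP E gamma)); try lia.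
      by rewrite /L /q Eiz -EiJ.
    have [C1 C2] := conjugated_system (RtoC J) (RtoC (/ t)) e1 e2 (RtoC nu) (d1 t) (d2 t)
      (q 0%nat 0%nat t) (q 0%nat 1%nat t) (q 1%nat 0%nat t) (q 1%nat 1%nat t)
      (L 0%nat 0%nat) (L 0%nat 1%nat) (L 1%nat 0%nat) (L 1%nat 1%nat)
      _ _ _ _ (r 0%nat 0%nat t) (r 0%nat 1%nat t) (r 1%nat 0%nat t) (r 1%nat 1%nat t) (V1 t) (V2 t) dV1 dV2 nJ
      ltac:(rewrite (Er 0%nat 0%nat) ?B1 ?B2 ?D1; try lia; rewrite Cplus_0_r; reflexivity)
      ltac:(rewrite (Er 0%nat 1%nat) ?B1 ?B2 ?D1; try lia; rewrite Cplus_0_r; reflexivity)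
      ltac:(rewrite (Er 1%nat 0%nat) ?B3 ?B4 ?D2; try lia; rewrite Cmult_0_r Cplus_0_r Cmult_0_l Cplus_0_l; reflexivity)
      ltac:(rewrite (Er 1%nat 1%nat) ?B3 ?B4 ?D2; try lia; rewrite Cmult_0_r Cplus_0_r Cmult_0_l Cplus_0_l; reflexivity)
      V1' V2'.
    split.
    - by apply: is_Cderive_eq (dW 0%nat ltac:(lia)) _; exact: C1.
    - by apply: is_Cderive_eq (dW 1%nat ltac:(lia)) _; exact: C2.
  have Hbd t (Ht : 0 < t < t1) :
     Cmod (d1 t) <= C0 * Rpower (J * t) (3 * eta - 1) /\
     Cmod (d2 t) <= C0 * Rpower (J * t) (3 * eta - 1) /\
     Cmod (R1 t) <= C0 * Rpower (J * t) (Rabs (Re e1 - Re e2) + 3 * eta - 1) * (Cmod (W1 t) + Cmod (W2 t)) /\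
     Cmod (R2 t) <= C0 * Rpower (J * t) (Rabs (Re e1 - Re e2) + 3 * eta - 1) * (Cmod (W1 t) + Cmod (W2 t)).
    have Hz := inZ t Ht.
    have zb := zvar_bounds E rho1 t xi J0' r1 Hz; rewrite /zvar -/J in zb.
    have rp := Rpower_pos (J * t) (3 * eta - 1).
    have dd i : (i < 2)%nat -> Cmod (entry (Msum mP (fun k => D k t xi)) i i) <= C0 * Rpower (J * t) (3 * eta - 1).
      move=> Hi; have := HD t xi Hz i i Hi Hi.
      have -> : s + - (1) - eta = 3 * eta - 1 by rewrite /eta; field.
      rewrite /zvar -/J /C0; have := Rmult_le_pos _ _ CR0 (Rlt_le _ _ rp); lra.
    have rr i : (i < 2)%nat -> Cmod (r i 0%nat t * V1 t + r i 1%nat t * V2 t)%C <=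
        C0 * Rpower (J * t) (Rabs (Re e1 - Re e2) + 3 * eta - 1) * (Cmod (W1 t) + Cmod (W2 t)).
      move=> Hi.
      have re j : (j < 2)%nat -> Cmod (r i j t) <= CR * Rpower (J * t) (Rabs (Re e1 - Re e2) + 3 * eta - 1).
        move=> Hj; apply: Rle_trans (HR t xi Hz i j Hi Hj) _; apply: Rmult_le_compat_l => //.
        apply: Rpower_le_1_antitone; first exact: zb.
        rewrite Hgap; move: hmg; rewrite -/s /eta.
        have -> : aP E = s - 1 by rewrite /s; ring.
        lra.
      have rq := Rlt_le _ _ (Rpower_pos (J * t) (Rabs (Re e1 - Re e2) + 3 * eta - 1)).
      apply: Rle_trans (Cmod_triangle _ _) _; rewrite (Cmod_mult _ (V1 t)) (Cmod_mult _ (V2 t)).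
      have h1 := Rmult_le_compat_r _ _ _ (Cmod_ge_0 (V1 t)) (re 0%nat ltac:(lia)).
      have h2 := Rmult_le_compat_r _ _ _ (Cmod_ge_0 (V2 t)) (re 1%nat ltac:(lia)).
      have [_ h3] := VW t Ht.
      have h4 := Rmult_le_compat_l _ _ _ (Rmult_le_pos _ _ CR0 rq) h3.
      have h5 : 0 <= CD * Rpower (J * t) (Rabs (Re e1 - Re e2) + 3 * eta - 1) * (Cmod (W1 t) + Cmod (W2 t)).
        apply: Rmult_le_pos; first exact: Rmult_le_pos.
        by have := Cmod_ge_0 (W1 t); have := Cmod_ge_0 (W2 t); lra.
      rewrite /C0; lra.
    split; first by apply: dd; lia.
    split; first by apply: dd; lia.
    by split; apply: rr; lia.
  have [l1 [l2 [Hl1 [Hl2 Hcmp]]]] := HK1 J t1 W1 W2 d1 d2 R1 R2 J0' t10 ltac:(lra)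
    (fun t Ht => conj (proj1 (Hsys t Ht)) (conj (proj2 (Hsys t Ht)) (Hbd t Ht))).
  exists l1, l2; split; last split.
  - apply: tends_at_0_ext Hl1; first exact: Rlt_0_1.
    move=> t [Ht _]; rewrite /vp /vm; have [-> ->] := varphi_entries E gamma N mP (fun s _ => u s) (fun s _ => v s) t xi Ht.
    rewrite -/e1 -/e2 -/(W1 t) -/(W2 t) -/nu -/(zvar E t xi).
    case: Hnu => [->|[_ ->]]; last by rewrite /zvar -/J; ring.
    rewrite !Rmult_0_l; ring.
  - apply: tends_at_0_ext Hl2; first exact: Rlt_0_1.
    by move=> t [Ht _]; rewrite /vm; have [_ ->] := varphi_entries E gamma N mP (fun s _ => u s) (fun s _ => v s) t xi Ht.
  move=> t0 S U.
  have Ht0 : 0 < t0 < t1 by rewrite /t0 -/J -/t1; lra.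
  have zt0 : zm <= J * t0.
    have -> : J * t0 = J * t1 / 2 by rewrite /t0 -/J -/t1; field.
    have : Rmin (wT E) rho0 <= J * t1; last by rewrite /zm; lra.
    rewrite /t1 /Rmin; case: (Rle_dec (wT E) (rho0 / J)) => h; case: (Rle_dec (wT E) rho0) => h' /=; try nra.
    - have -> : J * (rho0 / J) = rho0 by field; lra.
      lra.
    - have -> : J * (rho0 / J) = rho0 by field; lra.
      lra.
  have [c1 c2] := Hcmp t0 Ht0 zt0.
  have [w1 w2] := VW t0 Ht0.
  have EU : U = Cmod (U1 t0) + Cmod (v t0).
    rewrite /U1 Cmod_mult Cmod_R Rabs_pos_eq //; apply/Rlt_le/Rinv_0_lt_compat; lra.
  have vb : Cmod (V1 t0) + Cmod (V2 t0) <= KM * (Cmod (U1 t0) + Cmod (v t0)) by exact: linear_pair_bound.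
  have ub : Cmod (U1 t0) + Cmod (v t0) <= KN * (Cmod (V1 t0) + Cmod (V2 t0)).
    have dt := MP_det E gamma.
    have [n1 [n2 [n3 n4]]] := Minv_entries (MP E gamma).
    have i1 : U1 t0 = (n 0%nat 0%nat * V1 t0 + n 0%nat 1%nat * V2 t0)%C.
      rewrite /n n1 n2 /V1 /V2 /m; field; exact: dt.
    have i2 : v t0 = (n 1%nat 0%nat * V1 t0 + n 1%nat 1%nat * V2 t0)%C.
      rewrite /n n3 n4 /V1 /V2 /m; field; exact: dt.
    rewrite {1}i1 {1}i2; exact: linear_pair_bound.
  rewrite -EU in vb ub.
  have S0 : 0 <= S.
    by apply: Rplus_le_le_0_compat; apply: Rmult_le_pos; try exact: Cmod_ge_0; exact/Rlt_le/Rpower_pos.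
  have U0 : 0 <= U by rewrite EU; have := Cmod_ge_0 (U1 t0); have := Cmod_ge_0 (v t0); lra.
  have k1 := Rlt_le _ _ K10.
  split.
  - have a1 := Rmult_le_compat_l _ _ _ k1 w1.
    have a2 := Rmult_le_compat_l _ _ _ k1 vb.
    have := Rmult_le_pos _ _ k1 U0; have := Rmult_le_pos _ _ (Rmult_le_pos _ _ k1 KN0) U0; rewrite /K.
    rewrite -/S in c1; lra.
  - have a1 := Rmult_le_compat_l _ _ _ KN0 w2.
    have a2 := Rmult_le_compat_l _ _ _ KN0 c2; rewrite -/S in a2.
    have := Rmult_le_pos _ _ k1 S0; have := Rmult_le_pos _ _ (Rmult_le_pos _ _ k1 KM0) S0; rewrite /K; lra.
Qed.

(** * Bounds for the coefficients *)

(** The finite part of membership in the class [T^be] that the estimates use. Real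
    coefficients are differentiated once, since they enter the change of unknowns;
    complex ones are not. *)
Definition Rcoefficient (T be M : R) (f df : R -> R) : Prop :=
  Rabs (f 0) <= M /\
  (forall t, 0 < t <= T -> Rabs (f t - f 0) <= M * Rpower t be) /\
  (forall t, 0 < t -> continuity_pt (fun s => f (Rmin s T)) t) /\
  (forall t, 0 < t < T -> is_derive f t (df t) /\ Rabs (df t) <= M * Rpower t (be - 1)).

Definition Ccoefficient (T be M : R) (f : R -> C) : Prop :=
  Cmod (f 0) <= M /\
  (forall t, 0 < t <= T -> Cmod (f t - f 0%R)%C <= M * Rpower t be) /\
  (forall t, 0 < t -> Ccont (fun s => f (Rmin s T)) t).

Lemma norm_Cmod (z : C) : @norm R_AbsRing C_R_NormedModule z = Cmod z.
Proof.
  rewrite /norm /= /prod_norm /norm /= /abs /= /Cmod; congr sqrt.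
  by rewrite -!(pow2_abs (fst z)) -!(pow2_abs (snd z)) /=.
Qed.

Lemma Tclass_Rcoefficient (T be : R) (f : R -> R) : 0 < T ->
  in_Tclass (V := R_NormedModule) T be f -> exists M df, 0 <= M /\ Rcoefficient T be M f df.
Proof.
  move=> T0 [f0 [fs [Hf [fs0 [_ [G [[G0 GS] HG]]]]]]].
  have [dG [HdG HG1]] := GS 0%nat.
  have [C0 HC0] := HG 0%nat; have [C1 HC1] := HG 1%nat.
  exists (Rabs f0 + Rabs C0 + Rabs C1), dG.
  have p0 := Rabs_pos f0; have p1 := Rabs_pos C0; have p2 := Rabs_pos C1.
  have ff0 : f 0 = f0 by rewrite Hf ?fs0; [rewrite /plus /zero /=; ring|lra].
  have ft t : 0 < t <= T -> f t = f0 + G 0%nat t.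
    by move=> Ht; rewrite (G0 t Ht) Hf //; lra.
  split; first lra; split; first by rewrite ff0; lra.
  split.
    move=> t Ht; rewrite ff0 ft //; have -> : f0 + G 0%nat t - f0 = G 0%nat t by ring.
    have := HC0 t Ht; rewrite /norm /= /abs /= => h.
    have rp := Rpower_pos t be; have := Rle_abs C0 => h2.
    have := Rmult_le_compat_r _ _ _ (Rlt_le _ _ rp) h2.
    have := Rmult_le_pos _ _ p0 (Rlt_le _ _ rp); have := Rmult_le_pos _ _ p2 (Rlt_le _ _ rp); lra.
  split.
    move=> t Ht; have c := is_deriv_on_continuity_clamp _ _ T t T0 HdG Ht.
    apply/continuous_iff_continuity_pt.
    apply: (continuous_ext_loc _ (fun s => f0 + G 0%nat (Rmin s T))).
      apply: (locally_open_interval t 0 (t + 1)); first lra.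
      move=> s Hs; apply: esym; apply: ft; split; [apply: Rmin_glb_lt; lra|exact: Rmin_r].
    apply/continuous_iff_continuity_pt; apply: continuity_pt_plus => //; exact: continuity_pt_const.
  move=> t Ht; split.
    have L : locally t (fun s => 0 < s <= T).
      by apply: (locally_open_interval t 0 T) => // s; lra.
    apply: (is_derive_ext_loc (fun s => plus f0 (G 0%nat s))).
      by apply: filter_imp L => s Hs; rewrite ft.
    have -> : dG t = plus zero (dG t) by rewrite plus_zero_l.
    apply: (is_derive_plus (V := R_NormedModule)); first exact: is_derive_const.
    by apply: is_deriv_on_is_derive HdG _ L; lra.
  have h := HC1 t ltac:(lra); have E := HG1 t ltac:(lra).
  rewrite E /norm /= /abs /= /scal /= /mult /= Rabs_mult (Rabs_pos_eq t) in h; last lra.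
  rewrite Rpower_minus_1; last lra.
  have rp := Rpower_pos t be.
  apply: (Rmult_le_reg_l t); first lra.
  apply: Rle_trans h _.
  have -> : t * ((Rabs f0 + Rabs C0 + Rabs C1) * (Rpower t be / t)) = (Rabs f0 + Rabs C0 + Rabs C1) * Rpower t be by field; lra.
  apply: Rmult_le_compat_r; first lra.
  have := Rle_abs C1; lra.
Qed.

Lemma Tclass_Ccoefficient (T be : R) (f : R -> C) : 0 < T ->
  in_Tclass (V := C_R_NormedModule) T be f -> exists M, 0 <= M /\ Ccoefficient T be M f.
Proof.
  move=> T0 [f0 [fs [Hf [fs0 [_ [G [[G0 GS] HG]]]]]]].
  have [dG [HdG _]] := GS 0%nat.
  have [C0 HC0] := HG 0%nat.
  exists (Cmod f0 + Rabs C0).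
  have p0 := Cmod_ge_0 f0; have p1 := Rabs_pos C0.
  have ff0 : f 0 = f0.
    rewrite Hf ?fs0; last lra.
    exact: plus_zero_r.
  have ft t : 0 < t <= T -> f t = (f0 + G 0%nat t)%C.
    by move=> Ht; rewrite (G0 t Ht) Hf //; lra.
  split; first lra; split; first by rewrite ff0; lra.
  split.
    move=> t Ht; rewrite ff0 ft //; have -> : (f0 + G 0%nat t - f0 = G 0%nat t)%C by ring.
    have := HC0 t Ht; rewrite norm_Cmod => h.
    have rp := Rpower_pos t be; have := Rle_abs C0 => h2.
    have := Rmult_le_compat_r _ _ _ (Rlt_le _ _ rp) h2.
    have := Rmult_le_pos _ _ p0 (Rlt_le _ _ rp); lra.
  move=> t Ht; have c := is_deriv_on_Ccont_clamp _ _ T t T0 HdG Ht.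
  have [c1 c2] := Ccont_plus _ _ _ (Ccont_const f0 t) c.
  have L : locally t (fun s => (f0 + G 0%nat (Rmin s T))%C = f (Rmin s T)).
    apply: (locally_open_interval t 0 (t + 1)); first lra.
    move=> s Hs; apply: esym; apply: ft; split; [apply: Rmin_glb_lt; lra|exact: Rmin_r].
  split; apply/continuous_iff_continuity_pt; [move/continuous_iff_continuity_pt: c1|move/continuous_iff_continuity_pt: c2];
    apply: continuous_ext_loc; by apply: filter_imp L => s ->.
Qed.

Lemma Rcoefficient_ext T be M f g df dg : (forall t, f t = g t) -> (forall t, df t = dg t) ->
  Rcoefficient T be M f df -> Rcoefficient T be M g dg.
Proof.
  move=> h1 h2; have -> : f = g by apply: functional_extensionality.
  by have -> : df = dg by apply: functional_extensionality.
Qed.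

Lemma Ccoefficient_ext T be M f g : (forall t, f t = g t) -> Ccoefficient T be M f -> Ccoefficient T be M g.
Proof. by move=> h1; have -> : f = g by apply: functional_extensionality. Qed.

Lemma Rcoefficient_zero T be : 0 < T -> Rcoefficient T be 0 (fun _ => 0) (fun _ => 0).
Proof.
  move=> T0; split; first by rewrite Rabs_R0; lra.
  split; first by move=> t _; rewrite Rminus_diag Rabs_R0; lra.
  split; first by move=> t Ht; apply: continuity_pt_const.
  by move=> t _; split; [exact: is_derive_const|rewrite Rabs_R0; lra].
Qed.

Lemma Ccoefficient_zero T be : 0 < T -> Ccoefficient T be 0 (fun _ => RtoC 0).
Proof.
  move=> T0; split; first by rewrite Cmod_0; lra.
  split; last by move=> t Ht; exact: Ccont_const.
  by move=> t Ht; rewrite /Cminus Cplus_opp_r Cmod_0; lra.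
Qed.

Lemma Rcoefficient_lin T be M M' f df g dg c : Rabs c <= 1 ->
  Rcoefficient T be M f df -> Rcoefficient T be M' g dg ->
  Rcoefficient T be (M + M') (fun t => f t * c + g t) (fun t => df t * c + dg t).
Proof.
  move=> hc [f1 [f2 [f3 f4]]] [g1 [g2 [g3 g4]]].
  have lin (x y a b : R) : Rabs x <= a -> Rabs y <= b -> Rabs (x * c + y) <= a + b.
    move=> hx hy; apply: Rabs_plus_le => //.
    by have := Rabs_mult_le _ _ _ _ hx hc; rewrite Rmult_1_r.
  split; first exact: lin.
  split.
    move=> t Ht; have -> : f t * c + g t - (f 0 * c + g 0) = (f t - f 0) * c + (g t - g 0) by ring.
    by rewrite Rmult_plus_distr_r; apply: lin; [exact: f2|exact: g2].
  split.
    move=> t Ht; apply: continuity_pt_plus; last exact: g3.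
    by apply: continuity_pt_mult; [exact: f3|apply: continuity_pt_const].
  move=> t Ht; have [a1 a2] := f4 t Ht; have [b1 b2] := g4 t Ht; split.
    apply: is_derive_eq.
      apply: (is_derive_plus (V := R_NormedModule)); last exact: b1.
      by apply: is_derive_Rmult; [exact: a1|exact: is_derive_const].
    by rewrite /plus /zero /=; ring.
  by rewrite Rmult_plus_distr_r; apply: lin.
Qed.

Lemma Ccoefficient_lin T be M M' f g c : Rabs c <= 1 ->
  Ccoefficient T be M f -> Ccoefficient T be M' g ->
  Ccoefficient T be (M + M') (fun t => f t * RtoC c + g t)%C.
Proof.
  move=> hc [f1 [f2 f3]] [g1 [g2 g3]].
  have lin (x y : C) (a b : R) : Cmod x <= a -> Cmod y <= b -> Cmod (x * RtoC c + y)%C <= a + b.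
    move=> hx hy; apply: Rle_trans (Cmod_triangle _ _) _; rewrite Cmod_mult Cmod_R.
    have := Rmult_le_compat _ _ _ _ (Cmod_ge_0 x) (Rabs_pos c) hx hc; lra.
  split; first exact: lin.
  split.
    move=> t Ht; have -> : (f t * RtoC c + g t - (f 0%R * RtoC c + g 0%R) = (f t - f 0%R) * RtoC c + (g t - g 0%R))%C by ring.
    by rewrite Rmult_plus_distr_r; apply: lin; [exact: f2|exact: g2].
  move=> t Ht; apply: Ccont_plus; last exact: g3.
  by apply: Ccont_mult; [exact: f3|exact: Ccont_const].
Qed.

Lemma Rcoefficient_sum (I : Type) (r : seq I) T be M (F dF : I -> R -> R) (c : I -> R) :
  0 < T -> (forall i, Rabs (c i) <= 1) -> (forall i, Rcoefficient T be M (F i) (dF i)) ->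
  Rcoefficient T be (INR (size r) * M) (fun t => \big[Rplus/0]_(i <- r) (F i t * c i))
     (fun t => \big[Rplus/0]_(i <- r) (dF i t * c i)).
Proof.
  move=> T0 hc H; elim: r => [|x r IH].
    rewrite /= Rmult_0_l; apply: Rcoefficient_ext (Rcoefficient_zero T be T0) => t; by rewrite big_nil.
  have -> : INR (size (x :: r)) * M = M + INR (size r) * M by rewrite [size _]/= S_INR; ring.
  by apply: Rcoefficient_ext (Rcoefficient_lin _ _ _ _ _ _ _ _ (c x) (hc x) (H x) IH) => t; rewrite big_cons.
Qed.

Lemma Ccoefficient_sum (I : Type) (r : seq I) T be M (F : I -> R -> C) (c : I -> R) :
  0 < T -> (forall i, Rabs (c i) <= 1) -> (forall i, Ccoefficient T be M (F i)) ->
  Ccoefficient T be (INR (size r) * M) (fun t => \big[Cplus/RtoC 0]_(i <- r) Cmult (F i t) (RtoC (c i))).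
Proof.
  move=> T0 hc H; elim: r => [|x r IH].
    rewrite /= Rmult_0_l; apply: Ccoefficient_ext (Ccoefficient_zero T be T0) => t; by rewrite big_nil.
  have -> : INR (size (x :: r)) * M = M + INR (size r) * M by rewrite [size _]/= S_INR; ring.
  by apply: Ccoefficient_ext (Ccoefficient_lin _ _ _ _ _ _ (c x) (hc x) (H x) IH) => t; rewrite big_cons.
Qed.

Lemma Rcoefficient_mono T be M M' f df : M <= M' -> Rcoefficient T be M f df -> Rcoefficient T be M' f df.
Proof.
  move=> h [f1 [f2 [f3 f4]]].
  have mono x : M * Rpower x be <= M' * Rpower x be by apply: Rmult_le_compat_r => //; exact/Rlt_le/Rpower_pos.
  split; first lra; split; first by move=> t Ht; apply: Rle_trans (f2 t Ht) _.
  split => // t Ht; have [a1 a2] := f4 t Ht; split => //.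
  by apply: Rle_trans a2 _; apply: Rmult_le_compat_r => //; exact/Rlt_le/Rpower_pos.
Qed.

Lemma Ccoefficient_mono T be M M' f : M <= M' -> Ccoefficient T be M f -> Ccoefficient T be M' f.
Proof.
  move=> h [f1 [f2 f3]].
  split; first lra; split => // t Ht; apply: Rle_trans (f2 t Ht) _.
  by apply: Rmult_le_compat_r => //; exact/Rlt_le/Rpower_pos.
Qed.

(** The sum of the individual bounds bounds all of them. *)
Lemma finite_uniform_bound (I : finType) (P : I -> R -> Prop) :
  (forall i M M', M <= M' -> P i M -> P i M') -> (forall i, exists M, 0 <= M /\ P i M) ->
  exists M, 0 <= M /\ forall i, P i M.
Proof.
  move=> mono H.
  have [f Hf] := functional_choice (fun i M => 0 <= M /\ P i M) H.
  exists (\big[Rplus/0]_(i <- index_enum I) f i); split.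
    by apply: big_Rplus_ge0 => i; have [] := Hf i.
  move=> i; have [h1 h2] := Hf i; apply: mono h2.
  by apply: (big_Rplus_ge _ _ f) => [j|]; [have [] := Hf j|exact: mem_index_enum].
Qed.

(** The constant is uniform over directions because a symbol is a finite sum of
    coefficients with weights bounded by 1. *)
Lemma symbol_coefficients {d : nat} (E : wave_data d) : admissible E ->
  exists M, 0 <= M /\
    Ccoefficient (wT E) (wbeta E) M (wg E) /\ Ccoefficient (wT E) (wbeta E) M (wh E) /\
    forall om : vec d, (forall i, Rabs (om i) <= 1) ->
      (exists da, Rcoefficient (wT E) (wbeta E) M (fun t => fra E t om) da) /\
      (exists db, Rcoefficient (wT E) (wbeta E) M (fun t => frb E t om) db) /\
      Ccoefficient (wT E) (wbeta E) M (fun t => frc E t om).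
Proof.
  move=> [T0 [_ [_ [Ha [Hb [Hc [Hg [Hh _]]]]]]]].
  set T := wT E in T0 Ha Hb Hc Hg Hh *; set be := wbeta E in Ha Hb Hc Hg Hh *.
  have RP (f : R -> R) : in_Tclass (V := R_NormedModule) T be f ->
      exists M, 0 <= M /\ exists df, Rcoefficient T be M f df.
    by move=> /(Tclass_Rcoefficient T be f T0) [M [df [h1 h2]]]; exists M; split => //; exists df.
  have RM (f : R -> R) M M' : M <= M' -> (exists df, Rcoefficient T be M f df) -> exists df, Rcoefficient T be M' f df.
    by move=> h [df Hdf]; exists df; exact: Rcoefficient_mono Hdf.
  have [Mg [g0 Hg']] := Tclass_Ccoefficient T be _ T0 Hg.
  have [Mh [h0 Hh']] := Tclass_Ccoefficient T be _ T0 Hh.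
  have [Ma [a0 Ha']] : exists M, 0 <= M /\ forall i : 'I_d, forall j, exists df, Rcoefficient T be M (fun t => wa E t i j) df.
    apply: (finite_uniform_bound _ (fun i M => forall j, exists df, Rcoefficient T be M (fun t => wa E t i j) df)).
      by move=> i M M' h H j; exact: RM h (H j).
    move=> i; apply: (finite_uniform_bound _ (fun j M => exists df, Rcoefficient T be M (fun t => wa E t i j) df)).
      by move=> j M M'; exact: RM.
    by move=> j; exact: RP (Ha i j).
  have [Mb [b0 Hb']] : exists M, 0 <= M /\ forall i : 'I_d, exists df, Rcoefficient T be M (fun t => wb E t i) df.
    apply: (finite_uniform_bound _ (fun j M => exists df, Rcoefficient T be M (fun t => wb E t j) df)).
      by move=> j M M'; exact: RM.
    by move=> j; exact: RP (Hb j).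
  have [Mc [c0 Hc']] : exists M, 0 <= M /\ forall i : 'I_d, Ccoefficient T be M (fun t => wc E t i).
    apply: (finite_uniform_bound _ (fun j M => Ccoefficient T be M (fun t => wc E t j))).
      by move=> j M M'; exact: Ccoefficient_mono.
    by move=> j; exact: Tclass_Ccoefficient (Hc j).
  pose n := INR (size (index_enum 'I_d)).
  have n0 : 0 <= n by exact: pos_INR.
  have na := Rmult_le_pos _ _ n0 (Rmult_le_pos _ _ n0 a0); have nb := Rmult_le_pos _ _ n0 b0.
  have nc := Rmult_le_pos _ _ n0 c0.
  exists (Mg + Mh + n * (n * Ma) + n * Mb + n * Mc); split; first lra.
  split; first by apply: Ccoefficient_mono Hg'; lra.
  split; first by apply: Ccoefficient_mono Hh'; lra.
  move=> om Hom; split; last split.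
  - have inner (i : 'I_d) : exists da, Rcoefficient T be (n * Ma) (fun t => \big[Rplus/0]_(j < d) (wa E t i j * om j)) da.
      have [da Hda] := functional_choice _ (Ha' i).
      by eexists; exact: (Rcoefficient_sum _ (index_enum 'I_d) T be Ma (fun j t => wa E t i j) da om T0 Hom Hda).
    have [da Hda] := functional_choice _ inner.
    eexists; apply: Rcoefficient_mono; last first.
      apply: Rcoefficient_ext (Rcoefficient_sum _ (index_enum 'I_d) T be (n * Ma) _ da om T0 Hom Hda) => t //.
      rewrite /fra; apply: eq_bigr => i _.
      rewrite Rmult_comm -big_Rplus_scal; apply: eq_bigr => j _; ring.
    rewrite -/n; lra.
  - have [db Hdb] := functional_choice _ Hb'.
    eexists; apply: Rcoefficient_mono; last exact: (Rcoefficient_sum _ (index_enum 'I_d) T be Mb _ db om T0 Hom Hdb).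
    rewrite -/n; lra.
  - apply: Ccoefficient_mono; last exact: (Ccoefficient_sum _ (index_enum 'I_d) T be Mc _ om T0 Hom Hc').
    rewrite -/n; lra.
Qed.

Lemma dir_le1 {d : nat} (xi : vec d) i : Rabs (dir xi i) <= 1.
Proof.
  have h := coord_le_vnorm xi i; have v0 := vnorm_ge0 xi.
  rewrite /dir /Rdiv Rabs_mult.
  case: (Rle_lt_or_eq_dec _ _ v0) => hv.
    rewrite (Rabs_pos_eq (/ _)); last exact/Rlt_le/Rinv_0_lt_compat.
    apply: (Rmult_le_reg_r (vnorm xi)) => //.
    by rewrite Rmult_assoc Rinv_l ?Rmult_1_r ?Rmult_1_l //; lra.
  have -> : Rabs (xi i) = 0 by have := Rabs_pos (xi i); lra.
  rewrite Rmult_0_l; lra.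
Qed.

Lemma vnorm_dir {d : nat} (xi : vec d) : 0 < vnorm xi -> vnorm (dir xi) = 1.
Proof.
  move=> hv; apply: Rsqr_inj; [exact: vnorm_ge0|lra|].
  rewrite !Rsqr_pow2 vnorm_sqr pow1.
  transitivity (/ vnorm xi ^ 2 * \big[Rplus/0]_(i < d) (xi i) ^ 2).
    rewrite -big_Rplus_scal; apply: eq_bigr => i _; rewrite /dir; field; lra.
  rewrite -vnorm_sqr; field; lra.
Qed.

(** * From the zone to the final time *)

(** Where [X * t^(l+1)] is bounded, the system for [u / t] and [v] has a coefficient of
    size [/ t], and the interval has bounded logarithmic length. This covers the
    gap between the zone and the oscillatory region, and all times if the
    frequency is bounded. *)
Lemma bounded_phase_comparison (M Lam l kap : R) : 0 <= M -> 0 <= Lam -> -1 < l -> 1 <= kap ->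
  exists K, 1 <= K /\
  forall (X t0 t2 : R) (a b : R -> R) (c g h u v : R -> C),
  0 <= X -> 0 < t0 <= t2 -> t2 <= kap * t0 -> X * Rpower t2 (l + 1) <= Lam ->
  (forall t, t0 < t < t2 -> Rabs (a t) <= M /\ Rabs (b t) <= M /\ Cmod (c t) <= M /\ Cmod (g t) <= M /\ Cmod (h t) <= M /\
     is_Cderive u t (v t) /\
     is_Cderive v t (- (stiffness l X t (a t) (c t) (h t) * u t) - damping l X t (b t) (g t) * v t)%C) ->
  (forall t, t0 <= t <= t2 -> Ccont u t /\ Ccont v t) ->
  let U t := Cmod (u t) / t + Cmod (v t) in
  U t2 <= K * U t0 /\ U t0 <= K * U t2.
Proof.
  move=> M0 Lam0 hl hk.
  pose k := M * (Lam ^ 2 + Lam + 1) + M * (2 * Lam + 1) + 1.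
  have L2 := pow2_ge_0 Lam.
  have m1 : 0 <= M * (Lam ^ 2 + Lam + 1) by apply: Rmult_le_pos; lra.
  have m2 : 0 <= M * (2 * Lam + 1) by apply: Rmult_le_pos; lra.
  have k1 : 1 <= k by rewrite /k; lra.
  have lk : 0 <= ln kap by rewrite -ln_1; apply: ln_le; lra.
  pose Ex := exp (4 * (k * ln kap)).
  have Ex1 : 1 <= Ex.
    by rewrite /Ex -exp_0; apply: exp_le_compat; apply: Rmult_le_pos; [lra|apply: Rmult_le_pos; lra].
  exists (2 * Ex); split; first lra.
  move=> X t0 t2 a b c g h u v X0 [t00 t02] tk HX Hd Hc U.
  pose U1 t := (RtoC (/ t) * u t)%C.
  have dinv t : 0 < t -> is_derive (fun s => / s) t (- / t ^ 2).
    by move=> Ht; auto_derive; [lra|field; lra].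
  pose dU1 t := (RtoC (- / t ^ 2) * u t + RtoC (/ t) * v t)%C.
  pose dv t := (- (stiffness l X t (a t) (c t) (h t) * u t) - damping l X t (b t) (g t) * v t)%C.
  have dln t : 0 < t -> is_derive (fun s => k * ln s) t (k * / t).
    move=> Ht; apply: is_derive_eq.
      apply: is_derive_Rmult; first exact: is_derive_const.
      by apply/is_derive_Reals; exact: derivable_pt_lim_ln.
    by rewrite /zero /=; ring.
  have EU t : 0 < t -> Cmod (u t) = t * Cmod (U1 t).
    move=> Ht; rewrite /U1 Cmod_mult Cmod_R Rabs_pos_eq; last exact/Rlt_le/Rinv_0_lt_compat.
    by field; lra.
  have [H1 H2] : Cmod (U1 t2) ^ 2 + Cmod (v t2) ^ 2 <= (Cmod (U1 t0) ^ 2 + Cmod (v t0) ^ 2) * exp (4 * (k * ln t2 - k * ln t0)) /\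
     Cmod (U1 t0) ^ 2 + Cmod (v t0) ^ 2 <= (Cmod (U1 t2) ^ 2 + Cmod (v t2) ^ 2) * exp (4 * (k * ln t2 - k * ln t0)).
    apply: (pair_energy_bound U1 v dU1 dv (fun s => k * ln s) (fun s => k * / s) t0 t2 t02) => t Ht.
    - have [_ [_ [_ [_ [_ [d1 d2]]]]]] := Hd t Ht.
      split; last by split; [exact: d2|apply: dln; lra].
      by apply: is_Cderive_mult => //; apply: is_Cderive_RtoC; apply: dinv; lra.
    - have [c1 c2] := Hc t Ht; split; last first.
        by split => //; apply: is_derive_continuity_pt; apply: dln; lra.
      apply: Ccont_mult => //; apply: Ccont_RtoC; apply: is_derive_continuity_pt; apply: dinv; lra.
    - have [ha [hb [hc [hg [hh _]]]]] := Hd t Ht.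
      have tp : 0 < t by lra.
      have ti := Rinv_0_lt_compat _ tp.
      pose y := X * Rpower t (l + 1).
      have y0 : 0 <= y by apply: Rmult_le_pos => //; exact/Rlt_le/Rpower_pos.
      have yL : y <= Lam.
        apply: Rle_trans HX; apply: Rmult_le_compat_l => //; apply: Rle_Rpower_l; lra.
      have e1 : Rpower t l * X = y * / t by rewrite /y Rpower_plus Rpower_1 //; field; lra.
      have e2 : Rpower t (l - 1) * X = y * / t * / t by rewrite Rpower_minus_1 // -e1 /Rdiv; ring.
      have e3 : Rpower t (2 * l) * X ^ 2 = (y * / t) ^ 2.
        have -> : 2 * l = l + l by ring.
        by rewrite -e1 Rpower_plus; ring.
      have u0 := Cmod_ge_0 (U1 t); have v0 := Cmod_ge_0 (v t).
      have eu := EU t tp.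
      have tu := Rmult_le_pos _ _ (Rlt_le _ _ ti) u0; have tv := Rmult_le_pos _ _ (Rlt_le _ _ ti) v0.
      split.
      + apply: (Rle_trans _ (1 * (/ t * (Cmod (U1 t) + Cmod (v t))))).
          apply: Rle_trans (Cmod_triangle _ _) _; rewrite (Cmod_mult _ (u t)) (Cmod_mult _ (v t)) !Cmod_R Rabs_Ropp eu.
          rewrite !Rabs_pos_eq; try lra; last by apply/Rlt_le/Rinv_0_lt_compat/pow_lt.
          have -> : / t ^ 2 * (t * Cmod (U1 t)) = / t * Cmod (U1 t) by field; lra.
          lra.
        rewrite Rmult_assoc; apply: Rmult_le_compat_r; lra.
      + have hq : Cmod (stiffness l X t (a t) (c t) (h t) * u t)%C <= M * (Lam ^ 2 + Lam + 1) * (/ t * Cmod (U1 t)).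
          rewrite Cmod_mult eu.
          have B : Cmod (stiffness l X t (a t) (c t) (h t)) <= M * (Lam ^ 2 + Lam + 1) * / t ^ 2.
            rewrite /stiffness.
            have q1 := Cmod_triangle (RtoC (Rpower t (2 * l) * X ^ 2 * a t) + Ci * RtoC (Rpower t (l - 1) * X) * c t) (RtoC (/ t ^ 2) * h t).
            have q2 := Cmod_triangle (RtoC (Rpower t (2 * l) * X ^ 2 * a t)) (Ci * RtoC (Rpower t (l - 1) * X) * c t).
            apply: Rle_trans q1 _.
            have it2 : 0 < / t ^ 2 by apply/Rinv_0_lt_compat/pow_lt.
            have p1 : Cmod (RtoC (Rpower t (2 * l) * X ^ 2 * a t)) <= Lam ^ 2 * M * / t ^ 2.
              rewrite e3 Cmod_R Rabs_mult Rabs_pos_eq; last exact: pow2_ge_0.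
              rewrite Rpow_mult_distr pow_inv.
              have yy : y ^ 2 <= Lam ^ 2 by apply: pow_incr.
              have := Rmult_le_compat _ _ _ _ (pow2_ge_0 y) (Rabs_pos (a t)) yy ha => z.
              have := Rmult_le_compat_r _ _ _ (Rlt_le _ _ it2) z; lra.
            have p2 : Cmod (Ci * RtoC (Rpower t (l - 1) * X) * c t)%C <= Lam * M * / t ^ 2.
              rewrite -Cmult_assoc Cmod_Ci_mult Cmod_mult e2 Cmod_R Rabs_pos_eq; last first.
                apply: Rmult_le_pos; last lra.
                by apply: Rmult_le_pos; lra.
              have z := Rmult_le_compat _ _ _ _ y0 (Cmod_ge_0 (c t)) yL hc.
              have -> : y * / t * / t * Cmod (c t) = y * Cmod (c t) * / t ^ 2 by field; lra.
              by apply: Rmult_le_compat_r; lra.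
            have p3 : Cmod (RtoC (/ t ^ 2) * h t)%C <= M * / t ^ 2.
              rewrite Cmod_mult Cmod_R Rabs_pos_eq; last lra.
              by rewrite Rmult_comm; apply: Rmult_le_compat_r; lra.
            lra.
          have tU : 0 <= t * Cmod (U1 t) by apply: Rmult_le_pos; lra.
          apply: Rle_trans (Rmult_le_compat_r _ _ _ tU B) _.
          have -> : M * (Lam ^ 2 + Lam + 1) * / t ^ 2 * (t * Cmod (U1 t)) = M * (Lam ^ 2 + Lam + 1) * (/ t * Cmod (U1 t)) by field; lra.
          exact: Rle_refl.
        have hp : Cmod (damping l X t (b t) (g t) * v t)%C <= M * (2 * Lam + 1) * (/ t * Cmod (v t)).
          rewrite Cmod_mult.
          have B : Cmod (damping l X t (b t) (g t)) <= M * (2 * Lam + 1) * / t.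
            apply: Rle_trans (Cmod_triangle _ _) _.
            have p1 : Cmod (2 * Ci * RtoC (Rpower t l * X * b t))%C <= 2 * (Lam * M * / t).
              have -> : (2 * Ci * RtoC (Rpower t l * X * b t) = Ci * (RtoC 2 * RtoC (Rpower t l * X * b t)))%C by ring.
              rewrite Cmod_Ci_mult Cmod_mult !Cmod_R e1 (Rabs_pos_eq 2); last lra.
              apply: Rmult_le_compat_l; first lra.
              rewrite Rabs_mult Rabs_pos_eq; last by apply: Rmult_le_pos; lra.
              have z := Rmult_le_compat _ _ _ _ y0 (Rabs_pos (b t)) yL hb.
              have := Rmult_le_compat_r _ _ _ (Rlt_le _ _ ti) z; lra.
            have p2 : Cmod (RtoC (/ t) * g t)%C <= M * / t.
              rewrite Cmod_mult Cmod_R Rabs_pos_eq; last lra.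
              by rewrite Rmult_comm; apply: Rmult_le_compat_r; lra.
            lra.
          have := Rmult_le_compat_r _ _ _ v0 B; lra.
        apply: Rle_trans (Cmod_minus_le _ _) _; rewrite Cmod_opp.
        have := Rmult_le_pos _ _ m1 tv; have := Rmult_le_pos _ _ m2 tu; rewrite /k; lra.
  have Er : exp (4 * (k * ln t2 - k * ln t0)) <= Ex.
    apply: exp_le_compat; apply: Rmult_le_compat_l; first lra.
    rewrite -Rmult_minus_distr_l; apply: Rmult_le_compat_l; first lra.
    have : ln t2 <= ln (kap * t0) by apply: ln_le; lra.
    rewrite ln_mult; lra.
  have EUt t : 0 < t -> U t = Cmod (U1 t) + Cmod (v t).
    by move=> Ht; rewrite /U EU //; field; lra.
  have sq (x y x' y' e : R) : 0 <= x -> 0 <= y -> 0 <= x' -> 0 <= y' -> e <= Ex ->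
      x ^ 2 + y ^ 2 <= (x' ^ 2 + y' ^ 2) * e -> x + y <= 2 * Ex * (x' + y').
    move=> x0 y0 x0' y0' he h'; apply: sqr_le_linear; try lra.
    have := pow2_ge_0 (x - y).
    have s0 : 0 <= x' ^ 2 + y' ^ 2 by have := pow2_ge_0 x'; have := pow2_ge_0 y'; lra.
    have h2 : x' ^ 2 + y' ^ 2 <= (x' + y') ^ 2 by have := Rmult_le_pos _ _ x0' y0'; lra.
    have := Rmult_le_compat_l _ _ _ s0 he; have := Rmult_le_compat_r Ex _ _ ltac:(lra) h2; lra.
  rewrite !EUt; try lra.
  by split; apply: sq; try exact: Cmod_ge_0; eassumption.
Qed.

Lemma continuity_pt_Rpower_clamp (T p t : R) : 0 < T -> 0 < t ->
  continuity_pt (fun s => Rpower (Rmin s T) p) t.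
Proof.
  move=> T0 Ht; apply: (continuity_pt_comp (fun s => Rmin s T) (fun x => Rpower x p)).
    exact: continuity_pt_Rmin_r.
  apply: is_derive_continuity_pt; apply: is_derive_Rpower; exact: Rmin_glb_lt.
Qed.

Lemma wave_coefficients_Ccont {d : nat} (E : wave_data d) (xi : vec d) (t : R) : admissible E -> 0 < t ->
  Ccont (fun s => wave_damping E xi (Rmin s (wT E))) t /\ Ccont (fun s => wave_stiffness E xi (Rmin s (wT E))) t.
Proof.
  move=> HE Ht; have [M [_ [[_ [_ cg]] [[_ [_ ch]] HM]]]] := symbol_coefficients E HE.
  have [[da [_ [_ [ca _]]]] [[db [_ [_ [cb _]]]] [_ [_ cc]]]] := HM (dir xi) (dir_le1 xi).
  have T0 : 0 < wT E by case: HE.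
  have cR p := continuity_pt_Rpower_clamp (wT E) p t T0 Ht.
  have ci : continuity_pt (fun s => / Rmin s (wT E)) t.
    apply: continuity_pt_inv; first exact: continuity_pt_Rmin_r.
    by have := Rmin_glb_lt _ _ _ Ht T0; lra.
  have cst (x : R) : continuity_pt (fun _ => x) t by exact: continuity_pt_const.
  rewrite /wave_damping /wave_stiffness /damping /stiffness; split.
  - apply: Ccont_plus.
      apply: Ccont_mult; first exact: Ccont_const.
      apply: Ccont_RtoC; apply: continuity_pt_mult; last exact: cb.
      by apply: continuity_pt_mult.
    by apply: Ccont_mult; [apply: Ccont_RtoC|exact: cg].
  - apply: Ccont_plus.
      apply: Ccont_plus.
        apply: Ccont_RtoC; apply: continuity_pt_mult; last exact: ca.
        by apply: continuity_pt_mult.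
      apply: Ccont_mult; last exact: cc.
      apply: Ccont_mult; first exact: Ccont_const.
      by apply: Ccont_RtoC; apply: continuity_pt_mult.
    apply: Ccont_mult; last exact: ch.
    apply: Ccont_RtoC.
    apply: continuity_pt_inv; last first.
      by have := pow_lt _ 2 (Rmin_glb_lt _ _ _ Ht T0); lra.
    apply: (continuity_pt_comp (fun s => Rmin s (wT E)) (fun x => x ^ 2)); first exact: continuity_pt_Rmin_r.
    by apply/derivable_continuous_pt/derivable_pt_pow.
Qed.

(** Ellipticity keeps the argument of the root away from 0, so [alpha] inherits
    the bounds of its square. *)
Lemma sqrt_coefficient (T be M m : R) (a b da db : R -> R) :
  0 < T -> 0 < be -> 0 <= M -> 0 < m ->
  Rcoefficient T be M a da -> Rcoefficient T be M b db ->
  (forall t, 0 <= t <= T -> m ^ 2 <= a t + b t ^ 2) ->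
  let M1 := M * (1 + Rpower T be) in
  let M2 := M1 + 1 + (M + 2 * M1 * M) / m in
  let al t := sqrt (a t + b t ^ 2) in
  m <= al 0 /\
  (forall t, 0 < t <= T -> al t ^ 2 = a t + b t ^ 2 /\ m <= al t <= M2 /\ Rabs (al t - al 0) <= M2 * Rpower t be) /\
  (forall t, 0 < t -> continuity_pt (fun s => al (Rmin s T)) t) /\
  exists dal, forall t, 0 < t < T -> is_derive al t (dal t) /\ Rabs (dal t) <= M2 * Rpower t (be - 1).
Proof.
  move=> T0 be0 M0 m0 [a1 [a2 [a3 a4]]] [b1 [b2 [b3 b4]]] HA M1 M2 al.
  pose A t := a t + b t ^ 2.
  have rT := Rpower_pos T be.
  have MT : 0 <= M * Rpower T be by apply: Rmult_le_pos; lra.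
  have M10 : 0 <= M1 by rewrite /M1; lra.
  have MM : M <= M1 by rewrite /M1; lra.
  have le1 t : 0 < t <= T -> M * Rpower t be <= M * Rpower T be.
    by move=> Ht; apply: Rmult_le_compat_l => //; apply: Rle_Rpower_l; lra.
  have bT t : 0 <= t <= T -> Rabs (b t) <= M1.
    move=> [h1 h2]; case: (Rle_lt_or_eq_dec _ _ h1) => [h|<-]; last lra.
    have -> : b t = (b t - b 0) + b 0 by ring.
    apply: Rle_trans (Rabs_plus_le _ _ _ _ (b2 t ltac:(lra)) b1) _; have := le1 t ltac:(lra); rewrite /M1; lra.
  have aT t : 0 <= t <= T -> Rabs (a t) <= M1.
    move=> [h1 h2]; case: (Rle_lt_or_eq_dec _ _ h1) => [h|<-]; last lra.
    have -> : a t = (a t - a 0) + a 0 by ring.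
    apply: Rle_trans (Rabs_plus_le _ _ _ _ (a2 t ltac:(lra)) a1) _; have := le1 t ltac:(lra); rewrite /M1; lra.
  have m2 := pow_lt m 2 m0.
  have AT t : 0 <= t <= T -> 0 < A t by move=> Ht; have := HA t Ht; rewrite /A; lra.
  have al2 t : 0 <= t <= T -> al t ^ 2 = A t by move=> Ht; rewrite /al pow2_sqrt //; have := AT t Ht; rewrite /A; lra.
  have alm t : 0 <= t <= T -> m <= al t.
    move=> Ht; rewrite -(sqrt_pow2 m); last lra.
    by apply: sqrt_le_1_alt; exact: HA.
  have W0 : 0 <= (M + 2 * M1 * M) by have := Rmult_le_pos _ _ M10 M0; lra.
  have Wm : 0 <= (M + 2 * M1 * M) / m by apply: Rmult_le_pos => //; exact/Rlt_le/Rinv_0_lt_compat.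
  split; first by apply: alm; lra.
  split.
    move=> t Ht; split; first by apply: al2; lra.
    have hm := alm t ltac:(lra); have hm0 := alm 0 ltac:(lra).
    split.
      split => //; apply: (Rle_trans _ (M1 + 1)); last by rewrite /M2; lra.
      apply: Rsqr_incr_0_var; last lra.
      rewrite !Rsqr_pow2 al2; last lra.
      have := Rabs_le_between _ _ => /(_ (a t) M1) [/(_ (aT t ltac:(lra))) h _].
      have := pow_incr _ _ 2 (conj (Rabs_pos (b t)) (bT t ltac:(lra))); rewrite pow2_abs /A; lra.
    have E : (al t - al 0) * (al t + al 0) = (a t - a 0) + (b t - b 0) * (b t + b 0).
      transitivity (al t ^ 2 - al 0 ^ 2); first by ring.
      rewrite !al2 /A; try lra; ring.
    have rt := Rpower_pos t be.
    have h : Rabs ((al t - al 0) * (al t + al 0)) <= (M + 2 * M1 * M) * Rpower t be.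
      rewrite E; have h1 := Rabs_plus_le _ _ _ _ (bT t ltac:(lra)) (bT 0 ltac:(lra)).
      have := Rabs_plus_le _ _ _ _ (a2 t Ht) (Rabs_mult_le _ _ _ _ (b2 t Ht) h1); lra.
    rewrite Rabs_mult (Rabs_pos_eq (al t + al 0)) in h; last lra.
    have h2 : Rabs (al t - al 0) * m <= (M + 2 * M1 * M) * Rpower t be.
      apply: Rle_trans h; apply: Rmult_le_compat_l; [exact: Rabs_pos|lra].
    apply: (Rle_trans _ ((M + 2 * M1 * M) / m * Rpower t be)); last first.
      apply: Rmult_le_compat_r; [lra|rewrite /M2; lra].
    apply: (Rmult_le_reg_r m) => //.
    have -> : (M + 2 * M1 * M) / m * Rpower t be * m = (M + 2 * M1 * M) * Rpower t be by field; lra.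
    exact: h2.
  split.
    move=> t Ht.
    apply: (continuity_pt_comp (fun s => A (Rmin s T)) sqrt).
      apply: continuity_pt_plus; first exact: a3.
      apply: (continuity_pt_comp (fun s => b (Rmin s T)) (fun x => x ^ 2)); first exact: b3.
      by apply/derivable_continuous_pt/derivable_pt_pow.
    apply: continuity_pt_sqrt; apply/Rlt_le/AT; split; [apply/Rlt_le/Rmin_glb_lt => //|exact: Rmin_r].
  exists (fun t => (da t + 2 * b t * db t) / (2 * al t)) => t Ht.
  have [d1 d2] := a4 t Ht; have [e1 e2] := b4 t Ht.
  have hm := alm t ltac:(lra).
  split.
    have At := AT t ltac:(lra).
    apply: is_derive_eq.
      apply: (is_derive_comp sqrt (fun s => a s + b s ^ 2)).
        by apply/is_derive_Reals; exact: derivable_pt_lim_sqrt.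
      apply: (is_derive_plus (V := R_NormedModule)); first exact: d1.
      exact: (is_derive_pow _ 2 _ _ e1).
    have sA : 0 < sqrt (A t) by exact: sqrt_lt_R0.
    move: sA; rewrite /scal /= /mult /plus /= /al /A /=; move: (sqrt _) => x x0; field; lra.
  have rt := Rpower_pos t (be - 1).
  have h1 : Rabs (da t + 2 * b t * db t) <= (M + 2 * M1 * M) * Rpower t (be - 1).
    have hb : Rabs (2 * b t) <= 2 * M1.
      by rewrite Rabs_mult (Rabs_pos_eq 2); [have := bT t ltac:(lra); lra|lra].
    have := Rabs_plus_le _ _ _ _ d2 (Rabs_mult_le _ _ _ _ hb e2); lra.
  rewrite /Rdiv; have h2 : Rabs (/ (2 * al t)) <= / m.
    rewrite Rabs_pos_eq; last by apply/Rlt_le/Rinv_0_lt_compat; lra.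
    apply: Rinv_le_contravar; lra.
  apply: Rle_trans (Rabs_mult_le _ _ _ _ h1 h2) _.
  have -> : (M + 2 * M1 * M) * Rpower t (be - 1) * / m = (M + 2 * M1 * M) / m * Rpower t (be - 1) by rewrite /Rdiv; ring.
  apply: Rmult_le_compat_r; [lra|rewrite /M2; lra].
Qed.

(** The supremum is finite as soon as one bound is known, and only then is its
    real part an upper bound. *)
Lemma delta_plus_bound {d : nat} (E : wave_data d) (om0 : vec d) : -1 < wl E ->
  (exists B, forall om, vnorm om = 1 ->
     Rabs (Re (frc E 0%R om - (RtoC (wl E) + wg E 0%R) * RtoC (frb E 0%R om))%C) / alpha E 0 om <= B) ->
  vnorm om0 = 1 ->
  Rabs (Re (frc E 0%R om0 - (RtoC (wl E) + wg E 0%R) * RtoC (frb E 0%R om0))%C) / alpha E 0 om0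
    <= 2 * (wl E + 1) * delta_plus E.
Proof.
  move=> hl [B HB] h0; rewrite /delta_plus.
  set P := (fun x : R => _).
  have [ub lub] := Lub_Rbar_correct P.
  have P0 : P (Rabs (Re (frc E 0%R om0 - (RtoC (wl E) + wg E 0%R) * RtoC (frb E 0%R om0))%C) / alpha E 0 om0).
    by exists om0.
  have h1 := ub _ P0.
  have h2 : Rbar_le (Lub_Rbar P) (Finite B).
    by apply: lub => x [om [hom ->]]; exact: HB.
  move: h1 h2; case: (Lub_Rbar P) => [r| |] //= h1 _.
  have -> : 2 * (wl E + 1) * (/ (2 * (wl E + 1)) * r) = r by field; lra.
  exact: h1.
Qed.

Lemma Re_div_RtoC (z : C) (x : R) : x <> 0 -> Re (z / RtoC x)%C = Re z / x.
Proof. by move=> h; rewrite /Cdiv -RtoC_inv //; case: z => a b /=; rewrite /Rdiv; ring. Qed.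

Lemma oscillatory_region {d : nat} (E : wave_data d) : admissible E ->
  exists Lam K, 0 < K /\ forall (xi : vec d) (u v : R -> C) (t2 : R),
    0 < vnorm xi -> 0 < t2 <= wT E -> Lam <= vnorm xi * Rpower t2 (wl E + 1) ->
    is_classical_solution (wT E) (wave_damping E xi) (wave_stiffness E xi) u v ->
    let N t := (vnorm xi * Rpower t (wl E)) ^ 2 * Cmod (u t) ^ 2 + Cmod (v t) ^ 2 in
    let D := 2 * (wl E + 1) * delta_plus E in
    N (wT E) <= K * Rpower (wT E / t2) (wl E - Re (wg E 0) + D) * N t2 /\
    N t2 <= K * Rpower (wT E / t2) (- (wl E - Re (wg E 0)) + D) * N (wT E).
Proof.
  move=> HE; have [M [M0 [[g1 [g2 _]] [[h1 [h2 _]] HM]]]] := symbol_coefficients E HE.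
  move: (HE) => [T0 [hl [be0 [_ [_ [_ [_ [_ [la0 [lap Hell]]]]]]]]]].
  set T := wT E in T0 g2 h2 HM Hell *; set l := wl E in hl *; set be := wbeta E in be0 g2 h2 HM.
  pose m := sqrt la0.
  have m0 : 0 < m by exact: sqrt_lt_R0.
  have mm : m ^ 2 = la0 by rewrite /m pow2_sqrt //; lra.
  pose M1 := M * (1 + Rpower T be). pose M2 := M1 + 1 + (M + 2 * M1 * M) / m.
  have rT := Rpower_pos T be.
  have MT : 0 <= M * Rpower T be by apply: Rmult_le_pos; lra.
  have MM1 : M <= M1 by rewrite /M1; lra.
  have M12 : M1 + 1 <= M2.
    have : 0 <= (M + 2 * M1 * M) / m; last by rewrite /M2; lra.
    apply: Rmult_le_pos; last exact/Rlt_le/Rinv_0_lt_compat.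
    have := Rmult_le_pos _ _ (Rle_trans _ _ _ M0 MM1) M0; lra.
  have Hunit (om : vec d) : vnorm om = 1 -> (forall i, Rabs (om i) <= 1) /\
     forall t, 0 <= t <= T -> m ^ 2 <= fra E t om + frb E t om ^ 2.
    move=> hom; split; first by move=> i; rewrite -hom; exact: coord_le_vnorm.
    move=> t Ht; rewrite mm; have := Hell t om Ht; rewrite hom pow1 Rmult_1_r.
    by have := pow2_ge_0 (frb E t om); rewrite /fra; lra.
  have fq (om : vec d) (hom : vnorm om = 1) : m <= alpha E 0 om /\ Rabs (frb E 0 om) <= M2 /\
      Cmod (frc E 0 om) <= M2 /\ Cmod (wg E 0) <= M2 /\
      Rabs (Re (frc E 0%R om - (RtoC l + wg E 0%R) * RtoC (frb E 0%R om))%C) / alpha E 0 om <= (M2 + (Rabs l + M2) * M2) / m.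
    have [o1 o2] := Hunit om hom.
    have [[da Ha] [[db Hb] [c1 _]]] := HM om o1.
    have [k1 _] := sqrt_coefficient T be M m _ _ _ _ T0 be0 M0 m0 Ha Hb o2.
    have a0 : 0 < alpha E 0 om by move: k1; rewrite /alpha; lra.
    have b1 : Rabs (frb E 0 om) <= M by case: Hb.
    do 4 (split; first by (exact: k1 || lra)).
    have [q _] := frozen_quotient_close M2 m (Rabs l) l 0 (alpha E 0 om) (alpha E 0 om) (frb E 0 om) (frb E 0 om)
      (frc E 0 om) (frc E 0 om) (wg E 0) (wg E 0) ltac:(lra) m0 (Rle_refl _) (Rle_refl _) k1 k1 ltac:(lra) ltac:(lra)
      ltac:(lra) ltac:(lra) ltac:(rewrite Rminus_diag Rabs_R0; lra) ltac:(rewrite Rminus_diag Rabs_R0; lra)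
      ltac:(rewrite /Cminus Cplus_opp_r Cmod_0; lra) ltac:(rewrite /Cminus Cplus_opp_r Cmod_0; lra).
    apply: Rle_trans q; apply: Rle_trans (Rabs_Re_le _); rewrite Re_div_RtoC; last lra.
    rewrite /Rdiv Rabs_mult (Rabs_pos_eq (/ _)); [exact: Rle_refl|exact/Rlt_le/Rinv_0_lt_compat].
  have [Lam [K [K0 HK]]] := oscillatory_comparison M2 m l be T ltac:(lra) m0 hl be0 T0.
  exists Lam, K; split => //.
  move=> xi u v t2 X0 Ht2 HL [Hd Hc] N D.
  pose om := dir xi.
  have hom : vnorm om = 1 by exact: vnorm_dir.
  have [f1 [f2 [f3 [f4 _]]]] := fq om hom.
  have [o1 o2] := Hunit om hom.
  have [[da Ha] [[db Hb] [c1 [c2 _]]]] := HM om o1.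
  have [_ [s1 [s2 [dal s3]]]] := sqrt_coefficient T be M m _ _ _ _ T0 be0 M0 m0 Ha Hb o2.
  have [_ [b2 [b3 b4]]] := Hb.
  have le1 t p : 0 < t -> M * Rpower t p <= M2 * Rpower t p.
    by move=> Ht; apply: Rmult_le_compat_r; [exact/Rlt_le/Rpower_pos|lra].
  have hD : Rabs (Re ((frc E 0%R om - (RtoC l + wg E 0%R) * RtoC (frb E 0%R om)) / RtoC (alpha E 0 om))%C) <= D.
    rewrite Re_div_RtoC; last lra.
    rewrite /Rdiv Rabs_mult (Rabs_pos_eq (/ _)); last by apply/Rlt_le/Rinv_0_lt_compat; lra.
    apply: (delta_plus_bound E om hl) => //; eexists => om' hom'.
    by have [_ [_ [_ [_ h]]]] := fq om' hom'; exact: h.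
  apply: (HK (vnorm xi) (alpha E 0 om) (frb E 0 om) D t2 (frc E 0 om) (wg E 0) (fun t => fra E t om)
     (fun t => frb E (Rmin t T) om) (fun t => alpha E (Rmin t T) om) db dal (fun t => frc E t om) (wg E) (wh E) u v) => //.
  - move=> t Ht; have tm : Rmin t T = t by rewrite Rmin_left //; lra.
    have [q1 [q2 _]] := s1 t ltac:(lra).
    have [cu cv] := Hc t ltac:(lra).
    rewrite tm; split => //; split => //.
    split.
      have -> : frb E t om = (frb E t om - frb E 0 om) + frb E 0 om by ring.
      have : Rabs (frb E 0 om) <= M by case: Hb.
      move=> w; apply: Rle_trans (Rabs_plus_le _ _ _ _ (b2 t ltac:(lra)) w) _.
      have : M * Rpower t be <= M * Rpower T be by apply: Rmult_le_compat_l => //; apply: Rle_Rpower_l; lra.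
      move: M12; rewrite /M1; lra.
    split; first by apply: s2; lra.
    by split; first (apply: b3; lra).
  - move=> t Ht; have t0 : 0 < t by lra.
    have tm : Rmin t T = t by rewrite Rmin_left //; lra.
    have [q1 [q2 q3]] := s1 t ltac:(lra).
    have [r1 r2] := s3 t ltac:(lra).
    have [p1 p2] := b4 t ltac:(lra).
    have [du dv] := Hd t ltac:(lra).
    have L : locally (T := R_UniformSpace) t (fun s : R => Rmin s T = s).
      by apply: (locally_open_interval t 0 T) => [|s hs]; [lra|rewrite Rmin_left //; lra].
    rewrite tm; split.
      have -> : wh E t = (wh E t - wh E 0%R + wh E 0%R)%C by ring.
      apply: Rle_trans (Cmod_triangle _ _) _.
      have := h2 t ltac:(lra).
      have : M * Rpower t be <= M * Rpower T be by apply: Rmult_le_compat_l => //; apply: Rle_Rpower_l; lra.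
      move: M12; rewrite /M1; lra.
    split; first exact: q3.
    split; first by apply: Rle_trans (b2 t ltac:(lra)) _; exact: le1.
    split; first by apply: Rle_trans (c2 t ltac:(lra)) _; exact: le1.
    split; first by apply: Rle_trans (g2 t ltac:(lra)) _; exact: le1.
    split; first by apply: is_derive_ext_loc r1; apply: filter_imp L => s; rewrite /alpha => ->.
    split; first exact: r2.
    split; first by apply: is_derive_ext_loc p1; apply: filter_imp L => s ->.
    split; first by apply: Rle_trans p2 _; exact: le1.
    by split; [exact: du|exact: dv].
Qed.

Lemma Rpower_bounded_base (B x p : R) : 1 <= x <= B -> Rpower x p <= Rpower B (Rabs p) /\ 1 <= Rpower B (Rabs p) * Rpower x p.
Proof.
  move=> [x1 xB].
  have lx : 0 <= ln x by rewrite -ln_1; apply: ln_le; lra.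
  have lxB : ln x <= ln B by apply: ln_le; lra.
  have a1 := Rle_abs p; have a2 := Rle_abs (- p); rewrite Rabs_Ropp in a2.
  have a3 := Rabs_pos p.
  have h3 : Rabs p * ln x <= Rabs p * ln B by apply: Rmult_le_compat_l.
  split.
    rewrite /Rpower; apply: exp_le_compat.
    have := Rmult_le_compat_r _ _ _ lx a1; lra.
  rewrite /Rpower -exp_plus -exp_0; apply: exp_le_compat.
  have := Rmult_le_compat_r _ _ _ lx a2; lra.
Qed.

(** The interval from the zone to [wT E] is split at the time [t2] where
    [br * t^(l+1)] reaches the constant [Lam]; before it [bounded_phase_comparison]
    applies, after it [oscillatory_region]. Since [t2] is a constant times
    [br^(- 1 / (l + 1))], the powers of [T / t2] in the latter are the powers
    [delta_plus] and [delta_zero] of the bracket. *)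
Lemma outer_estimate {d : nat} (E : wave_data d) (rho0 : R) : (1 <= d)%nat -> admissible E -> 0 < rho0 <= 1 ->
  exists K, 0 < K /\ forall (xi : vec d) (u v : R -> C),
    is_classical_solution (wT E) (wave_damping E xi) (wave_stiffness E xi) u v ->
    let t0 := Rmin (wT E) (rho0 / dbracket E xi) / 2 in
    let U := Cmod (u t0) / t0 + Cmod (v t0) in
    let br := bracket (vnorm xi) in
    let F := br * Cmod (u (wT E)) + Cmod (v (wT E)) in
    Rpower br (delta_zero E) * F <= K * (Rpower br (delta_plus E) * U) /\
    U <= K * (Rpower br (delta_plus E) * (Rpower br (delta_zero E) * F)).
Proof.
  move=> hd HE [rho00 rho01].
  have [kd [kd1 HJ]] := dbracket_comparison d hd.
  have [Lam0 [K1 [K10 HK1]]] := oscillatory_region E HE.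
  have [M [M0 [[g1 [g2 _]] [[h1 [h2 _]] HM]]]] := symbol_coefficients E HE.
  move: (HE) => [T0 [hl [be0 _]]].
  set T := wT E in T0 g2 h2 HM HK1 *; set l := wl E in hl HK1 *; set be := wbeta E in be0 g2 h2 HM.
  have l1 : 0 < l + 1 by lra.
  have il1 : 0 < / (l + 1) by exact: Rinv_0_lt_compat.
  have rT := Rpower_pos T be.
  pose M1 := M * (1 + Rpower T be).
  have M10 : 0 <= M1 by apply: Rmult_le_pos; lra.
  have MT t : 0 < t <= T -> M + M * Rpower t be <= M1.
    move=> Ht; have h : Rpower t be <= Rpower T be by apply: Rle_Rpower_l; lra.
    have := Rmult_le_compat_l _ _ _ M0 h; rewrite /M1; lra.
  pose TP := Rpower T (l + 1).
  have TP0 : 0 < TP by exact: Rpower_pos.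
  (* [Lam0] for the oscillatory region, [TP] so that [|xi|] and its bracket are
     comparable once [t2 < T], [kd] so that [t0 <= t2]. *)
  pose Lam := 2 * Rabs Lam0 + 2 * TP + kd + 2.
  have aL := Rabs_pos Lam0.
  have Lam1 : 2 <= Lam by rewrite /Lam; lra.
  pose Bd := Lam / TP.
  have Bd2 : 2 <= Bd.
    apply: (Rmult_le_reg_r TP) => //; rewrite /Bd /Rdiv Rmult_assoc Rinv_l; last lra.
    rewrite /Lam; lra.
  pose mn := Rmin T rho0.
  have mn0 : 0 < mn by exact: Rmin_glb_lt.
  pose Lr := Rpower Lam (/ (l + 1)).
  have Lr0 : 0 < Lr by exact: Rpower_pos.
  pose kap := 2 * Lr / mn + 1.
  have kap1 : 1 <= kap.
    have : 0 < 2 * Lr / mn by apply: Rdiv_lt_0_compat; lra.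
    rewrite /kap; lra.
  have [K2 [K21 HK2]] := bounded_phase_comparison M1 Lam l kap M10 ltac:(lra) hl kap1.
  pose dp := delta_plus E; pose d0 := delta_zero E.
  pose c0 := Rpower Bd (Rabs d0); pose cp := Rpower Bd (Rabs dp).
  have c00 : 0 < c0 by exact: Rpower_pos.
  have cp0 : 0 < cp by exact: Rpower_pos.
  pose c := Rpower T l.
  have cpos : 0 < c by exact: Rpower_pos.
  have c2 : 0 < c ^ 2 by exact: pow_lt.
  pose b1 := Rpower (/ Bd) (2 * (dp - d0)); pose b2 := Rpower (/ Bd) (2 * (dp + d0)).
  have b10 : 0 < b1 by exact: Rpower_pos.
  have b20 : 0 < b2 by exact: Rpower_pos.
  have iT := Rinv_0_lt_compat _ T0.
  have ic2 := Rinv_0_lt_compat _ c2.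
  pose kA1 := (8 * / c ^ 2 + 2) * K1 * b1 * Lam ^ 2 + 1.
  pose kA2 := 2 * K1 * b2 * (c ^ 2 + 1) + 1.
  have kA10 : 1 <= kA1.
    have : 0 <= (8 * / c ^ 2 + 2) * K1 * b1 * Lam ^ 2; last by rewrite /kA1; lra.
    apply: Rmult_le_pos; last exact: pow2_ge_0.
    apply: Rmult_le_pos; last lra.
    by apply: Rmult_le_pos; lra.
  have kA20 : 1 <= kA2.
    have : 0 <= 2 * K1 * b2 * (c ^ 2 + 1); last by rewrite /kA2; lra.
    apply: Rmult_le_pos; last lra.
    apply: Rmult_le_pos; lra.
  pose KB1 := c0 * (Bd * T + 1) * K2 * cp.
  pose KB2 := K2 * (/ T + 1) * cp * c0.
  have KB10 : 0 < KB1.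
    have : 0 < Bd * T by apply: Rmult_lt_0_compat; lra.
    move=> h; apply: Rmult_lt_0_compat => //; apply: Rmult_lt_0_compat; last lra.
    by apply: Rmult_lt_0_compat; lra.
  have KB20 : 0 < KB2.
    apply: Rmult_lt_0_compat => //; apply: Rmult_lt_0_compat => //.
    by apply: Rmult_lt_0_compat; lra.
  have k1K : 0 < kA1 * K2 by apply: Rmult_lt_0_compat; lra.
  have k2K : 0 < K2 * kA2 by apply: Rmult_lt_0_compat; lra.
  exists (KB1 + KB2 + kA1 * K2 + K2 * kA2); split; first lra.
  move=> xi u v Hsol t0 U br F.
  have [J1 [JB1 JB2]] := HJ E xi hl.
  move: J1 JB1 JB2 @t0 @U; rewrite -/l -/br; set J := dbracket E xi => J1 JB1 JB2 t0 U.
  have br1 : 1 <= br by exact: bracket_ge1.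
  pose X := vnorm xi.
  have X0 : 0 <= X by exact: vnorm_ge0.
  have brX : br ^ 2 = 1 + X ^ 2 by exact: bracket_sqr.
  have Xbr : X <= br by apply: Rsqr_incr_0_var; [rewrite !Rsqr_pow2; lra|lra].
  pose tL := Rpower (Lam / br) (/ (l + 1)).
  have Lb0 : 0 < Lam / br by apply: Rdiv_lt_0_compat; lra.
  have tL0 : 0 < tL by exact: Rpower_pos.
  have tLP : Rpower tL (l + 1) = Lam / br by rewrite /tL Rpower_mult Rinv_l ?Rpower_1 //; lra.
  have t00 : 0 < t0.
    have := Rmin_glb_lt _ _ _ T0 (Rdiv_lt_0_compat _ _ rho00 (Rlt_le_trans _ _ _ Rlt_0_1 J1)); rewrite /t0 -/T; lra.
  have Jt0 : J * t0 <= 1 / 2.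
    have := Rmult_le_compat_l J _ _ ltac:(lra) (Rmin_r T (rho0 / J)).
    have -> : J * (rho0 / J) = rho0 by field; lra.
    rewrite /t0 -/T; lra.
  have Jt0' : mn <= 2 * (J * t0).
    have -> : 2 * (J * t0) = J * Rmin T (rho0 / J) by rewrite /t0 -/T; field.
    rewrite /mn /Rmin; case: (Rle_dec T (rho0 / J)) => h; case: (Rle_dec T rho0) => h' /=; try nra.
    - have -> : J * (rho0 / J) = rho0 by field; lra.
      lra.
    - have -> : J * (rho0 / J) = rho0 by field; lra.
      lra.
  have t0T : t0 <= T by have := Rmin_l T (rho0 / J); rewrite /t0 -/T; move: t00; rewrite /t0 -/T; lra.
  have root_mono (x y : R) : 0 < x -> x <= y -> Rpower x (/ (l + 1)) <= Rpower y (/ (l + 1)).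
    by move=> x0 xy; apply: Rle_Rpower_l; lra.
  have rootP (x : R) : 0 < x -> Rpower (Rpower x (l + 1)) (/ (l + 1)) = x.
    by move=> x0; rewrite Rpower_mult Rinv_r ?Rpower_1 //; lra.
  have t0L : t0 <= tL.
    rewrite -(rootP t0 t00); apply: root_mono; first exact: Rpower_pos.
    have h : Rpower t0 (l + 1) * Rpower J (l + 1) <= 1.
      rewrite Rpower_mult_distr; [|lra|lra].
      rewrite -[X in _ <= X](Rpower_O (t0 * J)); last by apply: Rmult_lt_0_compat; lra.
      apply: Rpower_le_1_antitone; last lra.
      by split; [apply: Rmult_lt_0_compat; lra|lra].
    apply: (Rmult_le_reg_r br); first lra.
    have -> : Lam / br * br = Lam by field; lra.
    have := Rmult_le_compat_l _ _ _ (Rlt_le _ _ (Rpower_pos t0 (l + 1))) JB2.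
    have := Rmult_le_compat_l kd _ _ ltac:(lra) h; rewrite /Lam; lra.
  pose t2 := Rmin T tL.
  have t20 : 0 < t2 by exact: Rmin_glb_lt.
  have t2T : t2 <= T by exact: Rmin_l.
  have t2L : t2 <= tL by exact: Rmin_r.
  have t02 : t0 <= t2 by exact: Rmin_glb.
  have t2k : t2 <= kap * t0.
    apply: Rle_trans t2L _.
    have e1 : tL * J <= Lr.
      have e : tL * Rpower br (/ (l + 1)) = Lr.
        rewrite /tL Rpower_mult_distr //; last lra.
        by rewrite /Lr; congr Rpower; field; lra.
      rewrite -e; apply: Rmult_le_compat_l; first lra.
      rewrite -(rootP J); last lra.
      by apply: root_mono => //; exact: Rpower_pos.
    have e2 : tL * mn <= 2 * Lr * t0.
      have := Rmult_le_compat_l _ _ _ (Rlt_le _ _ tL0) Jt0'.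
      have := Rmult_le_compat_r _ _ _ (Rlt_le _ _ t00) e1; lra.
    apply: (Rmult_le_reg_r mn) => //; rewrite /kap.
    have -> : (2 * Lr / mn + 1) * t0 * mn = 2 * Lr * t0 + t0 * mn by field; lra.
    have : 0 < t0 * mn by exact: Rmult_lt_0_compat.
    lra.
  have XL : X * Rpower t2 (l + 1) <= Lam.
    have -> : Lam = br * (Lam / br) by field; lra.
    apply: Rmult_le_compat => //; first exact/Rlt_le/Rpower_pos.
    rewrite -tLP; apply: Rle_Rpower_l; lra.
  have [[da [a1 [a2 _]]] [[db [bb1 [bb2 _]]] [cc1 [cc2 _]]]] := HM (dir xi) (dir_le1 xi).
  have [Hd Hc] := Hsol.
  have Rb (f : R -> R) t : Rabs (f 0) <= M -> Rabs (f t - f 0) <= M * Rpower t be -> 0 < t <= T -> Rabs (f t) <= M1.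
    move=> k1 k2 Ht; have -> : f t = f 0 + (f t - f 0) by ring.
    by apply: Rle_trans (Rabs_plus_le _ _ _ _ k1 k2) _; exact: MT.
  have Cb (f : R -> C) t : Cmod (f 0) <= M -> Cmod (f t - f 0%R)%C <= M * Rpower t be -> 0 < t <= T -> Cmod (f t) <= M1.
    move=> k1 k2 Ht; have -> : f t = (f 0%R + (f t - f 0%R))%C by ring.
    by apply: Rle_trans (Cmod_triangle _ _) _; have := MT t Ht; lra.
  pose Ut t := Cmod (u t) / t + Cmod (v t).
  have [u1 u2] : Ut t2 <= K2 * Ut t0 /\ Ut t0 <= K2 * Ut t2.
    apply: (HK2 X t0 t2 (fun t => fra E t (dir xi)) (fun t => frb E t (dir xi)) (fun t => frc E t (dir xi)) (wg E) (wh E) u v X0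
      (conj t00 t02) t2k XL).
    - move=> t Ht; have Ht' : 0 < t <= T by lra.
      split; first by apply: (Rb (fun t => fra E t (dir xi))) => //; exact: a2.
      split; first by apply: (Rb (fun t => frb E t (dir xi))) => //; exact: bb2.
      split; first by apply: (Cb (fun t => frc E t (dir xi))) => //; exact: cc2.
      split; first by apply: (Cb (wg E)) => //; exact: g2.
      split; first by apply: (Cb (wh E)) => //; exact: h2.
      by apply: Hd; rewrite -/T; lra.
    - by move=> t Ht; apply: Hc; rewrite -/T; lra.
  rewrite -/T in F *.
  have uT0 := Cmod_ge_0 (u T); have vT0 := Cmod_ge_0 (v T).
  have buT : 0 <= br * Cmod (u T) by apply: Rmult_le_pos; lra.
  have F0 : 0 <= F by rewrite /F; lra.
  have UP t : 0 < t -> 0 <= Ut t.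
    move=> Ht; apply: Rplus_le_le_0_compat; last exact: Cmod_ge_0.
    by apply: Rmult_le_pos; [exact: Cmod_ge_0|exact/Rlt_le/Rinv_0_lt_compat].
  have U0 := UP t0 t00.
  pose P0 := Rpower br d0; pose Pp := Rpower br dp.
  have P00 : 0 < P0 by exact: Rpower_pos.
  have Pp0 : 0 < Pp by exact: Rpower_pos.
  have PU : 0 <= Pp * U by apply: Rmult_le_pos => //; lra.
  have PF : 0 <= Pp * (P0 * F) by apply: Rmult_le_pos; [lra|apply: Rmult_le_pos; lra].
  rewrite -/dp -/d0 -/P0 -/Pp.
  have weak (x y k k' : R) : 0 <= y -> k <= k' -> x <= k * y -> x <= k' * y.
    by move=> y0 kk h; apply: Rle_trans h _; exact: Rmult_le_compat_r.
  case: (Rle_dec T tL) => hT.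
  - (* Bounded frequencies: every weight is bounded above and below. *)
    have t2E : t2 = T by rewrite /t2 Rmin_left.
    rewrite t2E in u1 u2.
    have brB : br <= Bd.
      have : TP <= Lam / br by rewrite -tLP; apply: Rle_Rpower_l; lra.
      move=> h; apply: (Rmult_le_reg_r TP) => //.
      have -> : Bd * TP = Lam by rewrite /Bd; field; lra.
      have := Rmult_le_compat_l br _ _ ltac:(lra) h.
      have -> : br * (Lam / br) = Lam by field; lra.
      by [].
    have [q1 q2] := Rpower_bounded_base Bd br d0 (conj br1 brB).
    have [q3 q4] := Rpower_bounded_base Bd br dp (conj br1 brB).
    rewrite -/P0 -/c0 in q1 q2; rewrite -/Pp -/cp in q3 q4.
    have UT0 := UP T T0.
    have FU : F <= (Bd * T + 1) * Ut T.
      have e : Cmod (u T) = T * (Cmod (u T) / T) by field; lra.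
      have h : 0 <= Cmod (u T) / T by apply: Rmult_le_pos; lra.
      have b0T : 0 <= Bd * T by apply: Rmult_le_pos; lra.
      have k1 := Rmult_le_compat_r _ _ _ uT0 brB.
      have k3 : Bd * Cmod (u T) = Bd * T * (Cmod (u T) / T) by rewrite {1}e; ring.
      have := Rmult_le_pos _ _ b0T vT0; rewrite /F /Ut; lra.
    have UF : Ut T <= (/ T + 1) * F.
      have k1 := Rmult_le_compat_r _ _ _ uT0 br1.
      have k3 := Rmult_le_compat_l _ _ _ (Rlt_le _ _ iT) k1.
      have := Rmult_le_pos _ _ (Rlt_le _ _ iT) vT0; rewrite /F /Ut /Rdiv; lra.
    have b0T : 0 <= Bd * T by apply: Rmult_le_pos; lra.
    split.
    + apply: (weak _ _ KB1) => //; first lra.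
      have s1 := Rmult_le_compat_r _ _ _ F0 q1.
      have s2 := Rmult_le_compat_l _ _ _ (Rlt_le _ _ c00) FU.
      have s3 := Rmult_le_compat_l (c0 * (Bd * T + 1)) _ _ ltac:(apply: Rmult_le_pos; lra) u1.
      have s4 : 0 <= c0 * (Bd * T + 1) * K2 * Ut t0.
        by apply: Rmult_le_pos => //; apply: Rmult_le_pos; [apply: Rmult_le_pos; lra|lra].
      have s5 := Rmult_le_compat_l _ _ _ s4 q4.
      rewrite /KB1 -/(Ut t0) in s5 *; rewrite /U -/(Ut t0); lra.
    + apply: (weak _ _ KB2) => //; first lra.
      have s1 := Rmult_le_compat_l K2 _ _ ltac:(lra) UF.
      have s2 : 0 <= K2 * (/ T + 1) * F.
        by apply: Rmult_le_pos => //; apply: Rmult_le_pos; lra.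
      have s3 := Rmult_le_compat_l _ _ _ s2 q2.
      have s4 : 0 <= K2 * (/ T + 1) * F * (c0 * P0) by apply: Rmult_le_pos => //; apply: Rmult_le_pos; lra.
      have s5 := Rmult_le_compat_l _ _ _ s4 q4.
      rewrite /KB2 /U -/(Ut t0); lra.
  - have t2E : t2 = tL by rewrite /t2 Rmin_right //; lra.
    have bX : br / 2 <= X.
      have : Bd < br.
        apply: Rnot_le_lt => h; apply: hT.
        rewrite -(rootP T T0) -/TP; apply: root_mono => //.
        apply: (Rmult_le_reg_r br); first lra.
        have -> : Lam / br * br = Bd * TP by rewrite /Bd; field; lra.
        rewrite Rmult_comm; apply: Rmult_le_compat_r; lra.
      move=> h; apply: Rsqr_incr_0_var => //; rewrite !Rsqr_pow2.
      have : 2 ^ 2 <= br ^ 2 by apply: pow_incr; lra.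
      have -> : (br / 2) ^ 2 = br ^ 2 / 4 by field.
      lra.
    have Xp : 0 < X by lra.
    have XL2 : Lam / 2 <= X * Rpower t2 (l + 1).
      rewrite t2E tLP.
      have -> : Lam / 2 = br / 2 * (Lam / br) by field; lra.
      by apply: Rmult_le_compat_r; lra.
    have [n1 n2] := HK1 xi u v t2 Xp (conj t20 t2T) ltac:(rewrite -/X; have := Rle_abs Lam0; move: XL2; rewrite /Lam; lra) Hsol.
    pose N t := (X * Rpower t l) ^ 2 * Cmod (u t) ^ 2 + Cmod (v t) ^ 2.
    have ET : Rpower (T / t2) = Rpower (Rpower (br / Bd) (/ (l + 1))).
      congr Rpower; rewrite t2E -{1}(rootP T T0) -/TP.
      have bb : 0 < br / Bd by apply: Rdiv_lt_0_compat; lra.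
      have -> : TP = Lam / br * (br / Bd) by rewrite /Bd; field; lra.
      rewrite -Rpower_mult_distr // /tL; field.
      by have := Rpower_pos (Lam / br) (/ (l + 1)); lra.
    have EP (e : R) : Rpower (T / t2) (2 * (l + 1) * e) = Rpower (/ Bd) (2 * e) * Rpower br e ^ 2.
      rewrite ET Rpower_mult.
      have -> : / (l + 1) * (2 * (l + 1) * e) = 2 * e by field; lra.
      have -> : br / Bd = / Bd * br by rewrite /Rdiv; ring.
      rewrite -Rpower_mult_distr; [|by apply: Rinv_0_lt_compat; lra|lra].
      by rewrite /= Rmult_1_r -Rpower_plus; congr (_ * Rpower _ _); ring.
    have e1 : l - Re (wg E 0) + 2 * (l + 1) * delta_plus E = 2 * (l + 1) * (dp - d0).
      rewrite /dp /d0 /delta_zero -/l; field; lra.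
    have e2 : - (l - Re (wg E 0)) + 2 * (l + 1) * delta_plus E = 2 * (l + 1) * (dp + d0).
      rewrite /dp /d0 /delta_zero -/l; field; lra.
    rewrite e1 EP -/b1 -/(N T) -/(N t2) in n1; rewrite e2 EP -/b2 -/(N T) -/(N t2) in n2.
    have U2p := UP t2 t20.
    have phase : X * Rpower t2 l = X * Rpower t2 (l + 1) * / t2.
      by rewrite Rpower_plus Rpower_1 //; field; lra.
    have it2 := Rinv_0_lt_compat _ t20.
    have u20 := Cmod_ge_0 (u t2); have v20 := Cmod_ge_0 (v t2).
    have ut : 0 <= Cmod (u t2) / t2 by apply: Rmult_le_pos; lra.
    have EN2 : N t2 = (X * Rpower t2 (l + 1)) ^ 2 * (Cmod (u t2) / t2) ^ 2 + Cmod (v t2) ^ 2.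
      by rewrite /N phase; field; lra.
    have sv := pow2_ge_0 (Cmod (v t2)); have su := pow2_ge_0 (Cmod (u t2) / t2).
    have NU : N t2 <= Lam ^ 2 * Ut t2 ^ 2.
      have k1 : (X * Rpower t2 (l + 1)) ^ 2 <= Lam ^ 2 by apply: pow_incr; lra.
      have L1 : 1 <= Lam ^ 2 by apply: pow_R1_Rle; lra.
      have k3 := Rmult_le_compat_r _ _ _ su k1; have k4 := Rmult_le_compat_r _ _ _ sv L1.
      have k5 := Rmult_le_pos _ _ ut v20.
      have k6 : 0 <= Lam ^ 2 * (Cmod (u t2) / t2 * Cmod (v t2)) by apply: Rmult_le_pos => //; lra.
      rewrite EN2 /Ut; lra.
    have UN : Ut t2 ^ 2 <= 2 * N t2.
      have k1 : 1 <= (X * Rpower t2 (l + 1)) ^ 2 by apply: pow_R1_Rle; lra.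
      have k3 := Rmult_le_compat_r _ _ _ su k1.
      have k4 := pow2_ge_0 (Cmod (u t2) / t2 - Cmod (v t2)).
      rewrite EN2 /Ut; lra.
    have suT := pow2_ge_0 (Cmod (u T)); have svT := pow2_ge_0 (Cmod (v T)).
    have ENT : N T = c ^ 2 * (X ^ 2 * Cmod (u T) ^ 2) + Cmod (v T) ^ 2 by rewrite /N -/c; ring.
    have Xb2 : X ^ 2 <= br ^ 2 by lra.
    have Xb4 : br ^ 2 <= 4 * X ^ 2.
      have := pow_incr (br / 2) X 2 ltac:(lra); have -> : (br / 2) ^ 2 = br ^ 2 / 4 by field.
      lra.
    have NF : N T <= (c ^ 2 + 1) * F ^ 2.
      have k1 := Rmult_le_compat_r _ _ _ suT Xb2.
      have k3 := Rmult_le_compat_l _ _ _ (Rlt_le _ _ c2) k1.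
      have k4 : br ^ 2 * Cmod (u T) ^ 2 <= F ^ 2.
        by rewrite -Rpow_mult_distr; apply: pow_incr; rewrite /F; lra.
      have k5 : Cmod (v T) ^ 2 <= F ^ 2 by apply: pow_incr; rewrite /F; lra.
      have k6 := Rmult_le_compat_l _ _ _ (Rlt_le _ _ c2) k4.
      rewrite ENT; lra.
    have FN : F ^ 2 <= (8 * / c ^ 2 + 2) * N T.
      have k1 := Rmult_le_compat_r _ _ _ suT Xb4.
      have k3 : F ^ 2 <= 2 * (br ^ 2 * Cmod (u T) ^ 2) + 2 * Cmod (v T) ^ 2.
        by have := pow2_ge_0 (br * Cmod (u T) - Cmod (v T)); rewrite /F; lra.
      have k4 : X ^ 2 * Cmod (u T) ^ 2 = / c ^ 2 * (c ^ 2 * (X ^ 2 * Cmod (u T) ^ 2)) by field; lra.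
      have k5 : 0 <= c ^ 2 * (X ^ 2 * Cmod (u T) ^ 2).
        by apply: Rmult_le_pos; [lra|apply: Rmult_le_pos => //; exact: pow2_ge_0].
      have k6 := Rmult_le_pos _ _ (Rlt_le _ _ ic2) svT.
      rewrite ENT; lra.
    have NT0 : 0 <= N T.
      by rewrite ENT; apply: Rplus_le_le_0_compat => //; apply: Rmult_le_pos; [lra|apply: Rmult_le_pos => //; exact: pow2_ge_0].
    have R1 := Rpower_pos br (dp - d0); have R2 := Rpower_pos br (dp + d0).
    have s1 : F <= kA1 * (Rpower br (dp - d0) * Ut t2).
      apply: sqr_le_linear => //; first by apply: Rmult_le_pos; lra.
      have h8 : 0 <= 8 * / c ^ 2 + 2 by lra.
      have k1 := Rmult_le_compat_l _ _ _ h8 n1.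
      have kr : 0 <= (8 * / c ^ 2 + 2) * (K1 * (b1 * Rpower br (dp - d0) ^ 2)).
        apply: Rmult_le_pos => //; apply: Rmult_le_pos; first lra.
        by apply: Rmult_le_pos; [lra|exact: pow2_ge_0].
      have k3 := Rmult_le_compat_l _ _ _ kr NU.
      have k4 := pow2_ge_0 (Rpower br (dp - d0) * Ut t2).
      rewrite Rpow_mult_distr in k4 *; rewrite /kA1; lra.
    have s2 : Ut t2 <= kA2 * (Rpower br (dp + d0) * F).
      apply: sqr_le_linear => //; first by apply: Rmult_le_pos; lra.
      have kr : 0 <= 2 * (K1 * (b2 * Rpower br (dp + d0) ^ 2)).
        apply: Rmult_le_pos; first lra.
        apply: Rmult_le_pos; first lra.
        by apply: Rmult_le_pos; [lra|exact: pow2_ge_0].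
      have k3 := Rmult_le_compat_l _ _ _ kr NF.
      have k4 := pow2_ge_0 (Rpower br (dp + d0) * F).
      rewrite Rpow_mult_distr in k4 *; rewrite /kA2; lra.
    have EPm : P0 * Rpower br (dp - d0) = Pp.
      by rewrite /P0 /Pp -Rpower_plus; congr Rpower; ring.
    have EPp : Rpower br (dp + d0) = Pp * P0 by rewrite /P0 /Pp -Rpower_plus.
    split.
    + apply: (weak _ _ (kA1 * K2)) => //; first lra.
      have k1 := Rmult_le_compat_l _ _ _ (Rlt_le _ _ P00) s1.
      have k3 : P0 * (kA1 * (Rpower br (dp - d0) * Ut t2)) = kA1 * Pp * Ut t2 by rewrite -EPm; ring.
      have k4 := Rmult_le_compat_l (kA1 * Pp) _ _ ltac:(apply: Rmult_le_pos; lra) u1.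
      rewrite /U -/(Ut t0); lra.
    + apply: (weak _ _ (K2 * kA2)) => //; first lra.
      have k1 := Rmult_le_compat_l K2 _ _ ltac:(lra) s2.
      rewrite EPp in k1; rewrite /U -/(Ut t0); lra.
Qed.

(** * Asymptotic data and scattering *)

Lemma Rpower_comparable (k x y p : R) : 1 <= k -> 0 < x -> x <= y -> y <= k * x ->
  Rpower y p <= Rpower k (Rabs p) * Rpower x p /\ Rpower x p <= Rpower k (Rabs p) * Rpower y p.
Proof.
  move=> k1 x0 xy ykx.
  have q : 1 <= y / x <= k.
    have E : y / x * x = y by field; lra.
    by split; apply: (Rmult_le_reg_r x) => //; lra.
  have [h1 h2] := Rpower_bounded_base k (y / x) p q.
  have E : Rpower y p = Rpower (y / x) p * Rpower x p.
    rewrite Rpower_mult_distr //; last lra.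
    by congr Rpower; field; lra.
  have rx := Rpower_pos x p.
  rewrite E; split; first by apply: Rmult_le_compat_r; lra.
  have := Rmult_le_compat_r _ _ _ (Rlt_le _ _ rx) h2; lra.
Qed.

(** The two estimates meet at the same time [t0]; what remains is to write the
    weights [dbracket^(Re e)] as the powers [gamma_plus] and [gamma_minus] of the
    bracket of the norm. *)
Lemma two_sided_estimate (d : nat) (E : wave_data d) (gamma : C) (rho1 : R)
    (D N Rem : nat -> R -> vec d -> mat2) (mP : nat) :
  (1 <= d)%nat -> admissible E -> 0 < rho1 < 1 ->
  diagonalization E gamma rho1 D N Rem -> (1 <= mP)%nat ->
  Rabs (Re gamma) <= INR mP * (aP E + 1) ->
  exists rhos, 0 < rhos <= rho1 /\ forall rho0, 0 < rho0 <= rhos ->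
  exists K, 0 < K /\ forall (xi : vec d) (u v : R -> C),
    is_classical_solution (wT E) (wave_damping E xi) (wave_stiffness E xi) u v ->
    let vp t := varphi_plus E gamma N mP (fun s _ => u s) (fun s _ => v s) t xi in
    let vm t := varphi_minus E gamma N mP (fun s _ => u s) (fun s _ => v s) t xi in
    exists l1 l2,
      tends_at_0 (fun t => vp t - RtoC (log_weight gamma * ln (zvar E t xi)) * vm t)%C l1 /\
      tends_at_0 vm l2 /\
      let A := asymptotic_size E gamma (fun _ => l1) (fun _ => l2) xi in
      let F := final_size E (fun s _ => u s) (fun s _ => v s) xi in
      A <= K * (Rpower (bracket (vnorm xi)) (delta_plus E) * F) /\
      F <= K * (Rpower (bracket (vnorm xi)) (delta_plus E) * A).
Proof.
  move=> hd HE [r10 r11] Hdiag hm hmg.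
  have [T0 [hl [be0 _]]] := HE.
  have [rhos [[rs0 rs1] Hz]] := zone_estimate d E gamma rho1 D N Rem mP hd T0 hl be0 (conj r10 r11) Hdiag hm hmg.
  exists rhos; split => // rho0 [rho00 rho0s].
  have [Kz [Kz0 HKz]] := Hz rho0 (conj rho00 rho0s).
  have [Ko [Ko0 HKo]] := outer_estimate E rho0 hd HE ltac:(lra).
  have [kd [kd1 HJ]] := dbracket_comparison d hd.
  pose gp := gamma_plus E gamma; pose gm := gamma_minus E gamma.
  pose k := Rpower kd (Rabs gp) + Rpower kd (Rabs gm).
  have kp := Rpower_pos kd (Rabs gp); have km := Rpower_pos kd (Rabs gm).
  have k0 : 0 < k by rewrite /k; lra.
  have KK : 0 < k * Kz * Ko by apply: Rmult_lt_0_compat => //; exact: Rmult_lt_0_compat.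
  exists (k * Kz * Ko); split => // xi u v Hsol vp vm.
  have [l1 [l2 [Hl1 [Hl2 [z1 z2]]]]] := HKz xi u v Hsol.
  exists l1, l2; split => //; split => // A F.
  have [o1 o2] := HKo xi u v Hsol.
  move: z1 z2 o1 o2; set U := (Cmod (u _) / _ + _).
  set S := (Rpower _ _ * _ + _); set br := bracket (vnorm xi) in A F *.
  set F' := (br * _ + _).
  move=> z1 z2 o1 o2.
  have [J1 [JB1 JB2]] := HJ E xi hl; rewrite -/br in JB1 JB2.
  set J := dbracket E xi in J1 JB1 JB2 S z1 z2 *.
  have EF : F = Rpower br (delta_zero E) * F'.
    rewrite /F /final_size -/br Rpower_plus Rpower_1 /F'; last by have := bracket_ge1 (vnorm xi); rewrite -/br; lra.
    ring.
  have Eplus : Re (exponent_plus E gamma) = (wl E + 1) * gp.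
    rewrite /gp /gamma_plus /exponent_plus Re_div_RtoC; last lra.
    rewrite /=; field; lra.
  have Eminus : Re (exponent_minus E gamma) = (wl E + 1) * gm.
    rewrite /gm /gamma_minus /exponent_minus Re_div_RtoC; last lra.
    rewrite /=; field; lra.
  pose x := Rpower J (wl E + 1).
  have x0 : 0 < x by exact: Rpower_pos.
  have [p1 p2] := Rpower_comparable kd x br gp kd1 x0 JB1 JB2.
  have [p3 p4] := Rpower_comparable kd x br gm kd1 x0 JB1 JB2.
  have ES : S = Rpower x gp * Cmod l1 + Rpower x gm * Cmod l2.
    by rewrite /S Eplus Eminus -!Rpower_mult.
  have EA : A = Rpower br gp * Cmod l1 + Rpower br gm * Cmod l2 by [].
  have c1 := Cmod_ge_0 l1; have c2 := Cmod_ge_0 l2.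
  have rx1 := Rpower_pos x gp; have rx2 := Rpower_pos x gm.
  have rb1 := Rpower_pos br gp; have rb2 := Rpower_pos br gm.
  have mix (a b a' b' : R) : 0 < a' -> 0 < b' -> a <= Rpower kd (Rabs gp) * a' -> b <= Rpower kd (Rabs gm) * b' ->
     a * Cmod l1 + b * Cmod l2 <= k * (a' * Cmod l1 + b' * Cmod l2).
    move=> a0 b0 h1 h2.
    have := Rmult_le_compat_r _ _ _ c1 h1; have := Rmult_le_compat_r _ _ _ c2 h2.
    have := Rmult_le_pos _ _ (Rlt_le _ _ km) (Rmult_le_pos _ _ (Rlt_le _ _ a0) c1).
    have := Rmult_le_pos _ _ (Rlt_le _ _ kp) (Rmult_le_pos _ _ (Rlt_le _ _ b0) c2); rewrite /k; lra.
  have AS : A <= k * S by rewrite EA ES; exact: mix.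
  have SA : S <= k * A by rewrite EA ES; exact: mix.
  rewrite EF; split.
  - have h1 := Rmult_le_compat_l _ _ _ (Rlt_le _ _ k0) z1.
    have h2 := Rmult_le_compat_l (k * Kz) _ _ ltac:(apply: Rmult_le_pos; lra) o2; lra.
  - have rp := Rpower_pos br (delta_plus E).
    have h1 := Rmult_le_compat_l (Ko * Rpower br (delta_plus E)) _ _ ltac:(apply: Rmult_le_pos; lra) z2.
    have h2 := Rmult_le_compat_l (Ko * Rpower br (delta_plus E) * Kz) _ _
      ltac:(apply: Rmult_le_pos; [apply: Rmult_le_pos; lra|lra]) SA; lra.
Qed.

Lemma varphi_local {d} (E : wave_data d) gamma N mP (phi dphi phi' dphi' : R -> vec d -> C) t xi :
  phi t xi = phi' t xi -> dphi t xi = dphi' t xi ->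
  varphi_plus E gamma N mP phi dphi t xi = varphi_plus E gamma N mP phi' dphi' t xi /\
  varphi_minus E gamma N mP phi dphi t xi = varphi_minus E gamma N mP phi' dphi' t xi.
Proof. by move=> h1 h2; rewrite /varphi_plus /varphi_minus /varphi h1 h2. Qed.

Lemma tends_at_0_is_lim_ZP {d} (E : wave_data d) (rho : R) (f : R -> vec d -> C) (xi : vec d) (l : C) :
  0 < wT E -> 0 < rho -> 0 < dbracket E xi ->
  tends_at_0 (fun t => f t xi) l <-> is_lim_ZP E rho f xi l.
Proof.
  move=> T0 r0 J0; split.
  - move=> H P [e He].
    have [dl [dl0 Hd]] := H e (cond_pos e).
    exists (mkposreal _ dl0) => t /ball_Rabs /Rabs_lt_between /= h1 h2 _.
    have h := Hd t ltac:(lra).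
    apply: He; split; apply/ball_Rabs.
      by apply: Rle_lt_trans h; have := Rabs_Re_le (f t xi - l)%C; case: (f t xi) => a b; case: (l).
    by apply: Rle_lt_trans h; have := Rabs_Im_le (f t xi - l)%C; case: (f t xi) => a b; case: (l).
  - move=> H e e0.
    have e2 : 0 < e / 2 by lra.
    have [dl Hdl] := H (fun z => Cmod (z - l)%C < e) ltac:(exists (mkposreal _ e2) => z [/ball_Rabs z1 /ball_Rabs z2];
      apply: Rle_lt_trans (Cmod_le_Rabs _) _; move: z1 z2; case: (z) => a b; case: (l) => a' b' /=; rewrite /Rminus; lra).
    have J1 : 0 < rho / dbracket E xi by exact: Rdiv_lt_0_compat.
    exists (Rmin dl (Rmin (wT E) (rho / dbracket E xi))); split.
      by apply: Rmin_glb_lt; [exact: cond_pos|exact: Rmin_glb_lt].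
    move=> t [t0 t1].
    have m1 := Rmin_l dl (Rmin (wT E) (rho / dbracket E xi)); have m2 := Rmin_r dl (Rmin (wT E) (rho / dbracket E xi)).
    have m3 := Rmin_l (wT E) (rho / dbracket E xi); have m4 := Rmin_r (wT E) (rho / dbracket E xi).
    apply: Hdl => //; first by apply/ball_Rabs; apply/Rabs_lt_between; lra.
    split; first lra.
    rewrite /zvar; have := Rmult_le_compat_l (dbracket E xi) t (rho / dbracket E xi) ltac:(lra) ltac:(lra).
    have -> : dbracket E xi * (rho / dbracket E xi) = rho by field; lra.
    by [].
Qed.

Lemma has_asymptotic_data_iff {d} (E : wave_data d) gamma rho N mP (a b : vec d -> C) (phi dphi : R -> vec d -> C) :
  0 < wT E -> 0 < rho -> (forall xi, 0 < dbracket E xi) ->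
  has_asymptotic_data E gamma rho N mP a b phi dphi <->
  forall xi, tends_at_0 (fun t => varphi_plus E gamma N mP phi dphi t xi
      - RtoC (log_weight gamma * ln (zvar E t xi)) * varphi_minus E gamma N mP phi dphi t xi)%C (a xi) /\
    tends_at_0 (fun t => varphi_minus E gamma N mP phi dphi t xi) (b xi).
Proof.
  move=> T0 r0 J0.
  have L f xi l := tends_at_0_is_lim_ZP E rho f xi l T0 r0 (J0 xi).
  split=> H xi.
  - have [H1 H2] := H xi; rewrite /log_weight; case: (Ceq_dec gamma 0) => h /=.
    + have [k1 k2] := H2 h; split; last exact/L.
      move/L: k1; apply: (tends_at_0_ext _ _ _ 1); first lra.
      by move=> t _; rewrite Rmult_1_l.
    + have [k1 k2] := H1 h; split; last exact/L.
      move/L: k1; apply: (tends_at_0_ext _ _ _ 1); first lra.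
      by move=> t _; rewrite Rmult_0_l; ring.
  - have [k1 k2] := H xi; move: k1; rewrite /log_weight; case: (Ceq_dec gamma 0) => h /= k1; split => // _.
    + split; last exact/L.
      apply/(L (fun t x => (varphi_plus E gamma N mP phi dphi t x - RtoC (ln (zvar E t x)) * varphi_minus E gamma N mP phi dphi t x)%C)).
      apply: (tends_at_0_ext _ _ _ 1) k1; first lra.
      by move=> t _; rewrite Rmult_1_l.
    + split; last exact/L.
      apply/L; apply: (tends_at_0_ext _ _ _ 1) k1; first lra.
      by move=> t _; rewrite Rmult_0_l; ring.
Qed.

Lemma solves_W_classical {d} (E : wave_data d) (phi dphi : R -> vec d -> C) (xi : vec d) :
  0 < wT E -> solves_W E phi dphi ->
  is_classical_solution (wT E) (wave_damping E xi) (wave_stiffness E xi)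
    (fun t => phi (Rmin t (wT E)) xi) (fun t => dphi (Rmin t (wT E)) xi).
Proof.
  move=> T0 H; have [dd [H1 [H2 [_ H3]]]] := H xi; split.
  - move=> t Ht.
    have L : locally (T := R_UniformSpace) t (fun s => 0 < s <= wT E).
      by apply: (locally_open_interval t 0 (wT E)) => // s; lra.
    have cl (f : R -> C) l : is_Cderive f t l -> is_Cderive (fun s => f (Rmin s (wT E))) t l.
      by apply: (is_Cderive_ext_loc _ _ t l 0 (wT E) Ht) => s Hs; rewrite Rmin_left //; lra.
    have D1 := is_deriv_on_is_Cderive _ _ _ t H1 ltac:(lra) L.
    have D2 := is_deriv_on_is_Cderive _ _ _ t H2 ltac:(lra) L.
    rewrite Rmin_left; last lra.
    split; first exact: cl D1.
    apply: is_Cderive_eq; first exact: cl D2.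
    apply: Cminus_0_eq; rewrite -(H3 t ltac:(lra)) /wave_stiffness /wave_damping /stiffness /damping; ring.
  - move=> t Ht; split.
      exact: is_deriv_on_Ccont_clamp T0 H1 (proj1 Ht).
    exact: is_deriv_on_Ccont_clamp T0 H2 (proj1 Ht).
Qed.

Lemma classical_solution_lin (T : R) (p q u1 v1 u2 v2 : R -> C) (c c' : C) :
  is_classical_solution T p q u1 v1 -> is_classical_solution T p q u2 v2 ->
  is_classical_solution T p q (fun t => c * u1 t + c' * u2 t)%C (fun t => c * v1 t + c' * v2 t)%C.
Proof.
  move=> [H1 H2] [H3 H4]; split => t Ht.
  - have [a1 a2] := H1 t Ht; have [b1 b2] := H3 t Ht.
    split; first exact: is_Cderive_lin.
    apply: is_Cderive_eq; first (apply: is_Cderive_lin; [exact: a2|exact: b2]).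
    ring.
  - have [a1 a2] := H2 t Ht; have [b1 b2] := H4 t Ht.
    by split; apply: Ccont_plus; apply: Ccont_mult => //; exact: Ccont_const.
Qed.

Lemma solves_W_of_strong {d} (E : wave_data d) (phi dphi : R -> vec d -> C) : admissible E ->
  (forall xi t, 0 < t <= wT E -> is_Cderive (fun s => phi s xi) t (dphi t xi) /\
    is_Cderive (fun s => dphi s xi) t (- (wave_stiffness E xi t * phi t xi) - wave_damping E xi t * dphi t xi)%C) ->
  solves_W E phi dphi.
Proof.
  move=> HE H xi; have [T0 _] := HE.
  pose dd t := (- (wave_stiffness E xi t * phi t xi) - wave_damping E xi t * dphi t xi)%C.
  exists dd; split; first by apply: is_Cderive_is_deriv_on => t Ht; have [] := H xi t Ht.
  split; first by apply: is_Cderive_is_deriv_on => t Ht; have [] := H xi t Ht.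
  split; last first.
    move=> t Ht; rewrite /dd /wave_stiffness /wave_damping /stiffness /damping; ring.
  move=> t Ht.
  have cdd : Ccont (fun s => dd (Rmin s (wT E))) t.
    have [c1 c2] := wave_coefficients_Ccont E xi t HE (proj1 Ht).
    have tm : Rmin t (wT E) = t by rewrite Rmin_left //; lra.
    have [h1 h2] := H xi t Ht.
    have c3 : Ccont (fun s => phi (Rmin s (wT E)) xi) t.
      by apply: (Ccont_comp (fun s => phi s xi)); [exact: continuity_pt_Rmin_r|rewrite tm; exact: is_Cderive_Ccont h1].
    have c4 : Ccont (fun s => dphi (Rmin s (wT E)) xi) t.
      by apply: (Ccont_comp (fun s => dphi s xi)); [exact: continuity_pt_Rmin_r|rewrite tm; exact: is_Cderive_Ccont h2].
    by apply: Ccont_plus; apply: Ccont_opp; apply: Ccont_mult.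
  have tm : Rmin t (wT E) = t by rewrite Rmin_left //; lra.
  case: cdd => /continuous_iff_continuity_pt k1 /continuous_iff_continuity_pt k2.
  move=> P [e He].
  have L1 : locally (T := R_UniformSpace) t (fun s => ball (Re (dd t)) e (Re (dd (Rmin s (wT E))))).
    by apply: k1; exists e => y Hy; rewrite tm in Hy.
  have L2 : locally (T := R_UniformSpace) t (fun s => ball (Im (dd t)) e (Im (dd (Rmin s (wT E))))).
    by apply: k2; exists e => y Hy; rewrite tm in Hy.
  have L3 : locally (T := R_UniformSpace) t (fun s => ball (Re (dd t)) e (Re (dd (Rmin s (wT E)))) /\
      ball (Im (dd t)) e (Im (dd (Rmin s (wT E))))) by apply: filter_and.
  rewrite /filtermap /within; move: L3; apply: filter_imp => s [b1 b2] Hs.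
  rewrite Rmin_left in b1 b2; try lra.
  by apply: He; split.
Qed.

Lemma varphi_lin {d} (E : wave_data d) gamma N mP (u1 v1 u2 v2 : R -> C) (c c' : C) t xi : 0 < t ->
  varphi_plus E gamma N mP (fun s _ => c * u1 s + c' * u2 s)%C (fun s _ => c * v1 s + c' * v2 s)%C t xi =
    (c * varphi_plus E gamma N mP (fun s _ => u1 s) (fun s _ => v1 s) t xi +
     c' * varphi_plus E gamma N mP (fun s _ => u2 s) (fun s _ => v2 s) t xi)%C /\
  varphi_minus E gamma N mP (fun s _ => c * u1 s + c' * u2 s)%C (fun s _ => c * v1 s + c' * v2 s)%C t xi =
    (c * varphi_minus E gamma N mP (fun s _ => u1 s) (fun s _ => v1 s) t xi +
     c' * varphi_minus E gamma N mP (fun s _ => u2 s) (fun s _ => v2 s) t xi)%C.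
Proof.
  move=> Ht.
  have [-> ->] := varphi_entries E gamma N mP (fun s _ => c * u1 s + c' * u2 s)%C (fun s _ => c * v1 s + c' * v2 s)%C t xi Ht.
  have [-> ->] := varphi_entries E gamma N mP (fun s _ => u1 s) (fun s _ => v1 s) t xi Ht.
  have [-> ->] := varphi_entries E gamma N mP (fun s _ => u2 s) (fun s _ => v2 s) t xi Ht.
  by split; ring.
Qed.

Definition asymptotic_limits {d} (E : wave_data d) gamma N mP (xi : vec d) (u v : R -> C) (a b : C) : Prop :=
  tends_at_0 (fun t => varphi_plus E gamma N mP (fun s _ => u s) (fun s _ => v s) t xi
    - RtoC (log_weight gamma * ln (zvar E t xi)) * varphi_minus E gamma N mP (fun s _ => u s) (fun s _ => v s) t xi)%C a /\
  tends_at_0 (fun t => varphi_minus E gamma N mP (fun s _ => u s) (fun s _ => v s) t xi) b.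

Lemma asymptotic_limits_lin {d} (E : wave_data d) gamma N mP xi u1 v1 u2 v2 a1 b1 a2 b2 (c c' : C) :
  asymptotic_limits E gamma N mP xi u1 v1 a1 b1 -> asymptotic_limits E gamma N mP xi u2 v2 a2 b2 ->
  asymptotic_limits E gamma N mP xi (fun t => c * u1 t + c' * u2 t)%C (fun t => c * v1 t + c' * v2 t)%C
    (c * a1 + c' * a2)%C (c * b1 + c' * b2)%C.
Proof.
  move=> [h1 h2] [h3 h4]; split.
  - apply: (tends_at_0_ext _ _ _ 1) (tends_at_0_lin _ _ _ _ c c' h1 h3); first lra.
    move=> t [Ht _]; have [-> ->] := varphi_lin E gamma N mP u1 v1 u2 v2 c c' t xi Ht; ring.
  - apply: (tends_at_0_ext _ _ _ 1) (tends_at_0_lin _ _ _ _ c c' h2 h4); first lra.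
    by move=> t [Ht _]; have [_ ->] := varphi_lin E gamma N mP u1 v1 u2 v2 c c' t xi Ht.
Qed.

(** Near 0 the clamping at [wT E] is invisible. *)
Lemma has_asymptotic_data_limits {d} (E : wave_data d) gamma rho N mP (a b : vec d -> C) (phi dphi : R -> vec d -> C) :
  0 < wT E -> 0 < rho -> (forall xi, 0 < dbracket E xi) ->
  has_asymptotic_data E gamma rho N mP a b phi dphi <->
  forall xi, asymptotic_limits E gamma N mP xi (fun t => phi (Rmin t (wT E)) xi) (fun t => dphi (Rmin t (wT E)) xi) (a xi) (b xi).
Proof.
  move=> T0 r0 J0; rewrite has_asymptotic_data_iff //.
  have loc t xi : 0 < t < wT E ->
     varphi_plus E gamma N mP phi dphi t xi =
       varphi_plus E gamma N mP (fun s _ => phi (Rmin s (wT E)) xi) (fun s _ => dphi (Rmin s (wT E)) xi) t xi /\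
     varphi_minus E gamma N mP phi dphi t xi =
       varphi_minus E gamma N mP (fun s _ => phi (Rmin s (wT E)) xi) (fun s _ => dphi (Rmin s (wT E)) xi) t xi.
    by move=> Ht; apply: varphi_local; rewrite Rmin_left //; lra.
  split=> H xi; have [h1 h2] := H xi; split.
  - apply: tends_at_0_ext T0 _ h1 => t Ht; have [e1 e2] := loc t xi Ht; by rewrite -e1 -e2.
  - apply: tends_at_0_ext T0 _ h2 => t Ht; have [e1 e2] := loc t xi Ht; by rewrite -e2.
  - apply: tends_at_0_ext T0 _ h1 => t Ht; have [e1 e2] := loc t xi Ht; by rewrite -e1 -e2.
  - apply: tends_at_0_ext T0 _ h2 => t Ht; have [e1 e2] := loc t xi Ht; by rewrite -e2.
Qed.

(** Here the derivatives at the end point [wT E] are included, as (W) requires. *)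
Definition is_strong_solution {d} (E : wave_data d) (xi : vec d) (u v : R -> C) : Prop :=
  forall t, 0 < t <= wT E -> is_Cderive u t (v t) /\
    is_Cderive v t (- (wave_stiffness E xi t * u t) - wave_damping E xi t * v t)%C.

Lemma strong_solution_exists {d} (E : wave_data d) (xi : vec d) (c0 c1 : C) : admissible E ->
  exists uv : (R -> C) * (R -> C), fst uv (wT E) = c0 /\ snd uv (wT E) = c1 /\ is_strong_solution E xi (fst uv) (snd uv).
Proof.
  move=> HE; have [T0 _] := HE.
  have [u [v [h1 [h2 h3]]]] := initial_value_problem (wT E) (wave_damping E xi) (wave_stiffness E xi) c0 c1 T0
    (fun t Ht => proj1 (wave_coefficients_Ccont E xi t HE Ht)) (fun t Ht => proj2 (wave_coefficients_Ccont E xi t HE Ht)).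
  by exists (u, v).
Qed.

Lemma strong_solution_classical {d} (E : wave_data d) (xi : vec d) (u v : R -> C) :
  is_strong_solution E xi u v -> is_classical_solution (wT E) (wave_damping E xi) (wave_stiffness E xi) u v.
Proof.
  move=> H; split => t Ht; first by apply: H; lra.
  by have [h1 h2] := H t Ht; split; [exact: is_Cderive_Ccont h1|exact: is_Cderive_Ccont h2].
Qed.

Lemma strong_solution_lin {d} (E : wave_data d) (xi : vec d) u1 v1 u2 v2 (c c' : C) :
  is_strong_solution E xi u1 v1 -> is_strong_solution E xi u2 v2 ->
  is_strong_solution E xi (fun t => c * u1 t + c' * u2 t)%C (fun t => c * v1 t + c' * v2 t)%C.
Proof.
  move=> H1 H2 t Ht; have [a1 a2] := H1 t Ht; have [b1 b2] := H2 t Ht.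
  split; first exact: is_Cderive_lin.
  apply: is_Cderive_eq; first (apply: is_Cderive_lin; [exact: a2|exact: b2]).
  ring.
Qed.

(** Used with the limits of two fundamental solutions: a nonzero solution with zero
    asymptotic data would contradict the estimate. *)
Lemma singular_kernel (p1 p2 m1 m2 : C) : (p1 * m2 - p2 * m1 = 0)%C ->
  exists c0 c1 : C, (c0 * p1 + c1 * p2 = 0)%C /\ (c0 * m1 + c1 * m2 = 0)%C /\ ~ (c0 = RtoC 0 /\ c1 = RtoC 0).
Proof.
  move=> H.
  case: (Ceq_dec p1 0) => [hp1|hp1].
    case: (Ceq_dec p2 0) => [hp2|hp2].
      case: (Ceq_dec m1 0) => [hm1|hm1].
        case: (Ceq_dec m2 0) => [hm2|hm2].
          exists (RtoC 1), (RtoC 0); rewrite hp1 hm1; split; first ring.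
          by split; [ring|move=> [/RtoC_inj h _]; lra].
        exists m2, (- m1)%C; rewrite hp1 hp2; split; first ring.
        by split; [ring|move=> [h _]].
      exists m2, (- m1)%C; rewrite hp1 hp2; split; first ring.
      split; first ring.
      by move=> [_ h]; apply: hm1; have -> : m1 = (- - m1)%C; [ring|rewrite h; ring].
    exists p2, (- p1)%C; split; first ring.
    split; last by move=> [h _].
    by have -> : (p2 * m1 + - p1 * m2 = - (p1 * m2 - p2 * m1))%C; [ring|rewrite H; ring].
  exists p2, (- p1)%C; split; first ring.
  split; last first.
    by move=> [_ h]; apply: hp1; have -> : p1 = (- - p1)%C; [ring|rewrite h; ring].
  by have -> : (p2 * m1 + - p1 * m2 = - (p1 * m2 - p2 * m1))%C; [ring|rewrite H; ring].
Qed.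

Lemma final_size_eq0 {d} (E : wave_data d) (phi dphi : R -> vec d -> C) (xi : vec d) :
  final_size E phi dphi xi <= 0 -> phi (wT E) xi = RtoC 0 /\ dphi (wT E) xi = RtoC 0.
Proof.
  rewrite /final_size => h.
  have r1 := Rpower_pos (bracket (vnorm xi)) (1 + delta_zero E); have r2 := Rpower_pos (bracket (vnorm xi)) (delta_zero E).
  have c1 := Cmod_ge_0 (phi (wT E) xi); have c2 := Cmod_ge_0 (dphi (wT E) xi).
  have m1 := Rmult_le_pos _ _ (Rlt_le _ _ r1) c1; have m2 := Rmult_le_pos _ _ (Rlt_le _ _ r2) c2.
  split; apply: Cmod_eq_0.
  - by apply: (Rmult_eq_reg_l (Rpower (bracket (vnorm xi)) (1 + delta_zero E))); lra.
  - by apply: (Rmult_eq_reg_l (Rpower (bracket (vnorm xi)) (delta_zero E))); lra.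
Qed.

Theorem theorem3p7 (d : nat) (hd : (1 <= d)%nat) (E : wave_data d)
    (hE : admissible E) (gamma : C) (hgamma : is_gamma E gamma) :
  exists m0 : nat,
  forall (rho1 : R) (D N Rem : nat -> R -> vec d -> mat2),
    0 < rho1 < 1 ->
    diagonalization E gamma rho1 D N Rem ->
  forall mP : nat, (m0 <= mP)%nat ->
  exists rhos : R, 0 < rhos <= rho1 /\
  forall rho0 : R, 0 < rho0 <= rhos ->
    (exists K : R,
       forall phi0 phi1 : vec d -> C,
       exists phi dphi : R -> vec d -> C,
         is_unique_solution E (has_final_data E phi0 phi1) phi dphi /\
         exists vp vm : vec d -> C,
           has_asymptotic_data E gamma rho0 N mP vp vm phi dphi /\
           forall xi : vec d,
             asymptotic_size E gamma vp vm xi <=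
               K * (Rpower (bracket (vnorm xi)) (delta_plus E)
                    * final_size E phi dphi xi)) /\
    (exists K : R,
       forall vp vm : vec d -> C,
       exists phi dphi : R -> vec d -> C,
         is_unique_solution E
           (has_asymptotic_data E gamma rho0 N mP vp vm) phi dphi /\
         forall xi : vec d,
           final_size E phi dphi xi <=
             K * (Rpower (bracket (vnorm xi)) (delta_plus E)
                  * asymptotic_size E gamma vp vm xi)).
Proof.
  have [T0 [hl [be0 _]]] := hE.
  have s0 : 0 < aP E + 1.
    by rewrite /aP; have := Rmin_glb_lt _ _ _ hl (_ : -1 < -1 + wbeta E); lra.
  have [kd [_ HJ]] := dbracket_comparison d hd.
  have J0 xi : 0 < dbracket E xi by have [h _] := HJ E xi hl; lra.
  have [n Hn] := INR_unbounded (Rabs (Re gamma) / (aP E + 1)).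
  exists (S n) => rho1 D N Rem Hr Hdiag mP HmP.
  have hm : (1 <= mP)%nat by lia.
  have hmg : Rabs (Re gamma) <= INR mP * (aP E + 1).
    have h : INR n <= INR mP by apply: le_INR; lia.
    have := Rmult_le_compat_r _ _ _ (Rlt_le _ _ s0) (Rlt_le _ _ (Rlt_le_trans _ _ _ Hn h)).
    have -> : Rabs (Re gamma) / (aP E + 1) * (aP E + 1) = Rabs (Re gamma) by field; lra.
    by [].
  have [rhos [Hrs HK]] := two_sided_estimate d E gamma rho1 D N Rem mP hd hE Hr Hdiag hm hmg.
  exists rhos; split => // rho0 Hrho0.
  have r0 : 0 < rho0 by lra.
  have [K [K0 HKxi]] := HK rho0 Hrho0.
  have Huniq xi u v : is_classical_solution (wT E) (wave_damping E xi) (wave_stiffness E xi) u v ->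
      u (wT E) = RtoC 0 -> v (wT E) = RtoC 0 -> forall t, 0 < t <= wT E -> u t = RtoC 0.
    move=> Hs h0 h1 t Ht; apply: (proj1 (classical_solution_unique (wT E) _ _ u v T0 _ _ Hs h0 h1 t Ht)) => s Hs'.
      exact: (proj1 (wave_coefficients_Ccont E xi s hE Hs')).
    exact: (proj2 (wave_coefficients_Ccont E xi s hE Hs')).
  have TT : Rmin (wT E) (wT E) = wT E by rewrite Rmin_left //; lra.
  have clampT t : 0 < t <= wT E -> Rmin t (wT E) = t by move=> Ht; rewrite Rmin_left //; lra.
  pose dsub (f g : R -> vec d -> C) xi t := (1 * f (Rmin t (wT E)) xi + - (1) * g (Rmin t (wT E)) xi)%C.
  have Hdiff phi dphi psi dpsi xi : solves_W E phi dphi -> solves_W E psi dpsi ->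
      is_classical_solution (wT E) (wave_damping E xi) (wave_stiffness E xi) (dsub psi phi xi) (dsub dpsi dphi xi).
    by move=> h1 h2; apply: classical_solution_lin; exact: solves_W_classical.
  have dsub0 (f g : R -> vec d -> C) xi t : 0 < t <= wT E -> dsub f g xi t = RtoC 0 -> f t xi = g t xi.
    move=> Ht; rewrite /dsub clampT // => h; apply: Cminus_0_eq; rewrite -h; ring.
  have limits xi u v (Hs : is_classical_solution (wT E) (wave_damping E xi) (wave_stiffness E xi) u v) :
    exists l1 l2, asymptotic_limits E gamma N mP xi u v l1 l2.
    by have [l1 [l2 [h1 [h2 _]]]] := HKxi xi u v Hs; exists l1, l2.
  have sizes xi u v a b (Hs : is_classical_solution (wT E) (wave_damping E xi) (wave_stiffness E xi) u v) :
    asymptotic_limits E gamma N mP xi u v a b ->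
    let A := asymptotic_size E gamma (fun _ => a) (fun _ => b) xi in
    let F := final_size E (fun s _ => u s) (fun s _ => v s) xi in
    A <= K * (Rpower (bracket (vnorm xi)) (delta_plus E) * F) /\
    F <= K * (Rpower (bracket (vnorm xi)) (delta_plus E) * A).
    move=> [ha hb]; have [l1 [l2 [h1 [h2 h3]]]] := HKxi xi u v Hs.
    by rewrite (tends_at_0_unique _ _ _ ha h1) (tends_at_0_unique _ _ _ hb h2).
  have trivial_limits xi u v : is_classical_solution (wT E) (wave_damping E xi) (wave_stiffness E xi) u v ->
      asymptotic_limits E gamma N mP xi u v 0 0 -> u (wT E) = RtoC 0 /\ v (wT E) = RtoC 0.
    move=> Hs Hl; have [_ h] := sizes xi u v 0 0 Hs Hl.
    apply: (final_size_eq0 E (fun s _ => u s) (fun s _ => v s) xi).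
    move: h; rewrite /asymptotic_size Cmod_0 !Rmult_0_r Rplus_0_r !Rmult_0_r; exact.
  have sizeF (phi dphi : R -> vec d -> C) xi : final_size E (fun s _ => phi (Rmin s (wT E)) xi) (fun s _ => dphi (Rmin s (wT E)) xi) xi
     = final_size E phi dphi xi by rewrite /final_size TT.
  split; exists K.
  - move=> phi0 phi1.
    have [f Hf] := functional_choice _ (fun xi => strong_solution_exists E xi (phi0 xi) (phi1 xi) hE).
    pose phi t xi := fst (f xi) t. pose dphi t xi := snd (f xi) t.
    have Hsol : solves_W E phi dphi.
      by apply: solves_W_of_strong => // xi t Ht; have [_ [_ h]] := Hf xi; exact: h.
    exists phi, dphi; split.
      split => //; split; first by move=> xi; have [h1 [h2 _]] := Hf xi.
      move=> psi dpsi Hpsi Hfin t xi Ht; apply: dsub0 => //.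
      have [p1 p2] := Hfin xi; have [q1 [q2 _]] := Hf xi.
      apply: (Huniq xi _ (dsub dpsi dphi xi)) => //; first exact: Hdiff.
        by rewrite /dsub TT p1 /phi q1; ring.
      by rewrite /dsub TT p2 /dphi q2; ring.
    have cl xi := solves_W_classical E phi dphi xi T0 Hsol.
    have [l Hl] := functional_choice (fun xi (ab : C * C) => asymptotic_limits E gamma N mP xi (fun t => phi (Rmin t (wT E)) xi)
        (fun t => dphi (Rmin t (wT E)) xi) (fst ab) (snd ab))
      (fun xi => let '(ex_intro l1 (ex_intro l2 h)) := limits xi _ _ (cl xi) in ex_intro _ (l1, l2) h).
    exists (fun xi => fst (l xi)), (fun xi => snd (l xi)); split.
      by apply/has_asymptotic_data_limits.
    move=> xi; have [h _] := sizes xi _ _ _ _ (cl xi) (Hl xi).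
    by rewrite sizeF in h.
  - move=> vp vm.
    have Hex xi : exists uv : (R -> C) * (R -> C), is_strong_solution E xi (fst uv) (snd uv) /\
        asymptotic_limits E gamma N mP xi (fst uv) (snd uv) (vp xi) (vm xi).
      have [[u1 v1] /= [hu1 [hv1 S1]]] := strong_solution_exists E xi 1 0 hE.
      have [[u2 v2] /= [hu2 [hv2 S2]]] := strong_solution_exists E xi 0 1 hE.
      have [p1 [m1 L1]] := limits xi _ _ (strong_solution_classical E xi _ _ S1).
      have [p2 [m2 L2]] := limits xi _ _ (strong_solution_classical E xi _ _ S2).
      have det : (p1 * m2 - p2 * m1)%C <> RtoC 0.
        move=> H; have [c0 [c1 [k1 [k2 k3]]]] := singular_kernel p1 p2 m1 m2 H.
        have L := asymptotic_limits_lin E gamma N mP xi _ _ _ _ _ _ _ _ c0 c1 L1 L2.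
        rewrite k1 k2 in L.
        have [z1 z2] := trivial_limits xi _ _ (strong_solution_classical E xi _ _ (strong_solution_lin E xi _ _ _ _ c0 c1 S1 S2)) L.
        apply: k3; split; [rewrite -z1 hu1 hu2|rewrite -z2 hv1 hv2]; ring.
      pose c0 := ((vp xi * m2 - p2 * vm xi) / (p1 * m2 - p2 * m1))%C.
      pose c1 := ((p1 * vm xi - m1 * vp xi) / (p1 * m2 - p2 * m1))%C.
      exists ((fun t => c0 * u1 t + c1 * u2 t)%C, (fun t => c0 * v1 t + c1 * v2 t)%C) => /=.
      split; first exact: strong_solution_lin.
      have -> : vp xi = (c0 * p1 + c1 * p2)%C by rewrite /c0 /c1; field; exact: det.
      have -> : vm xi = (c0 * m1 + c1 * m2)%C by rewrite /c0 /c1; field; exact: det.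
      exact: asymptotic_limits_lin.
    have [f Hf] := functional_choice _ Hex.
    pose phi t xi := fst (f xi) t. pose dphi t xi := snd (f xi) t.
    have Hsol : solves_W E phi dphi.
      by apply: solves_W_of_strong => // xi t Ht; have [h _] := Hf xi; exact: h.
    have Hasym : has_asymptotic_data E gamma rho0 N mP vp vm phi dphi.
      apply/has_asymptotic_data_iff => // xi; have [_ [h1 h2]] := Hf xi; split.
        apply: tends_at_0_ext Rlt_0_1 _ h1 => t Ht.
        by have [-> ->] := varphi_local E gamma N mP (fun s _ => fst (f xi) s) (fun s _ => snd (f xi) s) phi dphi t xi erefl erefl.
      apply: tends_at_0_ext Rlt_0_1 _ h2 => t Ht.
      by have [_ ->] := varphi_local E gamma N mP (fun s _ => fst (f xi) s) (fun s _ => snd (f xi) s) phi dphi t xi erefl erefl.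
    exists phi, dphi; split.
      split => //; split => //.
      move=> psi dpsi Hpsi Has t xi Ht; apply: dsub0 => //.
      have Hd := Hdiff phi dphi psi dpsi xi Hsol Hpsi.
      have A1 : asymptotic_limits E gamma N mP xi _ _ _ _ := proj1 (has_asymptotic_data_limits E gamma rho0 N mP vp vm phi dphi T0 r0 J0) Hasym xi.
      have A2 : asymptotic_limits E gamma N mP xi _ _ _ _ := proj1 (has_asymptotic_data_limits E gamma rho0 N mP vp vm psi dpsi T0 r0 J0) Has xi.
      have L := asymptotic_limits_lin E gamma N mP xi _ _ _ _ _ _ _ _ 1 (- (1))%C A2 A1.
      have e1 : (1 * vp xi + - (1) * vp xi = 0)%C by ring.
      have e2 : (1 * vm xi + - (1) * vm xi = 0)%C by ring.
      rewrite e1 e2 in L.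
      have [z1 z2] := trivial_limits xi _ _ Hd L.
      exact: (Huniq xi _ (dsub dpsi dphi xi)).
    move=> xi.
    have A1 : asymptotic_limits E gamma N mP xi _ _ _ _ := proj1 (has_asymptotic_data_limits E gamma rho0 N mP vp vm phi dphi T0 r0 J0) Hasym xi.
    have [_ h] := sizes xi _ _ _ _ (solves_W_classical E phi dphi xi T0 Hsol) A1.
    by rewrite sizeF in h.
Qed.
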